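(* Let $p\in[2,+\infty[$ and assume conditions (C1)--(C5) of the context. Then for any sufficiently large integer $m$ the implicit time discretization scheme $$u^m(t_0)=0,\qquad u^m(t_1)=u_0+\delta_mA^m_{t_0}(u^m(t_1)),$$ $$u^m(t_{i+1})=u^m(t_i)+\delta_mA^m_{t_i}(u^m(t_{i+1}))+\sum_{j=1}^r\tilde B^{m,j}_{t_i}(u^m(t_i))\,(W^j_{t_{i+1}}-W^j_{t_i}),\quad1\le i<m,$$ has a unique ($V$-valued) solution $\{u^m(t_i):i=0,1,\dots,m\}$ such that $E\big(|u^m(t_i)|_V^p\big)<+\infty$ for each $i=0,\dots,m$. If in addition to (C1)--(C5) conditions (H2) and (H3) of the context also hold, then there is an integer $m_0\ge1$ such that for every $m\ge m_0$ and $n\ge1$ the implicit space-time discretization scheme $$u^{n,m}(t_0)=0,\qquad u^{n,m}(t_1)=\Pi_nu_0+\delta_m\Pi_nA^m_{t_0}(u^{n,m}(t_1)),$$ $$u^{n,m}(t_{i+1})=u^{n,m}(t_i)+\delta_m\Pi_nA^m_{t_i}(u^{n,m}(t_{i+1}))+\sum_{j=1}^r\Pi_n\tilde B^{m,j}_{t_i}(u^{n,m}(t_i))\,(W^j_{t_{i+1}}-W^j_{t_i}),\quad1\le i<m,$$ has a unique ($V_n$-valued) solution $\{u^{n,m}(t_i):i=0,1,\dots,m\}$ satisfying $E\big(|u^{n,m}(t_i)|_V^p\big)<+\infty$ for each $i=0,1,\dots,m$ and $n\ge1$.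
   Context: $V$ is a separable reflexive Banach space with norm $|\cdot|_V$, embedded continuously and densely into a Hilbert space $H$ with inner product $(\cdot,\cdot)$ and norm $|\cdot|_H$. $H$ is identified with its dual by means of $(\cdot,\cdot)$, so that $V\hookrightarrow H\hookrightarrow V^*$ with dense and continuous embeddings; $\langle v,x\rangle=\langle x,v\rangle$ denotes the duality product of $v\in V$, $x\in V^*$, and $\langle v,h\rangle=(v,h)$ for $h\in H$. $(\Omega,\mathcal F,(\mathcal F_t)_{t\ge0},P)$ is a stochastic basis satisfying the usual conditions and carrying an $r$-dimensional Wiener martingale $W=(W^1,\dots,W^r)$ with respect to $(\mathcal F_t)$. Fix $T>0$ and let $q=p/(p-1)$. $L^1$ is the space of integrable real functions on $[0,T]$. The operators $A:[0,T]\times V\times\Omega\to V^*$ and $B=(B^1,\dots,B^r):[0,T]\times V\times\Omega\to H^r$ are such that for all $v,w\in V$ and $1\le j\le r$, $\langle w,A_s(v)\rangle$ and $(B^j_s(v),w)$ are adapted processes. All processes considered are adapted to $(\mathcal F_t)$. Conditions: (C1) Almost surely, for all $t\in[0,T]$, $x,y\in V$: $2\langle x-y,A_t(x)-A_t(y)\rangle+\sum_{j=1}^r|B^j_t(x)-B^j_t(y)|_H^2\le0$. (C2) There exist non-negative integrable functions $K_1,\bar K_1$ and an integrable function $\lambda:\,]0,T]\to\,]0,+\infty[$ such that almost surely, for all $t\in]0,T]$, $x\in V$: $2\langle x,A_t(x)\rangle+\sum_{j=1}^r|B^j_t(x)|_H^2+\lambda(t)|x|_V^p\le K_1(t)|x|_H^2+\bar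 K_1(t)$. (C3) Almost surely, for all $t\in[0,T]$, $x,y,z\in V$: $\lim_{\varepsilon\to0}\langle A_t(x+\varepsilon y),z\rangle=\langle A_t(x),z\rangle$. (C4) There exist a non-negative $K_2\in L^1$ and a constant $\alpha\ge1$ such that almost surely, for all $t\in]0,T]$, $x\in V$: $|A_t(x)|_{V^*}^q\le\alpha\lambda^q(t)|x|_V^p+\lambda^{q-1}(t)K_2(t)$ (with $\lambda$ from (C2)). (C5) $u_0:\Omega\to H$ is $\mathcal F_0$-measurable and $E(|u_0|_H^2)<+\infty$. Space discretization: for every $n\ge1$, $V_n\subset V$ is a finite dimensional subspace and $\Pi_n:V^*\to V_n$ a bounded linear operator. Conditions: (H2) $\Pi_nx=x$ for $x\in V_n$, and for all $h,k\in H$, $x\in V$, $y\in V^*$: $(\Pi_nh,k)=(h,\Pi_nk)$ and $\langle\Pi_nx,y\rangle=\langle x,\Pi_ny\rangle$. (H3) For every $h\in H$: $|\Pi_nh|_H\le|h|_H$ and $\lim_n|h-\Pi_nh|_H=0$. Time discretization: for $m\ge1$ let $\delta_m=T/m$, $t_i=i\delta_m$, $0\le i\le m$. For $x\in V$: $A^m_{t_i}(x)=\frac1{\delta_m}\int_{t_i}^{t_{i+1}}A_s(x)\,ds\in V^*$ for $0\le i\le m-1$, and $\tilde B^{m,j}_{t_i}(x)=\frac1{\delta_m}\int_{t_{i-1}}^{t_i}B^j_s(x)\,ds\in H$ for $1\le i\le m$. The equations of the first scheme are understood in $V^*$. *)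

(* Defs.v *)
From HB Require Import structures.
From mathcomp Require Import all_boot all_order all_algebra.
From mathcomp Require Import all_classical all_reals all_analysis ring.

Set Implicit Arguments.
Unset Strict Implicit.
Unset Printing Implicit Defensive.

Import Order.TTheory GRing.Theory Num.Theory.
Import numFieldNormedType.Exports.

Local Open Scope classical_set_scope.
Local Open Scope ring_scope.

(** * Topological dual of a real normed space, with the operator norm *)

Section Dual.
Context {R : realType} (E : normedModType R).

Definition dual_pred : {pred E -> R^o} :=
  [pred f : E -> R^o | `[< linear f /\ continuous f >]].

Lemma dual_predP (f : E -> R^o) :
  reflect (linear f /\ continuous f) (f \in dual_pred).
Proof. exact: asboolP. Qed.

Lemma dual_submod_closed : submod_closed dual_pred.
Proof.
split=> [|a f g /dual_predP[lf cf] /dual_predP[lg cg]]; apply/dual_predP; split.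
- by move=> k x y; rewrite /= scaler0 addr0.
- by move=> x; exact: cvg_cst.
- move=> k x y; rewrite /= !fctE lf lg !scalerDr addrACA; congr (_ + _).
  by congr (_ + _); rewrite !scalerA mulrC.
- by move=> x; apply: cvgD; [apply: cvgZr; exact: cf|exact: cg].
Qed.

HB.instance Definition _ :=
  GRing.isSubmodClosed.Build R (E -> R^o) dual_pred dual_submod_closed.

Record dual := Dual { dual_fun :> E -> R^o ; _ : dual_fun \in dual_pred }.

HB.instance Definition _ := [isSub for dual_fun].
HB.instance Definition _ := [Choice of dual by <:].
HB.instance Definition _ := [SubChoice_isSubLmodule of dual by <:].

Lemma dual_ext (f g : dual) : f =1 g -> f = g.
Proof. by move=> fg; apply: val_inj; apply/funext. Qed.

Lemma dualD (f g : dual) x : (f + g) x = f x + g x.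
Proof. by []. Qed.

Lemma dualN (f : dual) x : (- f) x = - f x.
Proof. by []. Qed.

Lemma dualZ a (f : dual) x : (a *: f) x = a * f x.
Proof. by []. Qed.

Lemma dual_linear (f : dual) : linear f.
Proof. by case: f => f /= /dual_predP[]. Qed.

Lemma dual_continuous (f : dual) : continuous f.
Proof. by case: f => f /= /dual_predP[]. Qed.

Definition dual_norm (f : dual) : R := sup [set `|f x| | x in [set x | `|x| <= 1]].

Lemma dual_has_sup (f : dual) : has_sup [set `|f x| | x in [set x | `|x| <= 1]].
Proof.
split; first by exists `|f 0|, 0 => //=; rewrite normr0.
pose F : {linear E -> R^o} :=
  HB.pack (f : E -> R^o) (GRing.isLinear.Build _ _ _ _ f (dual_linear f)).
have /linear_boundedP : bounded_near F (nbhs 0).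
  by apply: continuous_linear_bounded; exact: dual_continuous.
move=> /pinfty_ex_gt0[M M0 /= FM]; exists M => _ [x /= x1 <-].
by rewrite (le_trans (FM x))// ler_piMr// ltW.
Qed.

Lemma dual_norm_ub (f : dual) x : `|x| <= 1 -> `|f x| <= dual_norm f.
Proof. by move=> x1; apply: (sup_upper_bound (dual_has_sup f)); exists x. Qed.

Lemma dual_norm_le (f : dual) c :
  (forall x, `|x| <= 1 -> `|f x| <= c) -> dual_norm f <= c.
Proof.
move=> fc; apply: sup_le_ub; first by have [] := dual_has_sup f.
by move=> _ [x /= x1 <-]; exact: fc.
Qed.

Lemma dual_normD f g : dual_norm (f + g) <= dual_norm f + dual_norm g.
Proof.
apply: dual_norm_le => x x1; rewrite dualD (le_trans (ler_normD _ _))//.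
by rewrite lerD// dual_norm_ub.
Qed.

Lemma dual_normZ (a : R) f : dual_norm (a *: f) = `|a| * dual_norm f.
Proof.
have le b g : dual_norm (b *: g) <= `|b| * dual_norm g.
  apply: dual_norm_le => x x1.
  by rewrite dualZ normrM ler_wpM2l// dual_norm_ub.
apply/eqP; rewrite eq_le le /=; have [->|a0] := eqVneq a 0.
  rewrite normr0 mul0r (le_trans _ (@dual_norm_ub _ 0 _)) ?normr0//.
rewrite mulrC -ler_pdivlMr ?normr_gt0// mulrC -normfV.
by rewrite (le_trans _ (le _ _))// scalerA mulVf// scale1r.
Qed.

Lemma dual_norm0_eq0 f : dual_norm f = 0 -> f = 0.
Proof.
move=> f0; apply: dual_ext => x; have [->|x0] := eqVneq x 0.
  have := dual_linear f 1 0 0; rewrite !scale1r addr0 => /eqP.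
  by rewrite -subr_eq0 opprD addrA subrr sub0r oppr_eq0 => /eqP.
have xn0 : `|x| != 0 by rewrite normr_eq0.
have := @dual_norm_ub f (`|x|^-1 *: x).
rewrite normrZ normfV normr_id mulVf// => /(_ (lexx _)).
rewrite f0 normr_le0 => /eqP fx.
have := dual_linear f `|x| (`|x|^-1 *: x) 0.
rewrite addr0 scalerA divff// scale1r fx scaler0 add0r => ->.
have := dual_linear f 1 0 0; rewrite !scale1r addr0 => /eqP.
by rewrite -subr_eq0 opprD addrA subrr sub0r oppr_eq0 => /eqP.
Qed.

HB.instance Definition _ :=
  @Lmodule_isNormed.Build R dual dual_norm dual_normD dual_normZ dual_norm0_eq0.

End Dual.

Section Spaces.
Context {R : realType}.

Definition separable (E : topologicalType) : Prop :=
  exists D : set E, countable D /\ dense D.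

Definition reflexive_space (E : normedModType R) : Prop :=
  forall phi : dual (dual E), exists x : E, forall f : dual E, phi f = f x.

Definition finite_dim_subspace (E : normedModType R) (S : set E) : Prop :=
  exists k (e : 'I_k -> E), S = range (fun c : 'I_k -> R => \sum_i c i *: e i).

(* The integral of a vector-valued function on a set of reals in the weak
   sense: the vector [I] such that [phi I] is the Lebesgue integral of
   [phi \o f] for every continuous linear form [phi], and 0 if there is none. *)
Definition vintegral (E : normedModType R) (D : set R) (f : R -> E) : E :=
  xget 0 [set I | forall phi : dual E,
    (@lebesgue_measure R).-integrable D (fun s => (phi (f s) : R)%:E) /\
    phi I = \int[lebesgue_measure]_(s in D) (phi (f s) : R)].

(* [H] is a Hilbert space for [inner], and [emb] embeds [V] into it. *)
Record gelfand_triple (V H : completeNormedModType R) := GelfandTriple {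
  inner : H -> H -> R ;
  innerC : forall x y, inner x y = inner y x ;
  inner_linear : forall y, linear ((inner^~ y) : H -> R^o) ;
  inner_norm : forall x, inner x x = `|x| ^+ 2 ;
  emb : {linear V -> H} ;
  emb_continuous : continuous emb ;
  emb_inj : injective emb ;
  emb_dense : dense (range emb) }.

End Spaces.

Section Embeddings.
Context {R : realType} {V H : completeNormedModType R} (G : gelfand_triple V H).

Lemma cauchy_schwarz x y : `|inner G x y| <= `|x| * `|y|.
Proof.
have [->|y0] := eqVneq y 0.
  rewrite innerC; have := inner_linear G x 1 0 0.
  rewrite !scale1r addr0 => /eqP; rewrite -subr_eq0 opprD addrA subrr sub0r.
  by rewrite oppr_eq0 => /eqP ->; rewrite normr0 mulr_ge0.
have yn : 0 < `|y| by rewrite normr_gt0.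
have lin a u v w : inner G (a *: u + v) w = a * inner G u w + inner G v w.
  exact: inner_linear.
set c := inner G x y.
set b := - (c / `|y| ^+ 2).
have h : 0 <= b * (b * `|y| ^+ 2 + c) + (b * c + `|x| ^+ 2).
  have := exprn_ge0 2 (normr_ge0 (b *: y + x)).
  rewrite -(inner_norm G (_ + _)) lin (innerC G y) (innerC G x) !lin !inner_norm.
  by rewrite (innerC G y x).
have y2 : 0 < `|y| ^+ 2 by rewrite exprn_gt0.
rewrite -(@ler_pXn2r _ 2) ?nnegrE ?mulr_ge0// exprMn -ler_pdivrMr//.
rewrite real_normK ?num_real// -subr_ge0; move: h; congr (_ <= _).
by rewrite /b; field; rewrite gt_eqF.
Qed.

Lemma to_dual_subproof (h : H) :
  ((fun v => inner G (emb G v) h) : V -> R^o) \in @dual_pred R V.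
Proof.
apply/dual_predP; split=> [a u v|].
  by rewrite linearP; exact: inner_linear.
pose F : {linear H -> R^o} := HB.pack ((inner G)^~ h : H -> R^o)
  (GRing.isLinear.Build _ _ _ _ ((inner G)^~ h : H -> R^o) (inner_linear G h)).
have cF : continuous F.
  apply/linear_bounded_continuous/linear_boundedP.
  near=> r => x /=; rewrite (le_trans (cauchy_schwarz _ _))// mulrC.
  by rewrite ler_wpM2r.
by move=> v; apply: (@continuous_comp _ _ _ (emb G) F);
  [exact: emb_continuous|exact: cF].
Unshelve. all: by end_near. Qed.

(* The embedding of [H] into the dual of [V]. *)
Definition to_dual (h : H) : dual V := Dual (to_dual_subproof h).

End Embeddings.

(** * Stochastic basis *)

Section Stochastic.
Context {R : realType} {d : measure_display} {Omega : measurableType d}.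
Variable P : probability Omega R.

Definition borel (E : ptopologicalType) := g_sigma_algebraType (@open E).

Definition measurable_wrt (S : set (set Omega)) {d'} {E : measurableType d'}
    (X : Omega -> E) : Prop :=
  measurable_fun setT (X : g_sigma_algebraType S -> E).

Definition usual_filtration (F : R -> set (set Omega)) : Prop :=
  [/\ forall t : R, 0 <= t -> sigma_algebra setT (F t) /\ F t `<=` measurable,
      forall s t : R, 0 <= s -> s <= t -> F s `<=` F t,
      forall t : R, 0 <= t -> \bigcap_(s in [set s | t < s]) F s `<=` F t &
      forall N, P.-negligible N -> F 0 N].

(* The last clause says that [W t - W s] is independent of [F s] and has the
   Gaussian law of covariance [(t - s) * Id]. *)
Definition wiener_martingale (F : R -> set (set Omega)) (r : nat)
    (W : 'I_r -> R -> Omega -> R) : Prop :=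
  [/\ forall j (t : R), 0 <= t -> measurable_wrt (F t) (W j t),
      {ae P, forall w, forall j, W j 0 w = 0},
      {ae P, forall w, forall j, {within `[0, +oo[, continuous (W j ^~ w)}} &
      forall s t : R, 0 <= s -> s < t -> forall D, F s D ->
      forall U : 'I_r -> set R, (forall j, measurable (U j)) ->
      (P (D `&` \bigcap_j [set w | U j (W j t w - W j s w)%R]) =
       P D * \prod_(j < r) normal_prob 0 (Num.sqrt (t - s)) (U j))%E].

(* Adaptedness is joined with joint measurability in time and chance, so that
   time integrals of the process are random variables. *)
Definition adapted_process (F : R -> set (set Omega)) (T : R)
    (X : R -> Omega -> R) : Prop :=
  (forall t : R, 0 <= t <= T -> measurable_wrt (F t) (X t)) /\
  measurable_fun (`[0, T] `*` setT) (fun z : R * Omega => X z.1 z.2).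

End Stochastic.

(** * Assumptions on the coefficients *)

Section Conditions.
Context {R : realType} {V H : completeNormedModType R} (G : gelfand_triple V H).
Context {d : measure_display} {Omega : measurableType d}.
Variables (P : probability Omega R) (T : R) (r : nat).
Variables (A : R -> V -> Omega -> dual V) (B : 'I_r -> R -> V -> Omega -> H).

Definition adapted_coefficients (F : R -> set (set Omega)) : Prop :=
  forall v w : V,
    adapted_process F T (fun s om => A s v om w) /\
    forall j, adapted_process F T (fun s om => inner G (B j s v om) (emb G w)).

Definition monotonicity : Prop :=
  {ae P, forall om, forall (t : R) (x y : V), 0 <= t <= T ->
    2 * (A t x om - A t y om) (x - y)
    + \sum_(j < r) `|B j t x om - B j t y om| ^+ 2 <= 0}.

Definition coercivity (p : R) (K1 K1bar lam : R -> R) : Prop :=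
  {ae P, forall om, forall (t : R) (x : V), 0 < t <= T ->
    2 * A t x om x + \sum_(j < r) `|B j t x om| ^+ 2 + lam t * `|x| `^ p
    <= K1 t * `|emb G x| ^+ 2 + K1bar t}.

Definition hemicontinuity : Prop :=
  {ae P, forall om, forall (t : R) (x y z : V), 0 <= t <= T ->
    A t (x + eps *: y) om z @[eps --> (0 : R)^'] --> A t x om z}.

Definition growth (p q alpha : R) (lam K2 : R -> R) : Prop :=
  {ae P, forall om, forall (t : R) (x : V), 0 < t <= T ->
    `|A t x om| `^ q
    <= alpha * lam t `^ q * `|x| `^ p + lam t `^ (q - 1) * K2 t}.

Definition nonneg_integrable (K : R -> R) : Prop :=
  (forall t : R, 0 <= t <= T -> 0 <= K t) /\
  (@lebesgue_measure R).-integrable `[0, T] (EFin \o K).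

Definition pos_integrable (lam : R -> R) : Prop :=
  (forall t : R, 0 < t <= T -> 0 < lam t) /\
  (@lebesgue_measure R).-integrable `]0, T] (EFin \o lam).

Definition initial_condition (F : R -> set (set Omega)) (u0 : Omega -> H) :=
  measurable_wrt (F 0) (u0 : Omega -> borel H) /\
  ('E_P[(fun om => `|u0 om| ^+ 2)%R] < +oo)%E.

End Conditions.

(** * Space discretization *)

Section Projections.
Context {R : realType} {V H : completeNormedModType R} (G : gelfand_triple V H).
Variables (Vn : nat -> set V) (Pi : nat -> {linear dual V -> V}).

Local Notation "'PiH' n h" := (emb G (Pi n (to_dual G h)))
  (at level 10, n at next level, h at next level).

Definition space_discretization : Prop := forall n, (1 <= n)%N ->
  [/\ finite_dim_subspace (Vn n), continuous (Pi n) &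
      forall f, Vn n (Pi n f)].

Definition self_adjoint_projections : Prop := forall n, (1 <= n)%N ->
  [/\ forall x : V, Vn n x -> Pi n (to_dual G (emb G x)) = x,
      forall h k : H, inner G (PiH n h) k = inner G h (PiH n k) &
      forall (x : V) (y : dual V),
        y (Pi n (to_dual G (emb G x))) = to_dual G (emb G (Pi n y)) x].

Definition contractive_approximation : Prop := forall h : H,
  (forall n, (1 <= n)%N -> `|PiH n h| <= `|h|) /\
  `|h - PiH n h| @[n --> \oo] --> (0 : R).

End Projections.

(** * Implicit schemes *)

Section Schemes.
Context {R : realType} {V H : completeNormedModType R} (G : gelfand_triple V H).
Context {d : measure_display} {Omega : measurableType d}.
Variables (P : probability Omega R) (F : R -> set (set Omega)) (T p : R).
Variables (r : nat) (W : 'I_r -> R -> Omega -> R).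
Variables (A : R -> V -> Omega -> dual V) (B : 'I_r -> R -> V -> Omega -> H).
Variables (u0 : Omega -> H) (m : nat).

Definition step : R := T / m%:R.

Definition grid (i : nat) : R := i%:R * step.

Definition avgA (i : nat) (x : V) (om : Omega) : dual V :=
  step^-1 *: vintegral `[grid i, grid i.+1] (fun s => A s x om).

Definition avgB (j : 'I_r) (i : nat) (x : V) (om : Omega) : H :=
  step^-1 *: vintegral `[grid i.-1, grid i] (fun s => B j s x om).

Definition dW (j : 'I_r) (i : nat) (om : Omega) : R :=
  W j (grid i.+1) om - W j (grid i) om.

(* Only the values [u i] with [i <= m] are relevant below. *)
Definition grid_adapted (u : nat -> Omega -> V) : Prop :=
  forall i, (i <= m)%N -> measurable_wrt (F (grid i)) (u i : Omega -> borel V).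

Definition finite_moments (u : nat -> Omega -> V) : Prop :=
  forall i, (i <= m)%N -> ('E_P[(fun om => `|u i om| `^ p)%R] < +oo)%E.

Definition grid_indistinguishable (u v : nat -> Omega -> V) : Prop :=
  {ae P, forall om, forall i, (i <= m)%N -> u i om = v i om}.

Definition time_scheme (u : nat -> Omega -> V) : Prop :=
  grid_adapted u /\
  {ae P, forall om,
    [/\ u 0%N om = 0,
        to_dual G (emb G (u 1%N om)) =
          to_dual G (u0 om) + step *: avgA 0 (u 1%N om) om &
        forall i, (1 <= i < m)%N ->
        to_dual G (emb G (u i.+1 om)) =
          to_dual G (emb G (u i om)) + step *: avgA i (u i.+1 om) om
          + to_dual G (\sum_(j < r) dW j i om *: avgB j i (u i om) om)]}.

Definition space_time_scheme (Vn : set V) (Pin : {linear dual V -> V})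
    (u : nat -> Omega -> V) : Prop :=
  [/\ grid_adapted u,
      forall i, (i <= m)%N -> forall om, Vn (u i om) &
      {ae P, forall om,
        [/\ u 0%N om = 0,
            u 1%N om =
              Pin (to_dual G (u0 om)) + step *: Pin (avgA 0 (u 1%N om) om) &
            forall i, (1 <= i < m)%N ->
            u i.+1 om =
              u i om + step *: Pin (avgA i (u i.+1 om) om)
              + \sum_(j < r) dW j i om *: Pin (to_dual G (avgB j i (u i om) om))]}].

(* Uniqueness holds, up to a null set, among all solutions; the solution has
   moreover finite moments. *)
Definition well_posed (S : (nat -> Omega -> V) -> Prop) : Prop :=
  exists u, [/\ S u, finite_moments u &
    forall v, S v -> grid_indistinguishable v u].

End Schemes.

(* Main.v *)
Require Import Defs.
From HB Require Import structures.
From mathcomp Require Import all_boot all_order all_algebra.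
From mathcomp Require Import all_classical all_reals all_analysis.
From mathcomp Require Import measurable_realfun ring lra.

(** Each step of either scheme is an equation [D x = 0] in the dual of [V], for the
    operator [D x = x - h - (integral of A_s(x) over the cell)], where [h] is known from
    the previous steps, and where in the space-time scheme the unknown and the test vectors
    are confined to the range of a projection. The operator [D] is monotone, because [A] is,
    and strongly so in the norm of [H], which gives uniqueness. It is hemicontinuous, by
    dominated convergence. It is coercive once the integral of [K1] over every cell is at
    most 1, which absolute continuity of the integral ensures for a fine grid:
    [(integral of lam) |x|_V^p <= (integral of K1bar) + |h|_H^2] whenever [D x x <= 0]. So the
    theorem of Browder and Minty solves the equation path by path, and the last estimate gives
    the moment of order [p] from the second moment of [h]. Both schemes are treated at once, as
    schemes along a continuous projection [pi] of [V]: the identity for the discretization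
    in time, and [Pi_n] restricted to [V] for the discretization in space and time.

    The theorem of Browder and Minty ([browder_minty]) is proved from weak compactness of
    balls in a reflexive space ([reflexive_filter_compact], from Tychonoff's theorem and a
    norming functional) and from the finite intersection property of the half-spaces
    [0 <= D y (y - x)]. The latter is a fact about matrix games
    ([nonneg_symmetric_part_game]): a matrix with a nonnegative symmetric part has a
    nonnegative mixed strategy.

    Three probabilistic points remain. The integral over a cell of an adapted process is
    measurable at the end of the cell ([adapted_integral_measurable]); joint measurability
    and adaptedness do not say so directly, and the integral is obtained as an almost sure
    limit of means of well-chosen samples of the process. The solution is measurable
    ([measurable_monotone_solution]), because by Minty's lemma and weak compactness its
    membership in a closed ball is decided by countably many inequalities between values of
    [D]. Finally [h] has a second moment ([gaussian_increment_moment],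
    [square_dominated_explicit_part]): the squared increment of the Wiener process is
    independent of the past, and the averaged noise coefficients grow at most like
    [|x|_V^(p/2)], which follows from coercivity together with the growth of [A].

    One step with random data is [implicit_step]; [projected_well_posed] iterates it, and
    [time_schemeE] and [space_time_schemeE] identify the two schemes. *)

Set Implicit Arguments.
Unset Strict Implicit.
Unset Printing Implicit Defensive.

Import Order.TTheory GRing.Theory Num.Theory.
Import numFieldNormedType.Exports.

Local Open Scope classical_set_scope.
Local Open Scope ring_scope.

(** * Bounded linear functionals *)

Section Functionals.
Context {R : realType} (E : normedModType R).

Lemma dual0 (f : dual E) : f 0 = 0 :> R.
Proof.
have := dual_linear f 1 0 0; rewrite !scale1r addr0 => /eqP.
by rewrite -subr_eq0 opprD addrA subrr sub0r oppr_eq0 => /eqP.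
Qed.

Lemma dual_add (f : dual E) x y : f (x + y) = f x + f y :> R.
Proof. by have := dual_linear f 1 x y; rewrite !scale1r. Qed.

Lemma dual_scale (f : dual E) a x : f (a *: x) = a * f x :> R.
Proof. by have := dual_linear f a x 0; rewrite !addr0 dual0 addr0. Qed.

Lemma dual_opp (f : dual E) x : f (- x) = - f x :> R.
Proof. by rewrite -scaleN1r dual_scale mulN1r. Qed.

Lemma dual_sub (f : dual E) x y : f (x - y) = f x - f y :> R.
Proof. by rewrite dual_add dual_opp. Qed.

Lemma dual_sum (f : dual E) (I : Type) (s : seq I) (c : I -> R) (e : I -> E) :
  f (\sum_(i <- s) c i *: e i) = \sum_(i <- s) c i * f (e i) :> R.
Proof.
elim: s => [|i s IH]; first by rewrite !big_nil dual0.
by rewrite !big_cons dual_add dual_scale IH.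
Qed.

Lemma dual_le_norm (f : dual E) x : `|f x| <= `|f| * `|x|.
Proof.
have [->|x0] := eqVneq x 0; first by rewrite dual0 !normr0 mulr0.
have xn : 0 < `|x| by rewrite normr_gt0.
rewrite -ler_pdivrMr//.
have := @dual_norm_ub _ _ f (`|x|^-1 *: x).
rewrite normrZ normfV normr_id mulVf ?gt_eqF// => /(_ (lexx _)).
by rewrite dual_scale normrM normfV normr_id mulrC.
Qed.

Lemma dual_norm_le_bound (f : dual E) M : 0 <= M ->
  (forall x, `|f x| <= M * `|x|) -> `|f| <= M.
Proof.
move=> M0 fM; apply: dual_norm_le => x x1.
by rewrite (le_trans (fM x))// ler_piMr.
Qed.

Lemma bounded_linear_dual (f : E -> R) M :
  (forall a x y, f (a *: x + y) = a * f x + f y) ->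
  (forall x, `|f x| <= M * `|x|) -> exists g : dual E, forall x, g x = f x.
Proof.
move=> lf fM; suff fd : (f : E -> R^o) \in @dual_pred R E by exists (Dual fd).
apply/dual_predP; split=> [a x y|]; first exact: lf.
pose F : {linear E -> R^o} := HB.pack (f : E -> R^o)
  (GRing.isLinear.Build _ _ _ _ (f : E -> R^o) lf).
apply: (@linear_bounded_continuous _ _ _ F).1.
apply/linear_boundedP; near=> r => x /=.
by rewrite (le_trans (fM x))// ler_wpM2r.
Unshelve. all: by end_near. Qed.

End Functionals.

(** * The Hahn-Banach theorem *)

Section HahnBanach.
Context {R : realType} (E : normedModType R).

Definition sublinear (p : E -> R) :=
  (forall a x, 0 <= a -> p (a *: x) <= a * p x) /\
  (forall x y, p (x + y) <= p x + p y).

Lemma sublinear0 p : sublinear p -> p 0 = 0.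
Proof.
move=> [ph pD]; apply/eqP; rewrite eq_le; apply/andP; split.
  by have := ph 0 0 (lexx _); rewrite scale0r mul0r.
by have := pD 0 0; rewrite addr0 -subr_ge0 addrK.
Qed.

Lemma sublinearN p x : sublinear p -> - p (- x) <= p x.
Proof.
move=> sp; have [_ pD] := sp.
by rewrite -subr_ge0 opprK (le_trans _ (pD _ _))// subrr sublinear0.
Qed.

Lemma sublinearZ p a x : sublinear p -> 0 <= a -> p (a *: x) = a * p x.
Proof.
move=> sp; have [ph pD] := sp.
rewrite le_eqVlt => /predU1P[<-|a0]; first by rewrite scale0r mul0r sublinear0.
apply/eqP; rewrite eq_le (ph _ _ (ltW a0))/= -ler_pdivlMl//.
have an0 : a != 0 by rewrite gt_eqF.
by rewrite -{1}(scale1r x) -(mulVf an0) -scalerA ph// invr_ge0 ltW.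
Qed.

(** The largest sublinear functional below [p] whose value at [- y] is the least
    possible one, [- p y]. *)
Definition descend (p : E -> R) (y x : E) : R :=
  inf [set p (x + t *: y) - t * p y | t in [set t | 0 <= t]].

Section Descend.
Variables (p : E -> R) (sp : sublinear p) (y : E).

Lemma descend_has_inf x :
  has_inf [set p (x + t *: y) - t * p y | t in [set t | 0 <= t]].
Proof.
split; first by exists (p (x + 0 *: y) - 0 * p y), 0 => /=.
exists (- p (- x)) => _ [t /= t0 <-].
have [_ pD] := sp; rewrite -(sublinearZ _ sp t0).
rewrite lerBrDr addrC lerBlDr -{1}(addrK x (t *: y)) -(addrC x).
by apply: (le_trans (pD _ _)); rewrite lexx.
Qed.

Lemma descend_le x t : 0 <= t -> descend p y x <= p (x + t *: y) - t * p y.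
Proof.
by move=> t0; apply: ge_inf; [have [] := descend_has_inf x | exists t].
Qed.

Lemma descend_ge x c : (forall t, 0 <= t -> c <= p (x + t *: y) - t * p y) ->
  c <= descend p y x.
Proof.
move=> h; apply: lb_le_inf; first by have [] := descend_has_inf x.
by move=> _ [t /= t0 <-]; exact: h.
Qed.

Lemma descend_below x : descend p y x <= p x.
Proof. by have := @descend_le x 0 (lexx _); rewrite scale0r addr0 mul0r subr0. Qed.

Lemma sublinear_descend : sublinear (descend p y).
Proof.
split=> [a x|x z].
  rewrite le_eqVlt => /predU1P[<-|a0].
    rewrite scale0r mul0r (le_trans (descend_below _))// sublinear0//.
  rewrite -ler_pdivrMl//; apply: descend_ge => t t0; rewrite ler_pdivrMl//.
  have at0 : 0 <= a * t by rewrite mulr_ge0// ltW.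
  apply: le_trans (descend_le (a *: x) at0) _.
  by rewrite -scalerA -scalerDr (sublinearZ _ sp (ltW a0)) mulrBr mulrA.
rewrite -lerBlDr; apply: descend_ge => t t0.
rewrite lerBlDr -lerBlDl; apply: descend_ge => s s0.
rewrite lerBlDl (le_trans (@descend_le _ (t + s) _)) ?addr_ge0//.
rewrite scalerDl addrACA mulrDl opprD [leRHS]addrACA lerD2r.
by have [_ ->] := sp.
Qed.

End Descend.

(** A minimal sublinear functional coincides with its descent along every [y],
    so that it is odd, hence linear. *)
Lemma minimal_sublinear_linear p : sublinear p ->
  (forall q, sublinear q -> (forall x, q x <= p x) -> forall x, p x <= q x) ->
  forall a x y, p (a *: x + y) = a * p x + p y.
Proof.
move=> sp pmin.
have pN x : p (- x) = - p x.
  apply/eqP; rewrite eq_le; apply/andP; split.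
    rewrite (le_trans (pmin _ (sublinear_descend sp x) _ _))//.
      exact: descend_below.
    rewrite (le_trans (descend_le sp _ _ ler01))// scale1r addNr sublinear0//.
    by rewrite mul1r sub0r.
  by rewrite lerNl sublinearN.
have pD x y : p (x + y) = p x + p y.
  apply/eqP; rewrite eq_le sp.2/=.
  by have := sp.2 (x + y) (- y); rewrite addrK pN lerBrDr.
move=> a x y; rewrite pD; congr (_ + _).
have [a0|a0] := leP 0 a; first exact: sublinearZ.
rewrite -(opprK a) scaleNr pN sublinearZ ?oppr_ge0 ?ltW//.
by rewrite !mulNr opprK.
Qed.

(** Zorn's lemma: below [p0], a chain of sublinear functionals is bounded from below
    at each point [x] by [- p0 (- x)], so that its pointwise infimum is finite, and
    that infimum is again sublinear. *)
Lemma minimal_sublinear_exists p0 : sublinear p0 -> exists p,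
  [/\ sublinear p, forall x, p x <= p0 x &
   forall q, sublinear q -> (forall x, q x <= p x) -> forall x, p x <= q x].
Proof.
move=> sp0; pose T := {p : E -> R | sublinear p /\ forall x, p x <= p0 x}.
pose le (p q : T) := `[< forall x, sval q x <= sval p x >].
pose t0 : T := exist _ p0 (conj sp0 (fun x => lexx (p0 x))).
have [||A Atot|[p [sp pp0]] pmin] := @ZL_preorder T t0 le.
- by move=> t; apply/asboolP.
- move=> r s t /asboolP rs /asboolP st; apply/asboolP => x.
  exact: le_trans (rs x).
- have [[q0 Aq0]|A0] := pselect (exists q, A q); last first.
    by exists t0 => s As; exfalso; apply: A0; exists s.
  pose S x := [set sval q x | q in A].
  have hinf x : has_inf (S x).
    split; first by exists (sval q0 x), q0.
    exists (- p0 (- x)) => _ [[q [sq qp0]] Aq <-] /=.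
    by rewrite (le_trans _ (sublinearN _ sq))// lerN2.
  have inf_le x q : A q -> inf (S x) <= sval q x.
    by move=> Aq; apply: ge_inf; [have [] := hinf x|exists q].
  have le_inf x c : (forall q, A q -> c <= sval q x) -> c <= inf (S x).
    move=> h; apply: lb_le_inf; first by have [] := hinf x.
    by move=> _ [q Aq <-]; exact: h.
  have sI : sublinear (fun x => inf (S x)).
    split=> [a x|x y].
      rewrite le_eqVlt => /predU1P[<-|a0].
        rewrite scale0r mul0r (le_trans (inf_le _ _ Aq0))//.
        by case: q0 {Aq0} => q [sq _] /=; rewrite sublinear0.
      rewrite -ler_pdivrMl//; apply: (le_inf _ _) => q Aq.
      rewrite ler_pdivrMl// (le_trans (inf_le _ _ Aq))//.
      by case: q {Aq} => q [sq _] /=; rewrite sublinearZ// ltW.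
    rewrite -lerBlDr; apply: (le_inf _ _) => q Aq.
    rewrite lerBlDr -lerBlDl; apply: (le_inf _ _) => q' Aq'; rewrite lerBlDl.
    have [/asboolP qq'|/asboolP qq'] := Atot _ _ Aq Aq'.
      rewrite (le_trans (inf_le _ _ Aq'))//.
      case: q' {Aq'} qq' => q' [sq' ?] /= qq'.
      by rewrite (le_trans (sq'.2 _ _))// lerD2r.
    rewrite (le_trans (inf_le _ _ Aq))//.
    case: q {Aq} qq' => q [sq ?] /= qq'.
    by rewrite (le_trans (sq.2 _ _))// lerD2l.
  have Ip0 x : inf (S x) <= p0 x.
    by rewrite (le_trans (inf_le _ _ Aq0))//; case: q0 {Aq0} => q [? /=].
  pose tI : T := exist (fun p => sublinear p /\ forall x, p x <= p0 x) _ (conj sI Ip0).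
  by exists tI => q Aq; apply/asboolP => x; exact: inf_le.
exists p; split=> // q sq qp x.
have qp0 z : q z <= p0 z by exact: le_trans (qp z) _.
pose tq : T := exist (fun p => sublinear p /\ forall x, p x <= p0 x) q (conj sq qp0).
by have /asboolP/(_ x) := pmin tq (asboolT qp).
Qed.

(** A functional below the descent of the norm along [x] takes the value [- |x|] at
    [- x]. *)
Theorem norming_functional (x : E) :
  exists f : dual E, (forall y, `|f y| <= `|y|) /\ f x = `|x|.
Proof.
pose N (y : E) := `|y|.
have sN : sublinear N.
  by split=> [a y a0|y z]; rewrite /N ?normrZ ?ger0_norm// ler_normD.
have [p [sp pN pmin]] := minimal_sublinear_exists (sublinear_descend sN x).
have pl := minimal_sublinear_linear sp pmin.
have p0 : p 0 = 0 by exact: sublinear0.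
have pNE y : p (- y) = - p y.
  by have := pl (-1) y 0; rewrite !addr0 scaleN1r mulN1r p0 addr0.
have pleN y : p y <= `|y| by exact: le_trans (pN y) (descend_below sN x y).
have pn y : `|p y| <= 1 * `|y|.
  by rewrite mul1r ler_norml lerNl -pNE -{1}(normrN y) !pleN.
have [f fp] := bounded_linear_dual pl pn.
exists f; split=> [y|]; first by rewrite fp (le_trans (pn y))// mul1r.
rewrite fp; apply/eqP; rewrite eq_le pleN/= -lerN2 -pNE.
rewrite (le_trans (pN _))// (le_trans (descend_le sN _ _ ler01))//.
by rewrite scale1r addNr /N normr0 mul1r sub0r.
Qed.

End HahnBanach.

(** * Weak compactness in reflexive spaces *)

Section WeakCompactness.
Context {R : realType} (E : normedModType R).
Hypothesis reflE : reflexive_space E.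

(** Evaluations at the points of a ball lie in a product of compact intervals;
    a cluster point of them is a bounded linear functional on the dual, that
    is, by reflexivity, an evaluation. *)
Theorem reflexive_filter_compact (F : set_system E) (rho : R)
    (K : set (dual E * R)) : ProperFilter F -> F [set x | `|x| <= rho] ->
  (forall z, K z -> forall e, 0 < e -> F [set x | z.1 x <= z.2 + e]) ->
  exists x : E, `|x| <= rho /\ forall z, K z -> z.1 x <= z.2.
Proof.
move=> FF Frho FK.
have [x0 /= /(le_trans (normr_ge0 _)) rho0] := filter_ex Frho.
pose T := prod_topology (fun _ : dual E => R).
pose ev (x : E) : T := fun f => f x.
pose A : set T :=
  [set g | forall f : dual E, [set` `[- (rho * `|f|), rho * `|f|]] (g f)].
have cA : compact A.
  have := @tychonoff (dual E) (fun _ => (R : topologicalType))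
    (fun f => [set` `[- (rho * `|f|), rho * `|f|]]).
  by apply => f; exact: segment_compact.
have evA : F (ev @^-1` A).
  apply: filterS Frho => x /= xrho f /=.
  rewrite in_itv/= -ler_norml (le_trans (dual_le_norm f x))//.
  by rewrite mulrC ler_wpM2r.
have [phi []] := cA (ev @ F) _ evA.
rewrite /A /= => phiA; rewrite cluster_cvgE => -[Gf PG [Gphi FG]].
have coord f : (g f @[g --> Gf]) --> (phi f : R).
  have pc := @proj_continuous (dual E) (fun _ => (R : topologicalType)) f phi.
  exact: (cvg_trans (cvg_app (fun g : T => g f) Gphi) pc).
have evG (Q : set T) : (forall x, Q (ev x)) -> Gf Q.
  move=> hQ; apply: FG; apply: (@filterS _ F _ setT); last exact: filterT.
  by move=> x _; exact: hQ.
have philin a f g : phi (a *: f + g) = a * phi f + phi g.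
  apply: (cvg_unique _ (coord (a *: f + g))) => //.
  have h : (a * g0 f + g0 g @[g0 --> Gf]) --> (a * phi f + phi g : R).
    by apply: cvgD => //; apply: cvgM => //; exact: cvg_cst.
  apply: cvg_trans h; apply: near_eq_cvg.
  by apply: evG => x; rewrite /ev.
have phib f : `|phi f| <= rho * `|f|.
  by have := phiA f; rewrite /= in_itv/= -ler_norml.
have [Phi PhiE] := bounded_linear_dual philin phib.
have [x xE] := reflE Phi.
have phix f : phi f = f x by rewrite -PhiE xE.
exists x; split.
  have [f [fle fx]] := norming_functional x.
  rewrite -fx -phix (le_trans (ler_norm _))// (le_trans (phib _))//.
  rewrite ler_piMr// dual_norm_le_bound// => y; rewrite mul1r; exact: fle.
move=> z Kz; rewrite -phix; apply/ler_addgt0Pr => e e0.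
apply: (cvgr_to_le (coord z.1)).
by apply: FG; exact: FK.
Qed.

End WeakCompactness.

(** * Symmetric matrix games *)

Section Games.
Context {R : realType}.

Definition simplex n (l : 'I_n -> R) := (forall i, 0 <= l i) /\ \sum_i l i = 1.

Lemma continuous_sum (T : topologicalType) n (F : 'I_n -> T -> R) :
  (forall i, continuous (F i)) -> continuous (fun x => \sum_i F i x).
Proof.
move=> cF; apply: (@continuous_big R _ +%R 0 xpredT) => //.
exact: add_continuous.
Qed.

Lemma continuous_linear_form n (c : 'I_n -> R) :
  continuous (fun v : 'rV[R]_n => \sum_j c j * v ord0 j).
Proof.
apply: continuous_sum => i.
by move=> v; exact: (cvgM (cvg_cst _) (@coord_continuous _ _ _ _ _ _)).
Qed.

Lemma compact_simplex n :
  compact [set v : 'rV[R]_n | simplex (v ord0)].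
Proof.
apply: bounded_closed_compact.
  exists 1; split=> // r r1 v /= [v0 v1].
  have vle i : v ord0 i <= 1.
    by rewrite -v1 (bigD1 i)//= lerDl sumr_ge0.
  rewrite -[leLHS]/(mx_norm v) mx_normrE; apply/bigmax_leP; split.
    by rewrite (le_trans ler01)// ltW.
  move=> [i j] _ /=; rewrite ord1 ger0_norm// (le_trans (vle j))// ltW//.
have -> : [set v : 'rV[R]_n | simplex (v ord0)] =
    (\bigcap_(i in [set: 'I_n]) ((fun v : 'rV[R]_n => v ord0 i) @^-1` [set x | 0 <= x]))
    `&` ((fun v : 'rV[R]_n => \sum_j 1 * v ord0 j) @^-1` [set x | x = 1]).
  apply/seteqP; split=> v /=.
    by move=> [v0 v1]; split=> [i _|]; [exact: v0|under eq_bigr do rewrite mul1r].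
  by move=> [v0]; under eq_bigr do rewrite mul1r; move=> v1; split=> // i; exact: v0.
apply: closedI.
  apply: closed_bigI => i _; apply: preimage_closed; last exact: closed_ge.
  by move=> v _; exact: coord_continuous.
apply: preimage_closed; last exact: closed_eq.
by move=> v _; exact: continuous_linear_form.
Qed.

(** A point of the simplex minimising the sum of the squared negative parts [w]
    of [S l] has [w = 0]: moving towards the normalised vector [w] changes that
    sum at the rate [- 2 |w|^2], because [w^T S w = 0] for a skew [S]. *)
Lemma symmetric_game k (S : 'I_k.+1 -> 'I_k.+1 -> R) :
  (forall i j, S i j = - S j i) ->
  exists l, simplex l /\ forall i, 0 <= \sum_j S i j * l j.
Proof.
move=> skew.
pose Sv (v : 'I_k.+1 -> R) i := \sum_j S i j * v j.
pose neg (x : R) := (`|x| - x) / 2.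
pose f (v : 'rV[R]_k.+1) := \sum_i neg (Sv (v ord0) i) ^+ 2.
have negE x : neg x = Num.max 0 (- x).
  rewrite /neg; case: (leP 0 x) => x0.
    by rewrite ger0_norm// subrr mul0r max_l// oppr_le0.
  by rewrite ltr0_norm// max_r ?oppr_ge0 ?ltW//; field.
have neg0 x : 0 <= neg x by rewrite negE le_max lexx.
have cf : continuous f.
  apply: continuous_sum => i.
  have cl := @continuous_linear_form _ (S i).
  move=> v; rewrite /neg.
  have h : ((`|Sv (x ord0) i| - Sv (x ord0) i) / 2 @[x --> v]) --> neg (Sv (v ord0) i).
    apply: cvgM; last exact: cvg_cst.
    by apply: cvgB; [apply: cvg_norm|]; exact: cl.
  exact: (cvgM h h).
have [v /set_mem /= [v0 v1] vmin] : exists2 c, c \in [set v : 'rV[R]_k.+1 | simplex (v ord0)] &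
    forall t, t \in [set v : 'rV[R]_k.+1 | simplex (v ord0)] -> f c <= f t.
  apply: compact_EVT_min.
  - exists (\row_j (j == ord0)%:R); split=> [i|]; first by rewrite mxE ler0n.
    rewrite (bigD1 ord0)//= mxE eqxx big1 ?addr0// => i i0.
    by rewrite mxE (negbTE i0).
  - exact: compact_simplex.
  - exact: continuous_subspaceT.
pose w i := neg (Sv (v ord0) i).
pose s := \sum_i w i.
exists (v ord0); split=> // i0; rewrite leNgt; apply/negP => Si0.
have wi0 : 0 < w i0 by rewrite /w negE lt_max oppr_gt0 Si0 orbT.
have s0 : 0 < s.
  by rewrite /s (bigD1 i0)//= ltr_pwDl// sumr_ge0// => i _; exact: neg0.
pose c i := Sv (fun j => w j / s - v ord0 j) i.
pose W := \sum_i w i ^+ 2.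
have W0 : 0 < W.
  rewrite /W (bigD1 i0)//= ltr_pwDl ?exprn_gt0// sumr_ge0// => i _.
  by rewrite exprn_ge0// neg0.
have wSw : \sum_i w i * Sv w i = 0.
  have h : \sum_i w i * Sv w i = - \sum_i w i * Sv w i.
    rewrite -sumrN /Sv; under eq_bigr do rewrite mulr_sumr.
    rewrite exchange_big/=; apply: eq_bigr => i _.
    rewrite -mulrN -sumrN mulr_sumr; apply: eq_bigr => j _.
    by rewrite (skew j i); ring.
  by move/eqP: h; rewrite -subr_eq0 opprK -mulr2n mulrn_eq0 => /eqP.
have wv i : w i * Sv (v ord0) i = - w i ^+ 2.
  rewrite /w negE; case: (leP 0 (Sv (v ord0) i)) => h.
    by rewrite max_l ?oppr_le0// mul0r expr0n oppr0.
  by rewrite max_r ?oppr_ge0 ?ltW//; ring.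
have wc : \sum_i w i * c i = W.
  have -> : \sum_i w i * c i = s^-1 * (\sum_i w i * Sv w i) - \sum_i w i * Sv (v ord0) i.
    rewrite mulr_sumr -sumrB; apply: eq_bigr => i _.
    rewrite /c /Sv mulrCA -mulrBr; congr (_ * _).
    rewrite mulr_sumr -sumrB; apply: eq_bigr => j _; ring.
  rewrite wSw mulr0 sub0r -sumrN; apply: eq_bigr => i _.
  by rewrite wv opprK.
pose C := \sum_i c i ^+ 2.
have C0 : 0 <= C by rewrite sumr_ge0// => i _; rewrite sqr_ge0.
(* For this step length the linear gain exceeds the quadratic loss. *)
pose t := Num.min 1 (W / (C + 1)).
have C1 : 0 < C + 1 by rewrite ltr_wpDl.
have t0 : 0 < t by rewrite /t lt_min ltr01 divr_gt0.
have t1 : t <= 1 by rewrite /t ge_min lexx.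
have tC : t * C < 2 * W.
  have : t * (C + 1) <= W by rewrite -ler_pdivlMr// /t ge_min lexx orbT.
  rewrite mulrDr mulr1 => h.
  by apply: (@lt_le_trans _ _ W); [apply: lt_le_trans h; rewrite ltrDl|rewrite ler_peMl// ?ler1n// ltW].
pose u : 'rV[R]_k.+1 := \row_j (v ord0 j + t * (w j / s - v ord0 j)).
have uu : u \in [set v : 'rV[R]_k.+1 | simplex (v ord0)].
  apply/mem_set; split=> [i|].
    rewrite mxE (_ : _ + _ = (1 - t) * v ord0 i + t * (w i / s)); last by ring.
    by apply: addr_ge0; apply: mulr_ge0;
      [rewrite subr_ge0|exact: v0|exact: ltW|exact: divr_ge0 (neg0 _) (ltW s0)].
  under eq_bigr do rewrite mxE.
  rewrite big_split/= -mulr_sumr sumrB v1 -mulr_suml divff ?gt_eqF//.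
  by rewrite subrr mulr0 addr0.
have := vmin _ uu; apply/negP; rewrite -ltNge.
have -> : f v = W by [].
apply: (@le_lt_trans _ _ (\sum_i (w i - t * c i) ^+ 2)).
  apply: ler_sum => i _.
  have Su : Sv (u ord0) i = Sv (v ord0) i + t * c i.
    rewrite /c /Sv mulr_sumr -big_split; apply: eq_bigr => j _.
    by rewrite mxE /=; ring.
  rewrite -[leRHS]real_normK ?num_real// ler_pXn2r ?nnegrE// Su.
  rewrite negE ge_max normr_ge0/= (le_trans _ (ler_norm _))// opprD lerD2r.
  by rewrite /w negE le_max lexx orbT.
have -> : \sum_i (w i - t * c i) ^+ 2 = W - t * (2 * W - t * C).
  transitivity (\sum_i (w i ^+ 2 - t * 2 * (w i * c i) + t ^+ 2 * c i ^+ 2)).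
    by apply: eq_bigr => i _; ring.
  by rewrite big_split/= sumrB -!mulr_sumr wc -/W -/C; ring.
by rewrite ltrBlDr ltrDl mulr_gt0// subr_gt0.
Qed.

(** The skew part of [M] has a nonnegative strategy [l], and [M] exceeds it entrywise
    by its symmetric part. *)
Lemma nonneg_symmetric_part_game k (M : 'I_k.+1 -> 'I_k.+1 -> R) :
  (forall i j, 0 <= M i j + M j i) ->
  exists l, simplex l /\ forall i, 0 <= \sum_j M i j * l j.
Proof.
move=> M0; have [i j|l [ls lS]] := @symmetric_game k (fun i j => (M i j - M j i) / 2).
  by ring.
exists l; split=> // i; apply: le_trans (lS i) _; apply: ler_sum => j _.
rewrite ler_wpM2r//; first by case: ls.
by have := M0 i j; lra.
Qed.

End Games.

(** * Monotone operators *)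

Section Monotone.
Context {R : realType} (E : normedModType R).
Implicit Types D : E -> dual E.

Definition monotone_op D := forall x y, 0 <= (D x - D y) (x - y).

Definition hemicontinuous_op D := forall x y z,
  (D (x + n.+1%:R^-1 *: y) z @[n --> \oo]) --> (D x z : R).

Definition locally_bounded_op D := forall rho, exists M,
  forall x w, `|x| <= rho -> `|D x w| <= M * `|w|.

(** Minty's trick: test with [x + t (y - x)], divide by [t], and let [t] tend to 0. *)
Lemma minty (C : set E) D x : hemicontinuous_op D ->
  (forall y t, C y -> 0 < t <= 1 -> C (x + t *: (y - x))) ->
  (forall y, C y -> 0 <= D y (y - x)) -> forall y, C y -> 0 <= D x (y - x).
Proof.
move=> hD starC Dx y Cy.
apply: (cvgr_to_ge (hD x (y - x) (y - x))); apply: nearW => n.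
have t0 : 0 < n.+1%:R^-1 :> R by rewrite invr_gt0.
have t1 : n.+1%:R^-1 <= 1 :> R by rewrite invf_le1// ler1n.
have := Dx _ (starC y n.+1%:R^-1 Cy _); rewrite t0 t1 => /(_ isT).
by rewrite (addrC x) addrK dual_scale pmulr_rge0.
Qed.

(** Monotonicity along the segment from [y] to [y + t z] bounds [D y' z] from
    above by [D (y + t z) z] up to an error of order [|y' - y| / t]. *)
Lemma monotone_demicontinuous D : monotone_op D -> hemicontinuous_op D ->
  locally_bounded_op D -> forall y z e, 0 < e -> exists2 de, 0 < de &
  forall y', `|y' - y| < de -> `|D y' z - D y z| <= e.
Proof.
move=> mD hD bD y.
suff half z e : 0 < e -> exists2 de, 0 < de &
    forall y', `|y' - y| < de -> D y' z <= D y z + e.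
  move=> z e e0; have [d1 d10 h1] := half z e e0.
  have [d2 d20 h2] := half (- z) e e0.
  exists (Num.min d1 d2); first by rewrite lt_min d10.
  move=> y'; rewrite lt_min => /andP[/h1 l1 /h2].
  by rewrite !dual_opp ler_norml => l2; apply/andP; split; lra.
move=> e0; have e20 : 0 < e / 2 by rewrite divr_gt0.
have /cvgrPdist_lt/(_ _ e20)[N _ /(_ N (leqnn N))] := hD y z z.
set t := N.+1%:R^-1 => hN.
have t0 : 0 < t by rewrite invr_gt0.
have t1 : t <= 1 by rewrite invf_le1// ler1n.
have [M hM] := bD (`|y| + 1 + `|z|).
have M0 : 0 < `|M| + 1 by rewrite ltr_wpDl.
exists (Num.min 1 (t * (e / 2) / (2 * (`|M| + 1)))).
  by rewrite lt_min ltr01 !(divr_gt0, mulr_gt0).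
move=> y'; rewrite lt_min => /andP[y'1 y'e].
have hM' x w : `|x| <= `|y| + 1 + `|z| -> `|D x w| <= (`|M| + 1) * `|w|.
  move=> xr; apply: le_trans (hM _ w xr) _; apply: ler_wpM2r => //.
  by rewrite (le_trans (ler_norm _))// lerDl.
have b1 : `|D y' (y' - y)| <= (`|M| + 1) * `|y' - y|.
  apply: hM'; rewrite -(subrK y y') (le_trans (ler_normD _ _))//.
  by have := normr_ge0 z; move: y'1; lra.
have b2 : `|D (y + t *: z) (y' - y)| <= (`|M| + 1) * `|y' - y|.
  apply: hM'; rewrite (le_trans (ler_normD _ _))// -addrA lerD2l normrZ gtr0_norm//.
  have : t * `|z| <= `|z| by rewrite ler_piMl.
  lra.
have := mD y' (y + t *: z).
rewrite opprD addrA => mono0.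
have mono : 0 <= (D y' (y' - y - t *: z) : R) - D (y + t *: z) (y' - y - t *: z) by [].
move: mono {mono0}; rewrite !dual_sub !dual_scale => mono.
move: mono b1 b2 hN; rewrite !dual_sub !ler_norml ltr_norml.
move: y'e; rewrite ltr_pdivlMr ?mulr_gt0// => y'e.
set a := D y' y'; set b := D y' y; set c := D _ y'; set f := D _ y.
set g := D _ z; set h := D _ z; set k := D _ z.
move=> mono /andP[b11 b12] /andP[b21 b22] /andP[n1 n2].
have key : t * g <= t * (h + e / 2).
  rewrite mulrDr; move: y'e; rewrite mulrC -mulrA => y'e.
  lra.
by move: key; rewrite ler_pM2l//; lra.
Qed.

Section Range.
Variable pi : {linear E -> E}.
Hypothesis cpi : continuous pi.
Hypothesis pi_idem : forall x, pi (pi x) = pi x.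

Lemma bounded_projection : exists2 C, 0 < C & forall x, `|pi x| <= C * `|x|.
Proof.
have /linear_boundedP : bounded_near pi (nbhs 0).
  by apply: continuous_linear_bounded; exact: cpi.
by move=> /pinfty_ex_gt0[M M0 /= piM]; exists M.
Qed.

Lemma dual_comp_projection (f : dual E) :
  exists g : dual E, forall x, g x = f (pi x) - f x.
Proof.
have [C C0 piC] := bounded_projection.
apply: (@bounded_linear_dual _ _ _ (`|f| * C + `|f|)) => [a x y|x].
  by rewrite linearP !dual_add !dual_scale; ring.
rewrite (le_trans (ler_normB _ _))// mulrDl lerD//; last exact: dual_le_norm.
rewrite (le_trans (dual_le_norm _ _))// -mulrA ler_wpM2l//.
Qed.

(** Functionals separate the points of the space. *)
Lemma projection_fixed x :
  (forall f g : dual E, (forall y, g y = f (pi y) - f y) -> g x <= 0) ->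
  pi x = x.
Proof.
move=> h; have [f [_ fx]] := norming_functional (pi x - x).
have [g gE] := dual_comp_projection f.
apply/eqP; rewrite -subr_eq0 -normr_le0 -fx dual_sub -gE.
exact: h gE.
Qed.

(** On the range of [pi], a linear space, an inequality for every direction is an
    equality. *)
Lemma minty_variational_solution D x : hemicontinuous_op D -> pi x = x ->
  (forall y, pi y = y -> 0 <= D y (y - x)) -> forall w, D x (pi w) = 0.
Proof.
move=> hD pix Dx w.
have Dx' : forall y, pi y = y -> 0 <= D x (y - x).
  apply: (@minty [set y | pi y = y]) => // y t /= piy _.
  by rewrite linearD linearZ linearB pix piy.
have h v : pi v = v -> 0 <= D x v.
  by move=> piv; rewrite -(addrK x v) Dx'// linearD pix piv.
apply/eqP; rewrite eq_le h// andbT -oppr_ge0 -dual_opp h//.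
by rewrite linearN pi_idem.
Qed.

(** By demicontinuity, [D y (y - x)] depends continuously on [y], so that it is
    enough to test a dense set; this turns the equation into countably many
    conditions. *)
Lemma minty_dense_solution D (Y : set E) x : monotone_op D ->
  hemicontinuous_op D -> locally_bounded_op D ->
  (forall y e, pi y = y -> 0 < e -> exists2 y', Y y' & `|y' - y| < e) ->
  pi x = x -> (forall y, Y y -> 0 <= D y (y - x)) -> forall w, D x (pi w) = 0.
Proof.
move=> mD hD bD dY pix Dx; apply: minty_variational_solution => // y piy.
apply/ler_addgt0Pr => e e0.
have e20 : 0 < e / 2 by rewrite divr_gt0.
have [de de0 hde] := monotone_demicontinuous mD hD bD y (y - x) e20.
have [M hM] := bD (`|y| + 1).
have M0 : 0 < `|M| + 1 by rewrite ltr_wpDl.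
pose r := Num.min de (Num.min 1 (e / 2 / (`|M| + 1))).
have r0 : 0 < r by rewrite !lt_min de0 ltr01 divr_gt0.
have [y' Yy'] := dY _ _ piy r0.
rewrite !lt_min => /and3P[/hde y'de y'1 y'e].
have := Dx _ Yy'.
have -> : y' - x = (y' - y) + (y - x) by rewrite addrA subrK.
rewrite dual_add => h.
have : `|D y' (y' - y)| <= (`|M| + 1) * `|y' - y|.
  apply: le_trans (hM _ _ _) _; last first.
    by apply: ler_wpM2r => //; rewrite (le_trans (ler_norm _))// lerDl.
  rewrite -(subrK y y') (le_trans (ler_normD _ _))//.
  by rewrite addrC lerD2l ltW.
move: y'e; rewrite ltr_pdivlMr// mulrC => y'e.
move: y'de; rewrite !ler_norml => /andP[_ h1] /andP[_ h2].
by rewrite addrC; lra.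
Qed.

Hypothesis reflE : reflexive_space E.

(** Finitely many of the half-spaces [0 <= D y (y - x)] have a common point in
    the convex hull of the [y]: the matrix of the [D y_i (y_i - y_j)] has a
    nonnegative symmetric part. *)
Lemma monotone_finite_intersection D (C : set E) (s : seq E) : monotone_op D ->
  (exists x, C x) ->
  (forall k (y l : 'I_k.+1 -> _), simplex l -> (forall i, C (y i)) ->
    C (\sum_i l i *: y i)) ->
  (forall y, y \in s -> C y) ->
  exists x, C x /\ forall y, y \in s -> 0 <= D y (y - x).
Proof.
move=> mD [x0 Cx0] cC.
case: s => [|y0 s]; first by move=> _; exists x0.
move=> sC; pose y (i : 'I_(size s).+1) := nth 0 (y0 :: s) i.
pose M i j := D (y i) (y i - y j).
have [i j|l [ls lM]] := @nonneg_symmetric_part_game _ _ M.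
  have := mD (y i) (y j); rewrite /M dualD dualN -[in X in X -> _]dual_opp opprB.
  by [].
exists (\sum_i l i *: y i); split.
  by apply: cC => // i; apply: sC; rewrite mem_nth.
move=> y' /(nthP 0)[i si <-]; have := lM (Ordinal si); rewrite /M /y /=.
set f := D _; set yi := nth _ _ _.
rewrite dual_sub dual_sum => h; rewrite subr_ge0; move: h.
under eq_bigr do rewrite dual_sub mulrBl mulrC.
rewrite sumrB -mulr_suml ls.2 mul1r subr_ge0.
by under eq_bigr do rewrite mulrC.
Qed.

(** Weak compactness extends the finite intersections to the intersection of all the
    half-spaces, which Minty's trick turns into the variational inequality. The
    range of [pi] is weakly closed because functionals separate points. *)
Lemma monotone_variational_inequality D rho : monotone_op D ->
  hemicontinuous_op D -> 0 <= rho -> exists x,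
  [/\ pi x = x, `|x| <= rho &
  forall y, pi y = y -> `|y| <= rho -> 0 <= D x (y - x)].
Proof.
move=> mD hD rho0.
pose C := [set x | pi x = x /\ `|x| <= rho].
have C0 : C 0 by split; rewrite ?linear0 ?normr0.
have convC k (y : 'I_k.+1 -> E) l : simplex l -> (forall i, C (y i)) ->
    C (\sum_i l i *: y i).
  move=> [l0 l1] Cy; split.
    rewrite linear_sum; apply: eq_bigr => i _.
    by rewrite linearZ (Cy i).1.
  rewrite (le_trans (ler_norm_sum _ _ _))//.
  rewrite -[leRHS]mul1r -l1 mulr_suml; apply: ler_sum => i _.
  by rewrite normrZ ger0_norm// ler_wpM2l// (Cy i).2.
pose S := [set s : seq E | forall y, y \in s -> C y].
pose B (s : seq E) := [set x | C x /\ forall y, y \in s -> 0 <= D y (y - x)].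
have FB : ProperFilter (filter_from S B).
  apply: filter_from_proper; last first.
    move=> s sC; apply: (monotone_finite_intersection mD _ convC sC).
    by exists 0.
  apply: filter_from_filter; first by exists [::].
  move=> s t Ss St; exists (s ++ t) => [y|x [Cx h]].
    by rewrite mem_cat => /orP[/Ss|/St].
  by split; split=> // y yst; apply: h; rewrite mem_cat yst ?orbT.
(* The second kind of half-spaces expresses [pi x = x]. *)
pose K := [set z : dual E * R |
  (exists2 y, C y & z = (D y, D y y)) \/
  (exists2 f : dual E, forall y, z.1 y = f (pi y) - f y & z.2 = 0)].
have [x [xrho xK]] : exists x : E, `|x| <= rho /\ forall z, K z -> z.1 x <= z.2.
  apply: (reflexive_filter_compact reflE FB).
    by exists [::] => // x [[]].
  move=> z [[y Cy ->] e e0|[f zf z2] e e0].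
    exists [:: y] => [y'|x [Cx h]]; first by rewrite inE => /eqP ->.
    have := h y; rewrite inE eqxx => /(_ isT).
    have le (a b c : R) : 0 < c -> 0 <= a - b -> b <= a + c by lra.
    by rewrite dual_sub; exact: le.
  exists [::] => // x [[pix _] _] /=.
  by rewrite zf z2 pix subrr add0r ltW.
have pix : pi x = x.
  by apply: projection_fixed => f g gf; apply: (xK (g, 0)); right; exists f.
exists x; split=> // y piy yrho.
apply: (@minty C) => // [{piy yrho}y t [piy yrho] /andP[t0 t1]|{piy yrho}y Cy].
  split; first by rewrite linearD linearZ linearB pix piy.
  rewrite (_ : _ + _ = (1 - t) *: x + t *: y); last first.
    by rewrite scalerBr scalerBl scale1r addrCA addrC.
  rewrite (le_trans (ler_normD _ _))// !normrZ.
  rewrite (gtr0_norm t0) ger0_norm ?subr_ge0//.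
  have h1 := ler_wpM2l (ltW t0) yrho.
  have h2 : (1 - t) * `|x| <= (1 - t) * rho by rewrite ler_wpM2l// subr_ge0.
  by apply: le_trans (lerD h2 h1) _; rewrite -mulrDl subrK mul1r.
by rewrite dual_sub subr_ge0; apply: (xK (D y, D y y)); left; exists y.
Qed.

(** The a priori bound [rho] puts the solution of the variational inequality on the
    ball of radius [|rho| + 1] in its interior, so that small multiples of every
    direction are admissible. *)
Theorem browder_minty D rho : monotone_op D -> hemicontinuous_op D ->
  (forall x, pi x = x -> D x x <= 0 -> `|x| <= rho) ->
  exists x, pi x = x /\ forall w, D x (pi w) = 0.
Proof.
move=> mD hD crc.
have rho0 : 0 <= `|rho| + 1 by rewrite addr_ge0.
have [x [pix xr Dx]] := monotone_variational_inequality mD hD rho0.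
exists x; split=> // w.
have xrho : `|x| <= `|rho|.
  rewrite (le_trans _ (ler_norm _))// crc//.
  have := Dx 0; rewrite linear0 normr0 sub0r dual_opp oppr_ge0.
  by apply.
pose t : R := (`|pi w| + 1)^-1.
have t0 : 0 < t by rewrite invr_gt0 ltr_wpDl.
have tw : t * `|pi w| <= 1.
  by rewrite /t mulrC ler_pdivrMr ?ltr_wpDl// mul1r lerDl.
have h a : `|a| = t -> 0 <= a * D x (pi w).
  move=> at_; have := Dx (x + a *: pi w).
  rewrite (addrC x) addrK dual_scale; apply.
    by rewrite linearD linearZ pi_idem pix.
  by rewrite (le_trans (ler_normD _ _))// normrZ at_ addrC lerD.
apply/eqP; rewrite eq_le -(pmulr_rge0 _ t0) h ?gtr0_norm// andbT.
by rewrite -oppr_ge0 -(pmulr_rge0 _ t0) mulrN -mulNr h// normrN gtr0_norm.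
Qed.

(** Solutions of finitely many Minty inequalities up to [1 / (k + 1)] have weak cluster
    points, which satisfy all the inequalities exactly and stay in the closed ball. *)
Lemma approximate_minty_solution D (y x : nat -> E) (c : E) r :
  monotone_op D -> hemicontinuous_op D -> locally_bounded_op D ->
  (forall z e, pi z = z -> 0 < e -> exists n, `|y n - z| < e) ->
  (forall k, pi (x k) = x k) ->
  (forall k, `|x k - c| < r + k.+1%:R^-1) ->
  (forall k i, (i <= k)%N -> - k.+1%:R^-1 < D (y i) (y i - x k)) ->
  exists x, [/\ pi x = x, `|x - c| <= r & forall w, D x (pi w) = 0].
Proof.
move=> mD hD bD dY pix xr Dx.
(* Half-spaces for the Minty inequalities, for [pi x = x], and for the ball. *)
pose K := [set z : dual E * R |
  [\/ exists i, z = (D (y i), D (y i) (y i)),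
    exists2 f : dual E, forall y, z.1 y = f (pi y) - f y & z.2 = 0 |
    exists2 f : dual E, forall y, `|f y| <= `|y| & z = (f, r + f c)]].
have small e : 0 < e -> \forall k \near \oo, k.+1%:R^-1 <= e :> R.
  by move=> e0; near=> k; apply: ltW; near: k; exact: near_infty_natSinv_lt (PosNum e0).
have [xx [_ xK]] : exists xx : E, `|xx| <= r + 1 + `|c| /\ forall z, K z -> z.1 xx <= z.2.
  apply: (reflexive_filter_compact reflE (F := x @ \oo)).
    apply: (@nearW _ _ _ eventually_filter) => k /=; rewrite -(subrK c (x k)) (le_trans (ler_normD _ _))//.
    rewrite lerD2r (le_trans (ltW (xr k)))// lerD2l invf_le1 ?ler1n//.
  move=> z [[i ->]|[f zf z2]|[f f1 ->]] e e0.
  - suff : \forall k \near \oo, D (y i) (x k) <= D (y i) (y i) + e :> R by [].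
    near=> k.
    have ik : (i <= k)%N by near: k; exact: nbhs_infty_ge.
    have ke : k.+1%:R^-1 <= e by near: k; exact: small.
    have le (a b s t : R) : t <= s -> - t < a - b -> b <= a + s by lra.
    by have := Dx k i ik; rewrite dual_sub; exact: le ke.
  - by apply: (@nearW _ _ _ eventually_filter) => k /=; rewrite zf z2 pix subrr add0r ltW.
  - suff : \forall k \near \oo, f (x k) <= r + f c + e :> R by [].
    near=> k.
    have ke : k.+1%:R^-1 <= e by near: k; exact: small.
    have le (a b s t n : R) : `|a - b| <= n -> n < r + t -> t <= s -> a <= r + b + s.
      by rewrite ler_norml => /andP[_]; lra.
    by have := f1 (x k - c); rewrite dual_sub => h; exact: le h (xr k) ke.
have pixx : pi xx = xx.
  by apply: projection_fixed => f g gf; apply: (xK (g, 0)); apply: Or32; exists f.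
exists xx; split=> //.
  have [f [f1 <-]] := norming_functional (xx - c).
  rewrite dual_sub lerBlDr; apply: (xK (f, _)); apply: Or33; by exists f.
apply: (@minty_dense_solution D (range y)) => //.
  by move=> z e piz e0; have [n hn] := dY z e piz e0; exists (y n) => //; exists n.
move=> _ [i _ <-].
by rewrite dual_sub subr_ge0; apply: (xK (D (y i), _)); apply: Or31; exists i.
Unshelve. all: by end_near. Qed.

End Range.
End Monotone.

(** * The Hilbert space of a Gelfand triple *)

Section Hilbert.
Context {R : realType} {V H : completeNormedModType R} (G : gelfand_triple V H).
Local Notation ip := (inner G).
Local Notation j := (emb G).

Lemma innerDl x y z : ip (x + y) z = ip x z + ip y z.
Proof. by have := inner_linear G z 1 x y; rewrite !scale1r. Qed.

Lemma inner0l z : ip 0 z = 0.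
Proof. by apply: (addrI (ip 0 z)); rewrite -innerDl !addr0. Qed.

Lemma innerZl a x z : ip (a *: x) z = a * ip x z.
Proof. by have := inner_linear G z a x 0; rewrite addr0 inner0l addr0. Qed.

Lemma innerNl x z : ip (- x) z = - ip x z.
Proof. by rewrite -scaleN1r innerZl mulN1r. Qed.

Lemma innerBl x y z : ip (x - y) z = ip x z - ip y z.
Proof. by rewrite innerDl innerNl. Qed.

Lemma innerDr x y z : ip z (x + y) = ip z x + ip z y.
Proof. by rewrite innerC innerDl !(innerC G z). Qed.

Lemma innerZr a x z : ip z (a *: x) = a * ip z x.
Proof. by rewrite innerC innerZl (innerC G z). Qed.

Lemma innerNr x z : ip z (- x) = - ip z x.
Proof. by rewrite innerC innerNl (innerC G z). Qed.

Lemma innerBr x y z : ip z (x - y) = ip z x - ip z y.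
Proof. by rewrite innerDr innerNr. Qed.

Lemma inner_suml n (c : 'I_n -> R) (x : 'I_n -> H) z :
  ip (\sum_i c i *: x i) z = \sum_i c i * ip (x i) z.
Proof.
apply: (big_ind2 (fun u v => ip u z = v)) => [|u a v b <- <-|i _].
- exact: inner0l.
- exact: innerDl.
- exact: innerZl.
Qed.

Lemma normrD_sqr x y : `|x + y| ^+ 2 = `|x| ^+ 2 + 2 * ip x y + `|y| ^+ 2.
Proof.
rewrite -!(inner_norm G) !innerDl !innerDr (innerC G y x); ring.
Qed.

Lemma normrB_sqr x y : `|x - y| ^+ 2 = `|x| ^+ 2 - 2 * ip x y + `|y| ^+ 2.
Proof. by rewrite normrD_sqr innerNr normrN; ring. Qed.

(** Young's inequality for the inner product. *)
Lemma inner_le_sqr x y : 2 * ip x y <= `|x| ^+ 2 + `|y| ^+ 2.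
Proof. by have := sqr_ge0 `|x - y|; rewrite normrB_sqr; lra. Qed.

Lemma sqr_normD_le (x y : H) : `|x + y| ^+ 2 <= 2 * `|x| ^+ 2 + 2 * `|y| ^+ 2.
Proof. by rewrite normrD_sqr; have := inner_le_sqr x y; lra. Qed.

Lemma sqr_norm_sum_le n (x : 'I_n -> H) :
  `|\sum_i x i| ^+ 2 <= 2 ^+ n * \sum_i `|x i| ^+ 2.
Proof.
elim: n x => [|n IH] x; first by rewrite !big_ord0 normr0 expr0n mulr0.
rewrite !big_ord_recr/= (le_trans (sqr_normD_le _ _))// mulrDr lerD//.
  by rewrite [2 ^+ n.+1]exprS -mulrA ler_pM2l.
by rewrite ler_wpM2r ?sqr_ge0// [2 ^+ n.+1]exprS ler_peMr// exprn_ege1// ler1n.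
Qed.

Lemma inner_cvg (x : nat -> H) z w : x n @[n --> \oo] --> z ->
  ip (x n) w @[n --> \oo] --> ip z w.
Proof.
move=> /cvgrPdist_lt xz; apply/cvgrPdist_lt => e e0.
have w0 : 0 < `|w| + 1 by rewrite ltr_wpDl.
have /xz : 0 < e / (`|w| + 1) by rewrite divr_gt0.
apply: filterS => n; rewrite ltr_pdivlMr// => h.
rewrite -innerBl (le_lt_trans (cauchy_schwarz _ _ _))//.
by apply: le_lt_trans h; rewrite ler_wpM2l// lerDl.
Qed.

(** A minimising sequence of [|x|^2 - 2 L x] is Cauchy by the parallelogram
    identity; the vanishing of the directional derivatives at its limit is the
    representation. *)
Theorem riesz_representation (L : H -> R) M :
  (forall a x y, L (a *: x + y) = a * L x + L y) ->
  (forall x, `|L x| <= M * `|x|) -> exists z, forall x, L x = ip z x.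
Proof.
move=> lL LM.
have L0 : L 0 = 0.
  by apply: (addrI (L 0)); have := lL 1 0 0; rewrite scale1r mul1r !addr0.
have LZ a x : L (a *: x) = a * L x by have := lL a x 0; rewrite !addr0 L0 addr0.
have LD x y : L (x + y) = L x + L y by have := lL 1 x y; rewrite scale1r mul1r.
pose J x := `|x| ^+ 2 - 2 * L x.
have Jlb x : - M ^+ 2 <= J x.
  have := LM x; rewrite ler_norml /J => /andP[_ h].
  by have := sqr_ge0 (`|x| - M); rewrite sqrrB => h2; nra.
have hJ : has_inf (range J).
  split; first by exists (J 0), 0.
  by exists (- M ^+ 2) => _ [x _ <-].
pose m := inf (range J).
have Jm x : m <= J x by apply: ge_inf; [case: hJ|exists x].
have /choice[x hx] n : exists x, J x < m + n.+1%:R^-1.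
  have n0 : 0 < n.+1%:R^-1 :> R by rewrite invr_gt0.
  by have [_ [x _ <-] h] := inf_adherent n0 hJ; exists x.
have xx n k : `|x n - x k| ^+ 2 <= 2 * (n.+1%:R^-1 + k.+1%:R^-1).
  have h := Jm (2^-1 *: (x n + x k)).
  have := normrD_sqr (x n) (x k); have := normrB_sqr (x n) (x k).
  move: h (hx n) (hx k); rewrite /J normrZ exprMn LZ LD ger0_norm ?invr_ge0//.
  set a := `|_ + _| ^+ 2; set b := `|_ - _| ^+ 2; set c := ip _ _.
  set f := n.+1%:R^-1; set g := k.+1%:R^-1.
  move=> h1 h2 h3 h4 h5.
  have h6 : 4 * m <= a - 4 * (L (x n) + L (x k)) by move: h1; rewrite (_ : 2^-1 ^+ 2 = 4^-1) => [|]; [lra|field].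
  by lra.
have /cauchy_cvgP xcvg : cauchy (x @ \oo).
  apply: cauchy_exP => e e0.
  have e4 : 0 < e ^+ 2 / 4 by rewrite divr_gt0 ?exprn_gt0.
  have [N _ hN] := near_infty_natSinv_lt (PosNum e4).
  exists (x N); exists N => // n /= Nn; rewrite -ball_normE /ball_/=.
  rewrite -(ltr_pXn2r (n := 2)) ?nnegrE ?(ltW e0)//.
  apply: le_lt_trans (xx N n) _.
  have hN' k : (N <= k)%N -> k.+1%:R^-1 < e ^+ 2 / 4 := hN k.
  have := hN' N (leqnn N); have := hN' n Nn.
  by set a := n.+1%:R^-1; set b := N.+1%:R^-1; set f := e ^+ 2; lra.
pose z := lim (x @ \oo); exists z => v.
have xz : x n @[n --> \oo] --> z by [].
have quad t : 0 <= 2 * t * (ip z v - L v) + t ^+ 2 * `|v| ^+ 2.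
  have cv : (2 * t * (ip (x n) v - L v) + t ^+ 2 * `|v| ^+ 2 + n.+1%:R^-1)
      @[n --> \oo] --> 2 * t * (ip z v - L v) + t ^+ 2 * `|v| ^+ 2 + 0.
    apply: cvgD; last exact: cvg_harmonic.
    apply: cvgD; last exact: cvg_cst.
    apply: cvgM; first exact: cvg_cst.
    by apply: cvgB; [exact: inner_cvg|exact: cvg_cst].
  rewrite -[X in _ <= X]addr0; apply: (cvgr_to_ge cv); apply: nearW => n.
  have := Jm (x n + t *: v); have := hx n.
  rewrite /J LD LZ normrD_sqr innerZr normrZ exprMn real_normK ?num_real//.
  by set f := n.+1%:R^-1; lra.
apply/eqP; rewrite eq_sym -subr_eq0; apply/eqP.
set a := ip z v - L v in quad *; set b := `|v| ^+ 2 in quad.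
have b0 : 0 <= b by rewrite sqr_ge0.
have := quad (- (a / (b + 1))).
have -> : 2 * - (a / (b + 1)) * a + (- (a / (b + 1))) ^+ 2 * b =
  - (a ^+ 2 * ((b + 2) / (b + 1) ^+ 2)).
  by field; lra.
rewrite oppr_ge0 pmulr_lle0; last by rewrite divr_gt0 ?exprn_gt0//; lra.
by move=> a2; apply/eqP; rewrite -sqrf_eq0 eq_le a2 sqr_ge0.
Qed.

Lemma emb_bounded : exists2 c, 0 < c & forall x, `|j x| <= c * `|x|.
Proof.
have /linear_boundedP : bounded_near j (nbhs 0).
  by apply: continuous_linear_bounded; exact: emb_continuous.
by move=> /pinfty_ex_gt0[M M0 /= piM]; exists M.
Qed.

Lemma emb_approx (h : H) e : 0 < e -> exists v : V, `|h - j v| < e.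
Proof.
move=> e0; have [x [bx [v _ vx]]] := @emb_dense _ _ _ G (ball h e)
  (ex_intro _ h (ballxx h e0)) (ball_open h e).
by exists v; move: bx; rewrite -ball_normE /ball_/= vx.
Qed.

Lemma emb_seq_dense (h : H) : exists v : nat -> V, j (v n) @[n --> \oo] --> h.
Proof.
have /choice[v hv] n : exists v : V, `|h - j v| < n.+1%:R^-1.
  by apply: emb_approx; rewrite invr_gt0.
exists v; apply/cvgrPdist_lt => e e0; near=> n.
apply: lt_trans (hv n) _; near: n; exact: near_infty_natSinv_lt (PosNum e0).
Unshelve. all: by end_near. Qed.

Lemma inner_dual (h : H) : exists f : dual H, forall x, f x = ip x h.
Proof.
apply: (@bounded_linear_dual _ _ _ `|h|) => [a x y|x].
  by rewrite innerDl innerZl.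
by rewrite mulrC; exact: cauchy_schwarz.
Qed.

End Hilbert.

Section Bidual.
Context {R : realType} (V : normedModType R).

Lemma evaluation_bidual (v : V) : exists Phi : dual (dual V), forall f, Phi f = f v.
Proof.
apply: (@bounded_linear_dual _ _ _ `|v|) => [a f g //|f].
by rewrite mulrC; exact: dual_le_norm.
Qed.

End Bidual.

(** * Measurability with respect to a complete sub-sigma-algebra *)

Lemma separable_sequence (R : realType) (E : normedModType R) : separable E ->
  exists y : nat -> E, forall x e, 0 < e -> exists n, `|y n - x| < e.
Proof.
move=> [D [/countable_injP[f] injf denseD]].
exists (fun n => xget 0 [set x | D x /\ f x = n]) => x e e0.
have [z [bz Dz]] := denseD (ball x e) (ex_intro _ x (ballxx x e0)) (ball_open x e).
exists (f z); set z' := xget _ _.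
have [Dz' fz'] : D z' /\ f z' = f z by apply: (@xgetPex _ _ [set t | D t /\ f t = f z]); exists z.
have -> : z' = z by apply: injf => //; rewrite inE.
by move: bz; rewrite -ball_normE /ball_/= distrC.
Qed.

Section SubSigmaAlgebra.
Context {R : realType} {d : measure_display} {Omega : measurableType d}.
Variables (P : probability Omega R) (S : set (set Omega)).

Definition complete_sub_sigma_algebra :=
  [/\ sigma_algebra setT S, S `<=` measurable &
      forall N, P.-negligible N -> S N].

Hypothesis cS : complete_sub_sigma_algebra.

Let sigS : sigma_algebra setT S. Proof. by case: cS. Qed.

Lemma measurable_sub_sigma :
  (@measurable _ (g_sigma_algebraType S) : set (set Omega)) = S.
Proof. exact: sigma_algebra_id. Qed.

Lemma measurable_wrtP d' (E : measurableType d') (X : Omega -> E) :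
  measurable_wrt S X <-> forall U, measurable U -> S (X @^-1` U).
Proof.
split=> [mX U mU|h _ U mU].
  by have := mX measurableT U mU; rewrite setTI measurable_sub_sigma.
by rewrite setTI measurable_sub_sigma; exact: h.
Qed.

Lemma sigma_setC A : S A -> S (~` A).
Proof. by case: sigS => _ h _ /h; rewrite setTD. Qed.

Lemma sigma_set0 : S set0. Proof. by case: sigS. Qed.

Lemma sigma_setT : S setT. Proof. by rewrite -setC0; apply/sigma_setC/sigma_set0. Qed.

Lemma sigma_bigcup (A : nat -> set Omega) : (forall n, S (A n)) -> S (\bigcup_n A n).
Proof. by case: sigS => _ _ h /h. Qed.

Lemma sigma_bigcap (A : nat -> set Omega) : (forall n, S (A n)) -> S (\bigcap_n A n).
Proof.
by move=> SA; rewrite -(setCK (\bigcap_n A n)) setC_bigcap; apply/sigma_setC/sigma_bigcup => n; exact: sigma_setC.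
Qed.

Lemma sigma_setI A B : S A -> S B -> S (A `&` B).
Proof.
rewrite -measurable_sub_sigma => mA mB; exact: (@measurableI _ (g_sigma_algebraType S)).
Qed.

Lemma sigma_setU A B : S A -> S B -> S (A `|` B).
Proof.
rewrite -measurable_sub_sigma => mA mB; exact: (@measurableU _ (g_sigma_algebraType S)).
Qed.

Lemma sigma_ae A : {ae P, forall w, A w} -> S A.
Proof. by move=> hA; rewrite -(setCK A); apply: sigma_setC; case: cS => _ _; apply. Qed.

Lemma sigma_ae_eq A B : S A -> {ae P, forall w, A w <-> B w} -> S B.
Proof.
move=> SA h.
have -> : B = (A `&` [set w | A w <-> B w]) `|` (B `&` ~` [set w | A w <-> B w]).
  by apply/seteqP; split=> w /=; [have [] := pselect (A w <-> B w)|]; tauto.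
apply: sigma_setU; first by apply: sigma_setI => //; exact: sigma_ae.
by case: cS => _ _; apply; apply: negligibleS h => w [].
Qed.

Lemma measurable_wrt_ae d' (E : measurableType d') (X Y : Omega -> E) :
  measurable_wrt S X -> {ae P, forall w, X w = Y w} -> measurable_wrt S Y.
Proof.
move=> /measurable_wrtP mX XY; apply/measurable_wrtP => U mU.
by apply: sigma_ae_eq (mX _ mU) _; apply: filterS XY => w /= ->.
Qed.

Lemma measurable_wrt_measurable d' (E : measurableType d') (X : Omega -> E) :
  measurable_wrt S X -> measurable_fun setT X.
Proof.
move=> /measurable_wrtP mX _ U mU; rewrite setTI.
by case: cS => _ h _; apply: h; exact: mX.
Qed.

(** Almost sure convergence suffices, since the null sets belong to [S]. *)
Lemma measurable_wrt_limit (X : nat -> Omega -> R) (Y : Omega -> R) :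
  (forall n, measurable_wrt S (X n)) ->
  {ae P, forall w, X n w @[n --> \oo] --> Y w} -> measurable_wrt S Y.
Proof.
move=> mX XY; pose A := [set w | X n w @[n --> \oo] --> Y w].
pose X' n w := if w \in A then X n w else 0.
pose Y' w := if w \in A then Y w else 0.
have AE : {ae P, forall w, w \in A} by apply: filterS XY => w Aw; exact: mem_set.
have mX' n : measurable_wrt S (X' n).
  apply: measurable_wrt_ae (mX n) _.
  by apply: filterS AE => w wA; rewrite /X' wA.
have mY' : measurable_wrt S Y'.
  apply: (@measurable_fun_cvg _ (g_sigma_algebraType S) R setT X') => // w _.
  rewrite /X' /Y'; case: ifPn => [/set_mem//|_]; exact: cvg_cst.
apply: measurable_wrt_ae mY' _.
by apply: filterS AE => w wA; rewrite /Y' wA.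
Qed.

Lemma measurable_wrt_piecewise (N : Omega -> nat) (g : nat -> Omega -> R) :
  (forall n, S [set w | N w = n]) -> (forall n, measurable_wrt S (g n)) ->
  measurable_wrt S (fun w => g (N w) w).
Proof.
move=> SN mg; apply/measurable_wrtP => U mU.
rewrite (_ : _ @^-1` _ = \bigcup_n ([set w | N w = n] `&` g n @^-1` U)); last first.
  by apply/seteqP; split=> w /= => [h|[n _ [<-]]]//; exists (N w).
apply: sigma_bigcup => n; apply: sigma_setI => //.
by have /measurable_wrtP := mg n; apply.
Qed.

Section Borel.
Context {V : normedModType R}.
Hypothesis sepV : separable V.

(** Every open set is a countable union of closed balls with centre in a dense
    sequence and radius [1 / (k + 1)]. *)
Lemma measurable_wrt_borel (X : Omega -> V) :
  (forall c r, S [set w | `|X w - c| <= r]) ->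
  measurable_wrt S (X : Omega -> borel V).
Proof.
move=> SX; have [y dy] := separable_sequence sepV.
have mX : forall U, @open V U -> S (X @^-1` U).
  move=> U oU.
  pose C n k := [set x : V | `|x - y n| <= k.+1%:R^-1].
  rewrite (_ : _ @^-1` _ = \bigcup_n \bigcup_k
     if `[< C n k `<=` U >] then X @^-1` C n k else set0); last first.
    apply/seteqP; split=> w /=; last first.
      move=> [n _ [k _]]; case: asboolP => // CU Cw; exact: CU.
    move=> Uw; have /nbhs_ballP[e /= e0 eU] : nbhs (X w) U by exact: open_nbhs_nbhs.
    have e2 : 0 < e / 2 by rewrite divr_gt0.
    have [k _ /(_ k (leqnn k)) hk'] := near_infty_natSinv_lt (PosNum e2).
    have hk : k.+1%:R^-1 < e / 2 := hk'.
    have k0 : 0 < k.+1%:R^-1 :> R by rewrite invr_gt0.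
    have [n hn] := dy (X w) _ k0.
    exists n => //; exists k => //; case: asboolP => [_|]; last first.
      case=> x; rewrite /C/= => xn; apply: eU; rewrite -ball_normE /ball_/=.
      rewrite -(subrK (y n) (X w)) -addrA (le_lt_trans (ler_normD _ _))//.
      rewrite (distrC (X w)) (distrC (y n) x).
      by move: hk xn hn; set a := k.+1%:R^-1; lra.
    by rewrite /C/= distrC ltW.
  apply: sigma_bigcup => n; apply: sigma_bigcup => k.
  case: ifPn => _; first exact: SX.
  exact: sigma_set0.
move=> _ U; apply: (@smallest_sub _ _ _ [set U | (@measurable _ (g_sigma_algebraType S)) (setT `&` X @^-1` U)]).
  split => /=.
  - by rewrite preimage_set0 setI0; exact: measurable0.
  - move=> A /=; rewrite !setTI !setTD preimage_setC; exact: measurableC.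
  - move=> A /= mA; rewrite setTI preimage_bigcup.
    by apply: bigcup_measurable => k _; have := mA k; rewrite setTI.
by move=> A oA /=; rewrite setTI measurable_sub_sigma; exact: mX.
Qed.

Lemma measurable_wrt_borel_open (X : Omega -> V) (U : set V) :
  measurable_wrt S (X : Omega -> borel V) -> open U -> S (X @^-1` U).
Proof.
move=> /measurable_wrtP mX oU; apply: mX.
exact: sub_sigma_algebra.
Qed.

Lemma measurable_wrt_continuous (X : Omega -> V) (f : V -> R) :
  continuous f -> measurable_wrt S (X : Omega -> borel V) ->
  measurable_wrt S (f \o X).
Proof.
move=> cf mX; apply: (measurability _ (RGenOpens.measurableE R)).
move=> _ [_ [a [b ->] <-]]; rewrite setTI measurable_sub_sigma comp_preimage.
have oU := @interval_open R (BRight a) (BLeft b) isT isT.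
by apply: measurable_wrt_borel_open => //; apply: open_comp => // x _; exact: cf.
Qed.

(** Approximate [X] by the first point of a dense sequence within [1 / (k + 1)]: along
    these countably valued variables [f] is measurable piece by piece. *)
Lemma measurable_wrt_caratheodory (f : V -> Omega -> R) (X : Omega -> V) :
  (forall x, measurable_wrt S (f x)) ->
  {ae P, forall w, continuous (f ^~ w)} ->
  measurable_wrt S (X : Omega -> borel V) ->
  measurable_wrt S (fun w => f (X w) w).
Proof.
move=> mf cf mX; have [y dy] := separable_sequence sepV.
have exN k w : exists n, `|y n - X w| < k.+1%:R^-1.
  by apply: dy; rewrite invr_gt0.
pose N k w := ex_minn (exN k w).
apply: (@measurable_wrt_limit (fun k w => f (y (N k w)) w)).
  move=> k; apply: (@measurable_wrt_piecewise (N k) (fun n => f (y n))) => // n.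
  pose B l := [set w | `|y l - X w| < k.+1%:R^-1].
  have SB l : S (B l).
    rewrite (_ : B l = X @^-1` ball (y l) k.+1%:R^-1); last first.
      by apply/seteqP; split=> w; rewrite /B /= -ball_normE.
    by apply: measurable_wrt_borel_open => //; exact: ball_open.
  rewrite (_ : mkset _ = B n `&` \bigcap_l (if (l < n)%N then ~` B l else setT)).
    apply: sigma_setI => //; apply: sigma_bigcap => l; case: ifPn => _.
      exact: sigma_setC.
    exact: sigma_setT.
  apply/seteqP; split=> w /=; rewrite /N.
    case: ex_minnP => m Bm mmin <-; split=> // l _; case: ifPn => // lm /= Bl.
    by have := mmin _ Bl; rewrite leqNgt lm.
  case: ex_minnP => m Bm mmin [Bn hl]; apply/eqP; rewrite eqn_leq mmin//= leqNgt.
  by apply/negP => mn; have := hl m I; rewrite mn; exact.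
apply: filterS cf => w cfw.
have yX : y (N k w) @[k --> \oo] --> X w.
  apply/cvgrPdist_lt => e e0; near=> k.
  rewrite distrC /N; case: ex_minnP => n hn _; apply: lt_trans hn _.
  by near: k; exact: near_infty_natSinv_lt (PosNum e0).
exact: (cvg_comp _ _ yX (cfw (X w))).
Unshelve. all: by end_near. Qed.

End Borel.

End SubSigmaAlgebra.

(** * Integrable real functions *)

Section RealIntegrable.
Context {R : realType} {d : measure_display} {T : measurableType d}.
Variables (nu : {measure set T -> \bar R}) (D : set T).
Hypothesis mD : measurable D.
Implicit Types f g : T -> R.
Local Notation Int f := (nu.-integrable D (EFin \o f)).

Lemma bounded_integrable f M : (nu D < +oo)%E ->
  measurable_fun D f -> (forall x, D x -> `|f x| <= M) -> Int f.
Proof.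
move=> Dfin mf fM; apply: measurable_bounded_integrable => //.
by exists M; split=> [|r Mr x /= Dx]; rewrite ?num_real// (le_trans (fM x Dx))// ltW.
Qed.

Lemma cst_integrable c : (nu D < +oo)%E -> Int (fun=> c).
Proof. by move=> Dfin; apply: (@bounded_integrable _ `|c|). Qed.

Lemma integrable_addr f g : Int f -> Int g -> Int (fun x => f x + g x).
Proof. by move=> If Ig; apply: (eq_integrable mD _ _ _ (integrableD mD If Ig)). Qed.

Lemma integrable_subr f g : Int f -> Int g -> Int (fun x => f x - g x).
Proof. by move=> If Ig; apply: (eq_integrable mD _ _ _ (integrableB mD If Ig)). Qed.

Lemma integrable_scale c f : Int f -> Int (fun x => c * f x).
Proof. by move=> If; apply: (eq_integrable mD _ _ _ (integrableZl mD c If)). Qed.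

Lemma integrable_scaler c f : Int f -> Int (fun x => f x * c).
Proof. by move=> If; apply: (eq_integrable mD _ _ _ (integrableZr mD c If)). Qed.

Lemma le_integrableR f g : measurable_fun D f ->
  (forall x, D x -> `|f x| <= g x) -> Int g -> Int f.
Proof.
move=> mf fg Ig.
apply: (@le_integrable _ _ _ nu _ mD _ (EFin \o g)) => //; first exact/measurable_EFinP.
by move=> x Dx /=; rewrite lee_fin; exact: le_trans (fg x Dx) (ler_norm _).
Qed.

Lemma integrable_norm f : Int f -> Int (fun x => `|f x|).
Proof. by move=> If; apply: (eq_integrable mD _ _ _ (integrable_abse If)). Qed.

Lemma integrable_measurable f : Int f -> measurable_fun D f.
Proof. by move=> /integrableP[/measurable_EFinP]. Qed.

Lemma EFin_Rintegral f : Int f ->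
  (\int[nu]_(x in D) f x)%:E = (\int[nu]_(x in D) (f x)%:E)%E.
Proof. by move=> If; rewrite fineK//; exact: integrable_fin_num. Qed.

Lemma Rintegral_abs_le f g : measurable_fun D f -> Int g ->
  (forall x, D x -> `|f x| <= g x) ->
  `|\int[nu]_(x in D) f x| <= \int[nu]_(x in D) g x.
Proof.
move=> mf Ig fg; have If := le_integrableR mf fg Ig.
rewrite (le_trans (le_normr_Rintegral mD If))//; apply: le_Rintegral => //.
apply: (le_integrableR _ _ Ig); first exact: measurableT_comp.
by move=> x Dx; rewrite normr_id fg.
Qed.

Lemma Rintegral_lin a f g : Int f -> Int g ->
  \int[nu]_(x in D) (a * f x + g x) =
  a * \int[nu]_(x in D) f x + \int[nu]_(x in D) g x.
Proof.
by move=> If Ig; rewrite RintegralD ?RintegralZl//; exact: integrable_scale.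
Qed.

End RealIntegrable.

(** * Time integrals of adapted processes *)

Section AdaptedIntegral.
Context {R : realType} {d : measure_display} {Omega : measurableType d}.
Variable P : probability Omega R.
Local Notation mu := (@lebesgue_measure R).
Variables (J : set R) (de : R).
Hypotheses (mJ : measurable J) (de0 : 0 < de) (muJ : mu J = de%:E).

Lemma J_finite : (mu J < +oo)%E. Proof. by rewrite muJ ltry. Qed.

Lemma tonelli_on (g : R -> Omega -> R) :
  measurable_fun setT (fun z : R * Omega => g z.1 z.2) ->
  (forall s w, 0 <= g s w) ->
  (\int[mu]_(s in J) \int[P]_w (g s w)%:E =
   \int[P]_w \int[mu]_(s in J) (g s w)%:E)%E.
Proof.
move=> mg g0.
pose f (z : R * Omega) : \bar R := (g z.1 z.2 * \1_J z.1)%:E.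
have mf : measurable_fun setT f.
  apply/measurable_EFinP; apply: measurable_funM => //.
  by apply: measurableT_comp => //; exact: measurable_indic.
have f0 z : (0 <= f z)%E by rewrite lee_fin mulr_ge0.
have e (h : R -> R) : (\int[mu]_(s in J) (h s)%:E = \int[mu]_s (h s * \1_J s)%:E)%E.
  rewrite integral_mkcond; apply: eq_integral => s _.
  by rewrite patchE indicE; case: ifPn; rewrite ?mulr1 ?mulr0.
have := @fubini_tonelli _ _ _ _ R mu P f mf f0; rewrite /f /=.
under [in X in _ = X]eq_integral do rewrite -(e (g^~ _)).
move=> <-; rewrite integral_mkcond; apply: eq_integral => s _.
rewrite patchE indicE; case: ifPn => _; first by under [RHS]eq_integral do rewrite mulr1.
by under eq_integral do rewrite mulr0; rewrite integral0.
Qed.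

Section UnitValued.
Variable X : R -> Omega -> R.
Hypothesis mX : measurable_fun setT (fun z : R * Omega => X z.1 z.2).
Hypothesis X01 : forall s w, 0 <= X s w <= 1.

Let Y w := de^-1 * \int[mu]_(s in J) X s w.

Lemma measurable_section_time w : measurable_fun setT (X ^~ w).
Proof. exact: (measurable_fun_pair1 w mX). Qed.

Lemma measurable_section_chance s : measurable_fun setT (X s).
Proof. exact: (measurable_fun_pair2 s mX). Qed.

Lemma integrable_section w : mu.-integrable J (EFin \o X ^~ w).
Proof.
apply: (@bounded_integrable _ _ _ _ _ _ _ 1) => //; first exact: J_finite.
  by apply: measurable_funTS; exact: measurable_section_time.
by move=> s _; have /andP[x0 x1] := X01 s w; rewrite ger0_norm.
Qed.

Lemma measurable_average : measurable_fun setT Y.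
Proof.
apply: measurable_funM => //.
pose f (z : R * Omega) : \bar R := (X z.1 z.2 * \1_J z.1)%:E.
have mf : measurable_fun setT f.
  apply/measurable_EFinP; apply: measurable_funM => //.
  by apply: measurableT_comp => //; exact: measurable_indic.
have f0 z : (0 <= f z)%E.
  by rewrite lee_fin mulr_ge0//; case/andP: (X01 z.1 z.2).
have := @measurable_fun_fubini_tonelli_G _ _ _ _ R mu f mf f0.
move=> /(measurableT_comp (@fine_measurable R setT measurableT)).
rewrite (_ : _ \o _ = fun w => \int[mu]_(s in J) X s w)//.
apply/funext => w; rewrite [RHS]/Rintegral [in RHS]integral_mkcond /=; congr fine.
apply: eq_integral => s _; rewrite /f /= patchE indicE.
by case: ifPn => _; rewrite ?mulr1 ?mulr0.
Qed.

Lemma average_bounds w : 0 <= Y w <= 1.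
Proof.
have I0 : 0 <= \int[mu]_(s in J) X s w.
  by apply: Rintegral_ge0 => s _; case/andP: (X01 s w).
have dei : 0 <= de^-1 by rewrite invr_ge0 ltW.
rewrite /Y mulr_ge0//= mulrC ler_pdivrMr// mul1r.
have -> : de = \int[mu]_(s in J) 1 by rewrite Rintegral_cst//= muJ mul1r.
apply: le_Rintegral => //; first exact: integrable_section.
  apply: (@bounded_integrable _ _ _ _ _ _ _ 1) => //; first exact: J_finite.
  by move=> s _; rewrite normr1.
by move=> s _; case/andP: (X01 s w).
Qed.

Lemma integral_sqr_deviation (c w : _) :
  (\int[mu]_(s in J) ((c + Y w - X s w) ^+ 2)%:E <= (de * (c ^+ 2 + 1))%:E)%E.
Proof.
pose k := c + Y w.
have iX := integrable_section w.
have ik : mu.-integrable J (EFin \o (fun=> k ^+ 2 + 1)).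
  by apply: cst_integrable => //; exact: J_finite.
have ikX : mu.-integrable J (EFin \o (fun s => 2 * k * X s w)).
  exact: integrable_scale.
have idiff : mu.-integrable J (EFin \o (fun s => k ^+ 2 + 1 - 2 * k * X s w)).
  exact: integrable_subr.
have msec : measurable_fun J (X^~ w).
  by apply: measurable_funTS; exact: measurable_section_time.
apply: (@le_trans _ _ (\int[mu]_(s in J) (k ^+ 2 + 1 - 2 * k * X s w)%:E)%E).
  apply: ge0_le_integral => //.
  - by move=> s _; rewrite lee_fin sqr_ge0.
  - apply/measurable_EFinP; apply: measurable_funX.
    by apply: measurable_funB => //; exact: measurable_cst.
  - by move: idiff => /integrableP[].
  - move=> s _; rewrite lee_fin -/k; have /andP[x0 x1] := X01 s w.
    by have : X s w ^+ 2 <= 1; [rewrite exprn_ile1//|rewrite sqrrB; lra].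
rewrite -(fineK (integrable_fin_num _ idiff))// -/(Rintegral _ _ _) lee_fin.
rewrite RintegralB// RintegralZl// Rintegral_cst//= muJ /=.
have -> : \int[mu]_(s in J) X s w = de * Y w by rewrite /Y mulrA divff ?gt_eqF// mul1r.
rewrite (_ : _ - _ = de * (c ^+ 2 - Y w ^+ 2 + 1)); last by rewrite /k; ring.
by rewrite ler_pM2l// lerD2r gerBl sqr_ge0.
Qed.

Let sq (f : Omega -> R) : \bar R := (\int[P]_w ((f w) ^+ 2)%:E)%E.

(** On average over [s] in [J], adding the centred variable [Y - X s] raises the
    second moment by at most 1; hence some [s] does not raise it by more than 2. *)
Lemma greedy_sample (f : Omega -> R) K : measurable_fun setT f ->
  (forall w, `|f w| <= K) -> exists2 s, J s &
  (sq (fun w => f w + (Y w - X s w))%R <= sq f + 2%:E)%E.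
Proof.
move=> mf fK; apply: contrapT => no.
have {}no s : J s -> (sq f + 2%:E < sq (fun w => f w + (Y w - X s w))%R)%E.
  by move=> Js; rewrite ltNge; apply/negP => h; apply: no; exists s.
have sq0 : (0 <= sq f)%E by apply: integral_ge0 => w _; rewrite lee_fin sqr_ge0.
have mf2 : measurable_fun setT (fun w => ((f w) ^+ 2)%:E).
  by apply/measurable_EFinP; exact: measurable_funX.
have sqfin : sq f \is a fin_num.
  rewrite ge0_fin_numE//.
  have /integrableP[_] : P.-integrable setT (EFin \o (fun w => f w ^+ 2)).
    apply: (@bounded_integrable _ _ _ _ _ _ _ (K ^+ 2)) => //.
    - exact: le_lt_trans (probability_le1 P measurableT) (ltry _).
    - exact: measurable_funX.
    - move=> w _; rewrite normrX ler_pXn2r ?nnegrE//.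
      by rewrite (le_trans _ (fK w)).
  apply: le_lt_trans; apply: ge0_le_integral => //.
  - by move=> w _; rewrite lee_fin sqr_ge0.
  - exact: measurableT_comp.
  - by move=> w _; rewrite lee_fin ler_norm.
have mg : measurable_fun setT
    (fun z : R * Omega => (f z.2 + (Y z.2 - X z.1 z.2)) ^+ 2).
  apply: measurable_funX; apply: measurable_funD.
    exact: (measurableT_comp mf measurable_snd).
  apply: measurable_funB => //.
  exact: (measurableT_comp measurable_average measurable_snd).
have T := tonelli_on (g := fun s w => (f w + (Y w - X s w)) ^+ 2) mg
  (fun s w => sqr_ge0 _).
have lo : ((sq f + 2%:E) * de%:E <=
    \int[mu]_(s in J) \int[P]_w ((f w + (Y w - X s w)) ^+ 2)%R%:E)%E.
  rewrite -muJ -integral_cst//; apply: ge0_le_integral => //.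
  - by move=> s _; rewrite adde_ge0.
  - pose F (z : R * Omega) := ((f z.2 + (Y z.2 - X z.1 z.2)) ^+ 2)%:E.
    have mF : measurable_fun setT F by apply/measurable_EFinP.
    have F0 z : (0 <= F z)%E by rewrite lee_fin sqr_ge0.
    have := @measurable_fun_fubini_tonelli_F _ _ _ _ R P F mF F0.
    exact: measurable_funTS.
  - by move=> s Js; apply: ltW; exact: no.
have hi : (\int[P]_w \int[mu]_(s in J) ((f w + (Y w - X s w)) ^+ 2)%R%:E <=
    de%:E * (sq f + 1))%E.
  have -> : (de%:E * (sq f + 1) = \int[P]_w (de * (f w ^+ 2 + 1))%R%:E)%E.
    rewrite /sq -[X in (_ * (_ + X))%E](@probability_setT _ _ _ P) -[X in (_ * (_ + X))%E]mul1e.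
    rewrite -integral_cst// -ge0_integralD//; last first.
      by move=> w _; rewrite lee_fin sqr_ge0.
    rewrite -ge0_integralZl//; last first.
    - by rewrite lee_fin ltW.
    - by move=> w _; rewrite adde_ge0// lee_fin sqr_ge0.
    - exact: emeasurable_funD.
  apply: ge0_le_integral => //.
  - by move=> w _; apply: integral_ge0 => s _; rewrite lee_fin sqr_ge0.
  - pose F (z : R * Omega) := ((f z.2 + (Y z.2 - X z.1 z.2)) ^+ 2 * \1_J z.1)%:E.
    have mF : measurable_fun setT F.
      apply/measurable_EFinP; apply: measurable_funM => //.
      by apply: measurableT_comp => //; exact: measurable_indic.
    have F0 z : (0 <= F z)%E by rewrite lee_fin mulr_ge0// sqr_ge0.
    have := @measurable_fun_fubini_tonelli_G _ _ _ _ R mu F mF F0.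
    rewrite (_ : fubini_G _ _ = fun w => \int[mu]_(s in J) ((f w + (Y w - X s w)) ^+ 2)%R%:E)%E//.
    apply/funext => w; rewrite /fubini_G [RHS]integral_mkcond.
    apply: eq_integral => s _; rewrite /F /= patchE indicE.
    by case: ifPn => _; rewrite ?mulr1 ?mulr0.
  - apply/measurable_EFinP; apply: measurable_funM => //.
    by apply: measurable_funD => //; exact: measurable_funX.
  - move=> w _; have := integral_sqr_deviation (f w) w.
    by under eq_integral do rewrite -addrA.
rewrite T in lo; have := le_trans lo hi.
rewrite -(fineK sqfin) -EFinD -!EFinM lee_fin.
by rewrite mulrC ler_pM2l//; lra.
Qed.

End UnitValued.
End AdaptedIntegral.

Lemma Rintegral_dominated (R : realType) d (T : measurableType d)
    (nu : {measure set T -> \bar R}) (D : set T) (f : nat -> T -> R) (l g : T -> R) :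
  measurable D -> (forall n, measurable_fun D (f n)) ->
  (forall x, D x -> f n x @[n --> \oo] --> l x) ->
  nu.-integrable D (EFin \o g) -> (forall n x, D x -> `|f n x| <= g x) ->
  \int[nu]_(x in D) f n x @[n --> \oo] --> \int[nu]_(x in D) l x.
Proof.
move=> mD mf fl Ig fg.
have mlim : measurable_fun D l by exact: measurable_fun_cvg mf fl.
have Il : nu.-integrable D (EFin \o l).
  apply: (le_integrableR mD mlim _ Ig) => x Dx.
  apply: (cvgr_to_le (cvg_norm (fl x Dx))); apply: nearW => n; exact: fg.
have [] := @dominated_convergence _ _ _ nu D mD (fun n => EFin \o f n) (EFin \o l)
  (EFin \o g).
- by move=> n; exact/measurable_EFinP.
- exact/measurable_EFinP.
- apply: aeW => x Dx; apply: cvg_EFin; first exact: nearW.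
  exact: fl.
- exact: Ig.
- by apply: aeW => x n Dx; exact: fg.
move=> _ _; rewrite -EFin_Rintegral//; move/fine_cvgP => [_]; apply: cvg_trans.
by apply: near_eq_cvg; apply: nearW => n.
Qed.

Section L2Summable.
Context {R : realType} {d : measure_display} {Omega : measurableType d}.
Variable P : probability Omega R.

(** The series of the squares has a finite expectation, hence converges almost surely. *)
Lemma l2_summable_cvg0 (f : nat -> Omega -> R) :
  (forall n, measurable_fun setT (f n)) ->
  (forall n, (\int[P]_w (f n w ^+ 2)%:E <= (1 / (2 ^ n.+1)%:R)%:E)%E) ->
  {ae P, forall w, f n w @[n --> \oo] --> (0 : R)}.
Proof.
move=> mf f2.
pose F n w := (f n w ^+ 2)%:E.
have F0 n w : (0 <= F n w)%E by rewrite lee_fin sqr_ge0.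
have mF n : measurable_fun setT (F n).
  by apply/measurable_EFinP; exact: measurable_funX.
pose G w := (\sum_(n <oo) F n w)%E.
have G0 w : (0 <= G w)%E by exact: nneseries_ge0.
have mG : measurable_fun setT G by exact: ge0_emeasurable_sum.
have IG : P.-integrable setT G.
  apply/integrableP; split => //.
  under eq_integral do rewrite gee0_abs//.
  rewrite integral_nneseries//; apply: (@le_lt_trans _ _ 1%E); last exact: ltry.
  apply: le_trans (epsilon_trick0 xpredT (@ler01 R)).
  by apply: lee_nneseries => [n _ _|n _]; [exact: integral_ge0|exact: f2].
have := integrable_ae measurableT IG; apply: filterS => w /(_ I) Gw.
have sqcvg : f n w ^+ 2 @[n --> \oo] --> (0 : R).
  apply: cvg_series_cvg_0; apply: nondecreasing_is_cvgn.
    by apply: nondecreasing_series => n _ _; exact: sqr_ge0.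
  exists (fine (G w)) => _ [n _ <-]; rewrite -lee_fin fineK//.
  rewrite /series/= -sumEFin.
  exact: (@nneseries_lim_ge R (fun n => F n w) xpredT 0 n).
apply/cvgrPdist_lt => e e0.
have /cvgrPdist_lt/(_ _ (exprn_gt0 2 e0)) := sqcvg.
apply: filterS => n; rewrite !sub0r !normrN normrX.
by rewrite ltr_pXn2r ?nnegrE// ltW.
Qed.

End L2Summable.

Section AdaptedMeasurable.
Context {R : realType} {d : measure_display} {Omega : measurableType d}.
Variables (P : probability Omega R) (S : set (set Omega)).
Hypothesis cS : complete_sub_sigma_algebra P S.
Local Notation mu := (@lebesgue_measure R).
Variables (J : set R) (de : R).
Hypotheses (mJ : measurable J) (de0 : 0 < de) (muJ : mu J = de%:E).

Section UnitValuedAdapted.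
Variable X : R -> Omega -> R.
Hypothesis mX : measurable_fun setT (fun z : R * Omega => X z.1 z.2).
Hypothesis X01 : forall s w, 0 <= X s w <= 1.
Hypothesis aX : forall s, J s -> measurable_wrt S (X s).

Let Y w := de^-1 * \int[mu]_(s in J) X s w.

(** The sampling times are chosen one by one, so as to keep, up to a
    factor 2, the variance of an independent sample without any independence. *)
Lemma greedy_samples n : exists l : seq R, [/\ size l = n,
  forall s, s \in l -> J s &
  (\int[P]_w ((\sum_(s <- l) (Y w - X s w)) ^+ 2)%:E <= (2 * n%:R)%:E)%E].
Proof.
elim: n => [|n [l [sl lJ h]]].
  exists [::]; split=> //; under eq_integral do rewrite big_nil expr0n.
  by rewrite integral0 mulr0.
have mY : measurable_fun setT Y by exact: measurable_average.
have mXs s : measurable_fun setT (X s) by exact: measurable_section_chance.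
have ml : measurable_fun setT (fun w => \sum_(s <- l) (Y w - X s w)).
  by apply: measurable_sum => s; exact: measurable_funB.
have bl w : `|\sum_(s <- l) (Y w - X s w)| <= n%:R.
  rewrite (le_trans (ler_norm_sum _ _ _))// -sl.
  rewrite -[leRHS](_ : \sum_(s <- l) 1 = _); last first.
    by rewrite big_const_seq count_predT iter_addr_0.
  apply: ler_sum => s _; have /andP[x0 x1] := X01 s w.
  have /andP[y0 y1] := average_bounds mJ de0 muJ mX X01 w.
  by rewrite ler_norml; apply/andP; split; rewrite /Y; lra.
have [s Js hs] := greedy_sample P mJ de0 muJ mX X01 ml bl.
exists (s :: l); split; first by rewrite /= sl.
  by move=> s'; rewrite inE => /predU1P[->//|]; exact: lJ.
under eq_integral do rewrite big_cons addrC.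
apply: le_trans hs _.
rewrite (_ : 2 * n.+1%:R = 2 * n%:R + 2 :> R); last by rewrite -natr1; ring.
rewrite [leRHS]EFinD; exact: leeD2r.
Qed.

(** Means of [2 ^ (k + 2)] well-chosen values [X s] are measurable with respect to [S]
    and converge to [Y] almost surely, their mean square distance to [Y] being at most
    [2 ^ - (k + 1)]. *)
Lemma measurable_wrt_unit_average : measurable_wrt S Y.
Proof.
pose N k := (2 ^ k.+2)%N.
have /choice[l hl] k := greedy_samples (N k).
pose Z k w := (N k)%:R^-1 * \sum_(s <- l k) X s w.
have N0 k : 0 < (N k)%:R :> R by rewrite ltr0n expn_gt0.
have mY : measurable_fun setT Y by exact: measurable_average.
have mXs s : measurable_fun setT (X s) by exact: measurable_section_chance.
have mZ k : measurable_wrt S (Z k).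
  apply: measurable_funM; first exact: measurable_cst.
  have [_ lJ _] := hl k.
  pose XJ s w := if s \in J then X s w else 0.
  rewrite (_ : (fun w => _) = fun w => \sum_(s <- l k) XJ s w); last first.
    apply/funext => w; apply: eq_big_seq => s sl.
    by rewrite /XJ mem_set//; exact: lJ.
  apply: measurable_sum => s; rewrite /XJ; case: (boolP (s \in J)) => [sJ|_].
    by apply: aX; exact: set_mem.
  exact: measurable_cst.
have YZ k w : Y w - Z k w = (N k)%:R^-1 * \sum_(s <- l k) (Y w - X s w).
  have [sl _ _] := hl k.
  rewrite sumrB mulrBr; congr (_ - _).
  by rewrite big_const_seq count_predT iter_addr_0 sl -[Y w *+ N k]mulr_natl mulrA mulVf ?mul1r ?gt_eqF.
apply: (measurable_wrt_limit cS mZ).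
have mYZ k : measurable_fun setT (fun w => Y w - Z k w).
  by apply: measurable_funB => //; exact: (measurable_wrt_measurable cS).
have : {ae P, forall w, Y w - Z k w @[k --> \oo] --> (0 : R)}.
  apply: l2_summable_cvg0 => // k.
  have [sl _ h] := hl k.
  under eq_integral do rewrite YZ exprMn EFinM.
  rewrite ge0_integralZl//; last first.
  - by move=> w _; rewrite lee_fin sqr_ge0.
  - apply/measurable_EFinP; apply: measurable_funX.
    by apply: measurable_sum => s; exact: measurable_funB.
  apply: le_trans (lee_wpmul2l _ h) _; first by rewrite lee_fin sqr_ge0.
  have NE : (N k)%:R = 2 * (2 ^ k.+1)%:R :> R by rewrite /N expnS natrM.
  have e (M : R) : 0 < M -> (2 * M)^-1 ^+ 2 * (2 * (2 * M)) = 1 / M.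
    by move=> M0; field; rewrite gt_eqF.
  by rewrite -EFinM lee_fin NE e// ltr0n expn_gt0.
apply: filterS => w h.
have -> : Y w = Y w - 0 by rewrite subr0.
rewrite (_ : (fun k => Z k w) = fun k => Y w - (Y w - Z k w)); last first.
  by apply/funext => k; rewrite subKr.
by apply: cvgB => //; exact: cvg_cst.
Qed.

End UnitValuedAdapted.

(** Joint measurability involves the whole sigma-algebra, not [S], so that Fubini's
    theorem does not give the measurability of the integral with respect to [S]. It is
    recovered from samples, after clipping [X] to a bounded interval. *)
Theorem adapted_integral_measurable (X : R -> Omega -> R) :
  measurable_fun (J `*` setT) (fun z : R * Omega => X z.1 z.2) ->
  (forall s, J s -> measurable_wrt S (X s)) ->
  {ae P, forall w, mu.-integrable J (EFin \o X ^~ w)} ->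
  measurable_wrt S (fun w => \int[mu]_(s in J) X s w).
Proof.
move=> mX aX iX.
pose clip (n : nat) (x : R) := Num.max (- n.+1%:R) (Num.min n.+1%:R x).
(* The clipped process, brought to values in [0, 1] by an affine map. *)
pose X' n s w := if s \in J then (clip n (X s w) + n.+1%:R) / (2 * n.+1%:R) else 0.
have n0 n : 0 < n.+1%:R :> R by rewrite ltr0n.
have clip_b n x : - n.+1%:R <= clip n x <= n.+1%:R.
  rewrite /clip le_max lexx/= ge_max ge_min lexx/= andbT.
  by rewrite (le_trans _ (ltW (n0 n)))// oppr_le0 ltW.
have X'01 n s w : 0 <= X' n s w <= 1.
  rewrite /X'; case: ifPn => _; last by rewrite lexx ler01.
  have /andP[c1 c2] := clip_b n (X s w).
  rewrite ler_pdivrMr ?mulr_gt0// divr_ge0 ?mulr_ge0 ?ler0n//=; last by lra.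
  by have := n0 n; lra.
have mclip n d' (T : measurableType d') (D : set T) (f : T -> R) :
    measurable_fun D f -> measurable_fun D (fun x => clip n (f x)).
  move=> mf; apply: measurable_maxr; first exact: measurable_cst.
  by apply: measurable_minr => //; exact: measurable_cst.
have mJT : measurable (J `*` [set: Omega]) by exact: measurableX.
have mX' n : measurable_fun setT (fun z : R * Omega => X' n z.1 z.2).
  have h : measurable_fun (J `*` setT)
      (fun z : R * Omega => (clip n (X z.1 z.2) + n.+1%:R) / (2 * n.+1%:R)).
    apply: measurable_funM => //; apply: measurable_funD => //; exact: mclip.
  move/(measurable_restrictT _ mJT) : h; apply: eq_measurable_fun => -[s w] _ /=.
  rewrite patchE /X'; case: ifPn => [|sJ].
    by rewrite inE /= => -[Js _]; rewrite mem_set.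
  case: ifPn => // /set_mem Js; case/negP: sJ.
  by rewrite inE.
have aX' n s : J s -> measurable_wrt S (X' n s).
  move=> Js; rewrite /X' mem_set//.
  apply: measurable_funM; last exact: measurable_cst.
  apply: measurable_funD; last exact: measurable_cst.
  by apply: mclip; exact: aX.
pose Z n w := 2 * n.+1%:R * (de * (de^-1 * \int[mu]_(s in J) X' n s w)) - n.+1%:R * de.
have mZ n : measurable_wrt S (Z n).
  apply: measurable_funB; last exact: measurable_cst.
  apply: measurable_funM; first exact: measurable_cst.
  apply: measurable_funM; first exact: measurable_cst.
  exact: (measurable_wrt_unit_average (mX' n) (X'01 n) (aX' n)).
apply: (measurable_wrt_limit cS mZ).
apply: filterS iX => w iXw.
have mXw : measurable_fun J (X^~ w).
  by move/integrableP : iXw => [/measurable_EFinP].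
have ZE n : Z n w = \int[mu]_(s in J) clip n (X s w).
  have iX'w : mu.-integrable J (EFin \o X' n ^~ w).
    exact: (integrable_section mJ muJ (mX' n) (X'01 n)).
  rewrite /Z [de * _]mulrA divff ?gt_eqF// mul1r.
  rewrite -RintegralZl//.
  have -> : n.+1%:R * de = \int[mu]_(s in J) n.+1%:R by rewrite Rintegral_cst//= muJ.
  rewrite -RintegralB//.
  - apply: eq_Rintegral => s sJ; rewrite /X' sJ mulrC divfK ?mulf_neq0 ?gt_eqF//.
    by rewrite addrK.
  - exact: integrable_scale.
  - by apply: cst_integrable => //; exact: (J_finite muJ).
rewrite (_ : (fun n => Z n w) = (fun n => \int[mu]_(s in J) clip n (X s w))); last exact/funext.
apply: (@Rintegral_dominated _ _ _ mu J (fun n s => clip n (X s w)) (X^~ w)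
  (fun s => `|X s w|)) => //.
- by move=> n; exact: mclip.
- move=> s Js; apply: cvg_near_cst; near=> n.
  have /andP[h1 h2] : - n.+1%:R <= X s w <= n.+1%:R.
    rewrite -ler_norml (@le_trans _ _ n%:R)//; last by rewrite ler_nat.
    by near: n; exact: nbhs_infty_ger.
  by rewrite /clip min_r// max_r.
- exact: integrable_norm.
- move=> n s _; move: (X s w) (n0 n) => x; rewrite /clip.
  move: n.+1%:R => c c0; rewrite ler_norml.
  have := ler_norm x; have := ler_norm (- x); rewrite normrN.
  by rewrite le_max ge_max !ge_min le_min; case: (leP c x); case: (leP (- c) x); lra.
Unshelve. all: by end_near. Qed.

End AdaptedMeasurable.

(** * Second moments of independent increments *)

Section Levels.
Context {R : realType}.

Lemma sum_levels (x : R) n : 0 <= x ->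
  \sum_(0 <= k < n) ((k%:R <= x)%R%:R : R) = (minn n (Num.truncn x).+1)%:R.
Proof.
move=> x0; elim: n => [|n IH]; first by rewrite big_geq// min0n.
rewrite big_nat_recr//= IH -truncn_ge_nat// -natrD; congr (_%:R).
case: (leqP n (Num.truncn x)) => h /=.
  by rewrite (minn_idPl (leqW h)) (minn_idPl _)// addn1.
by rewrite addn0 (minn_idPr h) (minn_idPr (leqW h)).
Qed.

Lemma levels_ge0 (x : R) k : (0 <= ((k%:R <= x)%R%:R : R)%:E)%E.
Proof. by rewrite lee_fin ler0n. Qed.

Lemma le_sum_levels (x : R) : 0 <= x ->
  (x%:E <= \sum_(k <oo) ((k%:R <= x)%R%:R : R)%:E)%E.
Proof.
move=> x0; set t := Num.truncn x.
apply: le_trans (nneseries_lim_ge t.+1 _); last by move=> k _ _; exact: levels_ge0.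
rewrite sumEFin lee_fin sum_levels// minnn.
by have /andP[_ /ltW] := truncn_itv x0.
Qed.

Lemma sum_levels_le (x : R) : 0 <= x ->
  (\sum_(k <oo) ((k%:R <= x)%R%:R : R)%:E <= (x + 1)%:E)%E.
Proof.
move=> x0; apply: lime_le; first by apply: is_cvg_nneseries => k _ _; exact: levels_ge0.
apply: nearW => n; rewrite sumEFin lee_fin sum_levels//.
rewrite (@le_trans _ _ (Num.truncn x).+1%:R)// ?ler_nat ?geq_minr//.
by rewrite -natr1 lerD2r; have /andP[] := truncn_itv x0.
Qed.

End Levels.

Section IndependentIncrement.
Context {R : realType} {d : measure_display} {Omega : measurableType d}.
Variable P : probability Omega R.

Lemma measurable_level (g : Omega -> R) (c : R) : measurable_fun setT g ->
  measurable [set w | c <= g w].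
Proof.
move=> mg; rewrite -[X in measurable X]setTI.
rewrite (_ : [set w | c <= g w] = g @^-1` `[c, +oo[); first exact: mg.
by apply/seteqP; split=> w /=; rewrite in_itv/= andbT.
Qed.

Lemma indic_level (g : Omega -> R) (c : R) w :
  \1_[set w | c <= g w] w = (c <= g w)%R%:R :> R.
Proof.
rewrite indicE; case: (boolP (c <= g w)) => h; first by rewrite mem_set.
by rewrite memNset//; exact/negP.
Qed.

(** The layer-cake bound [g <= sum_k 1_(g >= k)], integrated against [h]. *)
Lemma layer_cake (g h : Omega -> R) :
  measurable_fun setT g -> (forall w, 0 <= g w) ->
  measurable_fun setT h -> (forall w, 0 <= h w) ->
  (\int[P]_w (g w * h w)%R%:E <=
   \sum_(k <oo) \int[P]_(w in [set w | (k%:R <= g w)%R]) (h w)%:E)%E.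
Proof.
move=> mg g0 mh h0.
have mk (k : nat) : measurable_fun setT (fun w => (h w * (k%:R <= g w)%R%:R)%R%:E).
  apply/measurable_EFinP; apply: measurable_funM => //.
  rewrite (_ : (fun w => _) = \1_[set w | (k%:R <= g w)%R]).
    by apply: measurable_indic; exact: measurable_level.
  by apply/funext => w; rewrite indic_level.
have k0 (k : nat) w : (0 <= (h w * (k%:R <= g w)%R%:R)%R%:E)%E by rewrite lee_fin mulr_ge0.
have -> : (\sum_(k <oo) \int[P]_(w in [set w | (k%:R <= g w)%R]) (h w)%:E =
    \int[P]_w \sum_(k <oo) (h w * (k%:R <= g w)%R%:R)%R%:E)%E.
  rewrite integral_nneseries//; apply: eq_eseriesr => k _.
  rewrite [LHS]integral_mkcond; apply: eq_integral => w _; rewrite patchE.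
  case: ifPn => [/set_mem /= ->|]; first by rewrite mulr1.
  by rewrite notin_setE /= => /negP/negbTE ->; rewrite mulr0.
apply: ge0_le_integral => //.
- by move=> w _; rewrite lee_fin mulr_ge0.
- by apply/measurable_EFinP; exact: measurable_funM.
- exact: ge0_emeasurable_sum.
- move=> w _; under eq_eseriesr do rewrite EFinM.
  rewrite nneseriesZl//.
  rewrite mulrC EFinM; apply: lee_wpmul2l; first by rewrite lee_fin.
  exact: le_sum_levels.
Qed.

Lemma sum_levels_probability (g : Omega -> R) :
  measurable_fun setT g -> (forall w, 0 <= g w) ->
  (\sum_(k <oo) P [set w | (k%:R <= g w)%R] <= \int[P]_w (g w)%:E + 1)%E.
Proof.
move=> mg g0.
have mk (k : nat) : measurable_fun setT (fun w => ((k%:R <= g w)%R%:R : R)%:E).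
  apply/measurable_EFinP.
  rewrite (_ : (fun w => _) = \1_[set w | (k%:R <= g w)%R]).
    by apply: measurable_indic; exact: measurable_level.
  by apply/funext => w; rewrite indic_level.
have -> : (\sum_(k <oo) P [set w | (k%:R <= g w)%R] =
    \int[P]_w \sum_(k <oo) ((k%:R <= g w)%R%:R : R)%:E)%E.
  rewrite integral_nneseries//.
  apply: eq_eseriesr => k _.
  have := @integral_indic _ _ _ P setT measurableT _ (measurable_level k%:R mg).
  rewrite setIT => <-.
  by apply: eq_integral => w _; rewrite indic_level.
have -> : (\int[P]_w (g w)%:E + 1 = \int[P]_w ((g w)%:E + 1))%E.
  rewrite ge0_integralD//.
  - by rewrite integral_cst// mul1e; congr (_ + _)%E; exact/esym/probability_setT.
  - by move=> w _; rewrite lee_fin.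
  - exact/measurable_EFinP.
apply: ge0_le_integral => //.
- by move=> w _; apply: nneseries_ge0 => k _ _; exact: levels_ge0.
- by apply: ge0_emeasurable_sum => // k w _ _; exact: levels_ge0.
- by apply: emeasurable_funD => //; exact/measurable_EFinP.
- by move=> w _; exact: sum_levels_le.
Qed.

(** The Gaussian density of variance [s^2] is, on the set [x^2 >= n], at most a
    multiple of [exp (- n / (4 s^2))] times the density of variance [2 s^2]. *)
Lemma normal_tail (s : R) : s != 0 -> exists K q : R,
  [/\ 0 <= K, 0 < q < 1 &
  forall n, (normal_prob 0 s [set x | (n%:R <= x ^+ 2)%R] <= (K * q ^+ n)%:E)%E].
Proof.
move=> s0; pose s' := s * Num.sqrt 2.
have r20 : Num.sqrt 2 != 0 :> R by rewrite sqrtr_eq0 -ltNge.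
have s'0 : s' != 0 by rewrite mulf_neq0.
have s2 : 0 < s ^+ 2 by rewrite exprn_even_gt0.
have s's : s' ^+ 2 = 2 * s ^+ 2 by rewrite exprMn sqr_sqrtr// mulrC.
exists (normal_peak s / normal_peak s'), (expR (- (s ^+ 2 * 4)^-1)).
have pk' := normal_peak_gt0 s'0; have pk := normal_peak_gt0 s0.
split; first by rewrite divr_ge0// ltW.
  by rewrite expR_gt0 expR_lt1 oppr_lt0 invr_gt0 mulr_gt0.
move=> n; set q := expR _.
have mU : measurable [set x : R | n%:R <= x ^+ 2].
  rewrite -[X in measurable X]setTI.
  rewrite (_ : mkset _ = (fun x : R => x ^+ 2) @^-1` `[n%:R, +oo[).
    by apply: (measurable_funX 2 (@measurable_id _ _ setT)).
  by apply/seteqP; split=> x /=; rewrite in_itv/= andbT.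
have mpdf t : measurable_fun setT (EFin \o normal_pdf 0 t : R -> \bar R).
  by apply/measurable_EFinP; exact: measurable_normal_pdf.
rewrite /normal_prob.
apply: (@le_trans _ _ (\int[lebesgue_measure]_(x in [set x : R | (n%:R <= x ^+ 2)%R])
    ((normal_peak s / normal_peak s' * q ^+ n)%R%:E * (normal_pdf 0 s' x)%:E))%E).
  apply: ge0_le_integral => //.
  - by move=> x _; rewrite lee_fin normal_pdf_ge0.
  - exact: (measurable_funTS (mpdf s)).
  - by apply: measurable_funTS; apply: measurable_funeM; exact: mpdf.
  - move=> x /= nx; rewrite -EFinM lee_fin !normal_pdfE//.
    have alg1 (a b c f : R) : 0 < b -> a / b * c * (b * f) = a * (c * f).
      by move=> b0; field; rewrite gt_eqF.
    rewrite alg1// ler_pM2l// /normal_fun -expRM_natl -expRD ler_expR !subr0 s's.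
    have alg2 (v w k : R) : 0 < v -> k <= w ->
        - w / (v *+ 2) <= k * - (v * 4)^-1 + - w / ((2 * v) *+ 2).
      move=> v0 kw; rewrite -subr_ge0.
      rewrite (_ : _ - _ = (w - k) / (v * 4)); last by field; rewrite gt_eqF.
      by rewrite divr_ge0 ?subr_ge0// mulr_ge0// ltW.
    exact: alg2.
have c0 : 0 <= normal_peak s / normal_peak s' * q ^+ n.
  by rewrite mulr_ge0 ?exprn_ge0 ?expR_ge0// divr_ge0// ltW.
rewrite ge0_integralZl//.
- rewrite -[leRHS]mule1; apply: lee_wpmul2l; first by rewrite lee_fin.
  exact: (probability_le1 (normal_prob 0 s') mU).
- exact: (measurable_funTS (mpdf s')).
- by move=> x _; rewrite lee_fin normal_pdf_ge0.
Qed.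

Lemma geometric_nneseries_le (K q : R) : 0 <= K -> 0 < q < 1 ->
  (\sum_(n <oo) (K * q ^+ n)%R%:E <= (K / (1 - q))%R%:E)%E.
Proof.
move=> K0 /andP[q0 q1].
apply: lime_le.
  by apply: is_cvg_nneseries => k _ _; rewrite lee_fin mulr_ge0// exprn_ge0// ltW.
apply: nearW => n; rewrite sumEFin lee_fin.
have := @geometric_le_lim _ n K q K0 q0; rewrite gtr0_norm// => /(_ q1).
by rewrite /series /geometric /=.
Qed.

(** An increment independent of [S] with a Gaussian law has a second moment,
    which splits off, up to a constant, from the product with any integrable factor
    that is measurable with respect to [S]: its tails do, on every level set of the
    factor. *)
Lemma gaussian_increment_moment (S : set (set Omega)) (X : Omega -> R) (s : R) :
  S `<=` measurable -> measurable_fun setT X -> s != 0 ->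
  (forall D U, S D -> measurable U ->
    P (D `&` X @^-1` U) = (P D * normal_prob 0 s U)%E) ->
  exists2 C : R, 0 <= C & forall Z : Omega -> R, measurable_fun setT Z ->
    (forall c, S [set w | c <= Z w]) -> (forall w, 0 <= Z w) ->
    (\int[P]_w (Z w * X w ^+ 2)%R%:E <= C%:E * (\int[P]_w (Z w)%:E + 1))%E.
Proof.
move=> Sm mX s0 ind.
have [K [q [K0 q01 Nq]]] := normal_tail s0.
have C0 : 0 <= K / (1 - q) by case/andP: q01 => q0 q1; rewrite divr_ge0// subr_ge0 ltW.
exists (K / (1 - q)) => // Z mZ SZ Z0.
have mX2 : measurable_fun setT (fun w => X w ^+ 2) by exact: measurable_funX.
have X20 w : 0 <= X w ^+ 2 by exact: sqr_ge0.
have step D : S D -> (\int[P]_(w in D) (X w ^+ 2)%R%:E <= (K / (1 - q))%R%:E * P D)%E.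
  move=> SD; have mD := Sm _ SD.
  have mI : measurable_fun setT (\1_D : Omega -> R) by exact: measurable_indic.
  have := layer_cake mX2 X20 mI (fun w => ler0n _ _).
  rewrite (_ : (\int[P]_w _)%E = \int[P]_(w in D) (X w ^+ 2)%R%:E)%E; last first.
    rewrite [RHS]integral_mkcond; apply: eq_integral => w _.
    by rewrite patchE indicE; case: ifPn; rewrite ?mulr1 ?mulr0.
  move=> /le_trans; apply.
  have PD : P D \is a fin_num by exact: fin_num_measure.
  apply: (@le_trans _ _ (\sum_(k <oo) (P D * (K * q ^+ k)%R%:E))%E).
    apply: lee_nneseries => [k _ _|k _]; first by apply: integral_ge0 => w _; rewrite lee_fin.
    rewrite integral_indic//; last exact: measurable_level.
    have mU : measurable [set x : R | k%:R <= x ^+ 2].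
      rewrite -[X in measurable X]setTI.
      rewrite (_ : mkset _ = (fun x : R => x ^+ 2) @^-1` `[k%:R, +oo[).
        by apply: (measurable_funX 2 (@measurable_id _ _ setT)).
      by apply/seteqP; split=> x /=; rewrite in_itv/= andbT.
    have e : P (D `&` [set w | (k%:R <= X w ^+ 2)%R]) =
        (P D * normal_prob 0 s [set x | (k%:R <= x ^+ 2)%R])%E := ind D _ SD mU.
    by rewrite [leLHS]e; apply: lee_wpmul2l => //; exact: Nq.
  rewrite -(fineK PD) nneseriesZl; last first.
    by case/andP: q01 => q0 q1 k _; rewrite lee_fin mulr_ge0// exprn_ge0// ltW.
  rewrite muleC; apply: lee_wpmul2r; first by rewrite fineK.
  exact: geometric_nneseries_le.
apply: le_trans (layer_cake mZ Z0 mX2 X20) _.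
apply: (@le_trans _ _ (\sum_(k <oo) ((K / (1 - q))%R%:E * P [set w | (k%:R <= Z w)%R]))%E).
  apply: lee_nneseries => [k _ _|k _]; first by apply: integral_ge0 => w _; rewrite lee_fin.
  exact: step.
rewrite nneseriesZl//; apply: lee_wpmul2l; first by rewrite lee_fin.
exact: sum_levels_probability.
Qed.

End IndependentIncrement.

(** * Weak integrals over a time cell *)

Section CellIntegral.
Context {R : realType}.
Local Notation mu := (@lebesgue_measure R).
Variables (s0 s1 : R).
Hypothesis s01 : s0 < s1.
Local Notation J := (`]s0, s1]%classic : set R).
Local Notation Jc := (`[s0, s1]%classic : set R).

Lemma cell_measure : mu J = (s1 - s0)%:E.
Proof. by rewrite lebesgue_measure_itv/= lte_fin s01 EFinB. Qed.

Lemma cell_finite : (mu J < +oo)%E.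
Proof. by rewrite cell_measure ltry. Qed.

Lemma closed_cell f : measurable_fun Jc f -> mu.-integrable J (EFin \o f) ->
  mu.-integrable Jc (EFin \o f) /\
  \int[mu]_(s in Jc) f s = \int[mu]_(s in J) f s.
Proof.
move=> mf If; split; last by rewrite Rintegral_itv_obnd_cbnd.
move/integrableP : If => [mfJ fin]; apply/integrableP; split.
  exact/measurable_EFinP.
rewrite -integral_itv_obnd_cbnd//.
by apply: measurableT_comp.
Qed.

Lemma measurable_closed_open_cell (f : R -> R) :
  measurable_fun Jc f -> measurable_fun J f.
Proof.
apply: measurable_funS => // x /=; rewrite !in_itv/= => /andP[/ltW -> ->//].
Qed.

Section DualValued.
Context {V : completeNormedModType R}.
Hypothesis reflV : reflexive_space V.
Variables (f : R -> dual V) (g : R -> R).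
Hypothesis mf : forall w, measurable_fun Jc (fun s => f s w : R).
Hypothesis fg : forall s w, J s -> `|f s w| <= g s * `|w|.
Hypothesis Ig : mu.-integrable J (EFin \o g).

Lemma dual_cell_integrable w : mu.-integrable J (EFin \o (fun s => f s w : R)).
Proof.
apply: (@le_integrableR _ _ _ mu J _ (fun s => f s w : R) (fun s => `|w| * g s)) => //.
- exact: measurable_closed_open_cell.
- by move=> s Js; rewrite mulrC fg.
- exact: integrable_scale.
Qed.

(** By reflexivity, every functional on the dual is an evaluation, so that the pointwise
    integral, a bounded linear functional, is the weak integral. *)
Lemma vintegral_dual w :
  vintegral Jc f w = \int[mu]_(s in J) (f s w : R).
Proof.
have [I IE] : exists I : dual V, forall w, I w = \int[mu]_(s in J) (f s w : R).
  apply: (@bounded_linear_dual _ _ _ (\int[mu]_(s in J) g s)) => [a x y|x].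
    rewrite -Rintegral_lin//; try exact: dual_cell_integrable.
    by apply: eq_Rintegral => s _; rewrite dual_add dual_scale.
  rewrite mulrC -RintegralZl//; apply: Rintegral_abs_le => //.
  - exact: measurable_closed_open_cell.
  - exact: integrable_scale.
  - by move=> s Js; rewrite mulrC fg.
pose Q := [set I : dual V | forall phi : dual (dual V),
    mu.-integrable Jc (fun s => (phi (f s) : R)%:E) /\
    phi I = \int[mu]_(s in Jc) (phi (f s) : R)].
have QI : Q I.
  move=> phi; have [x phix] := reflV phi.
  have [h1 h2] := closed_cell (mf x) (dual_cell_integrable x).
  rewrite (_ : (fun s => (phi (f s))%:E) = EFin \o (fun s => f s x : R)); last first.
    by apply/funext => s /=; rewrite phix.
  split => //; rewrite phix IE -h2; apply: eq_Rintegral => s _; exact/esym/phix.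
have [Phi PhiE] := evaluation_bidual w.
have [_] := xgetPex 0 (ex_intro Q I QI) Phi.
rewrite -/Q => h; rewrite -(PhiE (vintegral _ _)) [LHS]h.
rewrite -(closed_cell (mf w) (dual_cell_integrable w)).2.
by apply: eq_Rintegral => s _; exact: PhiE.
Qed.

End DualValued.

Section HilbertValued.
Context {V H : completeNormedModType R} (G : gelfand_triple V H).
Variables (f : R -> H) (g : R -> R).
Hypothesis mf : forall w, measurable_fun Jc (fun s => inner G (f s) (emb G w)).
Hypothesis fg : forall s, J s -> `|f s| ^+ 2 <= g s.
Hypothesis Ig : mu.-integrable J (EFin \o g).

Lemma measurable_inner h : measurable_fun Jc (fun s => inner G (f s) h).
Proof.
have [v vh] := emb_seq_dense G h.
apply: (@measurable_fun_cvg _ _ _ _ (fun n s => inner G (f s) (emb G (v n)))) => //.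
by move=> s _; under eq_fun do rewrite innerC; rewrite innerC; exact: inner_cvg.
Qed.

Lemma inner_cell_integrable h : mu.-integrable J (EFin \o (fun s => inner G (f s) h)).
Proof.
apply: (@le_integrableR _ _ _ mu J _ (fun s => inner G (f s) h) (fun s => `|h| * (1 + g s))) => //.
- by apply: measurable_closed_open_cell; exact: measurable_inner.
- move=> s Js; rewrite (le_trans (cauchy_schwarz _ _ _))// mulrC ler_wpM2l//.
  by have := fg Js; have := sqr_ge0 `|f s|; have := sqr_ge0 (`|f s| - 1); rewrite sqrrB1; lra.
- apply: integrable_scale => //; apply: integrable_addr => //.
  by apply: cst_integrable => //; exact: cell_finite.
Qed.

(** The Riesz representation provides the vector, and shows that inner products are all
    the functionals that have to be tested. *)
Lemma inner_vintegral h :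
  inner G (vintegral Jc f) h = \int[mu]_(s in J) inner G (f s) h.
Proof.
have fle s : J s -> `|f s| <= 1 + g s.
  by move=> Js; have := fg Js; have := sqr_ge0 `|f s|; have := sqr_ge0 (`|f s| - 1); rewrite sqrrB1; lra.
have I1g : mu.-integrable J (EFin \o (fun s => 1 + g s)).
  apply: integrable_addr => //; apply: cst_integrable => //; exact: cell_finite.
have [I IE] : exists I, forall h, \int[mu]_(s in J) inner G (f s) h = inner G I h.
  apply: (@riesz_representation _ _ _ G (fun h => \int[mu]_(s in J) inner G (f s) h)
    (\int[mu]_(s in J) (1 + g s))) => [a x y|x].
    rewrite -Rintegral_lin//; try exact: inner_cell_integrable.
    by apply: eq_Rintegral => s _; rewrite innerDr innerZr.
  rewrite mulrC -RintegralZl//; apply: Rintegral_abs_le => //.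
  - by apply: measurable_closed_open_cell; exact: measurable_inner.
  - exact: integrable_scale.
  - move=> s Js; rewrite (le_trans (cauchy_schwarz _ _ _))// mulrC ler_wpM2l//.
    exact: fle.
pose Q := [set I : H | forall phi : dual H,
    mu.-integrable Jc (fun s => (phi (f s) : R)%:E) /\
    phi I = \int[mu]_(s in Jc) (phi (f s) : R)].
have QI : Q I.
  move=> phi.
  have [z phiz] : exists z, forall x, phi x = inner G z x.
    apply: (@riesz_representation _ _ _ G phi `|phi|) => [a x y|x].
      by rewrite dual_add dual_scale.
    exact: dual_le_norm.
  have phiE x : phi x = inner G x z by rewrite phiz innerC.
  have [h1 h2] := closed_cell (measurable_inner z) (inner_cell_integrable z).
  rewrite (_ : (fun s => (phi (f s))%:E) = EFin \o (fun s => inner G (f s) z)); last first.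
    by apply/funext => s /=; rewrite phiE.
  split => //; rewrite phiE -IE -h2; apply: eq_Rintegral => s _; exact/esym/phiE.
have [phi phiE] := inner_dual G h.
have [_] := xgetPex 0 (ex_intro Q I QI) phi.
rewrite -/Q => e; rewrite -(phiE (vintegral _ _)) [LHS]e.
rewrite -(closed_cell (measurable_inner h) (inner_cell_integrable h)).2.
by apply: eq_Rintegral => s _; exact: phiE.
Qed.

(** Jensen's inequality, from Young's inequality for [f s] and [u]. *)
Lemma average_sqr_norm (u : H) :
  (forall h, inner G u h = (s1 - s0)^-1 * \int[mu]_(s in J) inner G (f s) h) ->
  `|u| ^+ 2 <= (s1 - s0)^-1 * \int[mu]_(s in J) g s.
Proof.
move=> uE; set de := s1 - s0.
have de0 : 0 < de by rewrite subr_gt0.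
have Ic : mu.-integrable J (EFin \o (fun=> `|u| ^+ 2)).
  by apply: cst_integrable => //; exact: cell_finite.
have h : \int[mu]_(s in J) inner G (f s) u <=
    \int[mu]_(s in J) (2^-1 * (g s + `|u| ^+ 2)).
  apply: le_Rintegral => //; first exact: inner_cell_integrable.
    by apply: integrable_scale => //; exact: integrable_addr.
  by move=> s Js; have := fg Js; have := inner_le_sqr G (f s) u; lra.
move: h; rewrite RintegralZl//; last exact: integrable_addr.
rewrite RintegralD// Rintegral_cst//= cell_measure /= -/de.
have := uE u; rewrite (inner_norm G) -/de.
set A := \int[mu]_(s in J) inner G (f s) u; set B := \int[mu]_(s in J) g s.
set n := `|u| ^+ 2 => nE h.
have : de^-1 * A <= de^-1 * (2^-1 * (B + n * de)) by rewrite ler_wpM2l// invr_ge0 ltW.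
rewrite -nE (_ : de^-1 * _ = 2^-1 * (de^-1 * B) + 2^-1 * n); first by lra.
by field; rewrite gt_eqF.
Qed.

End HilbertValued.

End CellIntegral.

(** * The operator of one implicit step *)

Section RegularPath.
Context {R : realType} {V H : completeNormedModType R} (G : gelfand_triple V H).
Variables (T p : R) (r : nat).

(** A realisation of the coefficients, outside the exceptional null sets; [k] is
    one kernel for the growth of both coefficients. *)
Record regular_path (k K1 K1bar lam : R -> R) (a : R -> V -> dual V)
    (b : 'I_r -> R -> V -> H) : Prop := RegularPath {
  path_measurableA : forall v w,
    measurable_fun (`[0, T] : set R) (fun s => a s v w : R) ;
  path_measurableB : forall j v w,
    measurable_fun (`[0, T] : set R) (fun s => inner G (b j s v) (emb G w)) ;
  path_monotone : forall t x y, 0 < t <= T ->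
    2 * (a t x - a t y) (x - y) + \sum_(j < r) `|b j t x - b j t y| ^+ 2 <= 0 ;
  path_growthA : forall t x w, 0 < t <= T ->
    `|a t x w| <= k t * (1 + `|x| `^ p) * `|w| ;
  path_growthB : forall t x, 0 < t <= T ->
    \sum_(j < r) `|b j t x| ^+ 2 <= k t * (1 + `|x| `^ p) ;
  path_coercive : forall t x, 0 < t <= T ->
    2 * a t x x + lam t * `|x| `^ p <= K1 t * `|emb G x| ^+ 2 + K1bar t ;
  path_hemicontinuous : forall t x y z, 0 < t <= T ->
    a t (x + n.+1%:R^-1 *: y) z @[n --> \oo] --> (a t x z : R) }.

End RegularPath.

Section PathOfConditions.
Context {R : realType} {V H : completeNormedModType R} (G : gelfand_triple V H).
Variables (T p : R) (r : nat).
Hypothesis p_ge2 : 2 <= p.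

Lemma sqr_le_powR (x : R) : 0 <= x -> x ^+ 2 <= 1 + x `^ p.
Proof.
move=> x0; have [x1|x1] := leP x 1.
  by rewrite (@le_trans _ _ 1) ?exprn_ile1// lerDl powR_ge0.
rewrite -powR_mulrn// (@le_trans _ _ (x `^ p)) ?lerDr//.
by apply: ler_powR => //; exact: ltW.
Qed.

(** Young's inequality, up to a constant. *)
Lemma mul_le_powR (x y : R) : 0 <= x -> 0 <= y ->
  x * y <= x `^ p + y `^ (p / (p - 1)).
Proof.
move=> x0 y0; have p1 : 0 < p - 1 by have := p_ge2; lra.
have [yx|xy] := leP y (x `^ (p - 1)).
  apply: (@le_trans _ _ (x `^ p)); last by rewrite lerDl powR_ge0.
  have [->|xn0] := eqVneq x 0; first by rewrite mul0r powR_ge0.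
  rewrite (_ : p = 1 + (p - 1)); last by ring.
  rewrite powRD; last by rewrite xn0 implybT.
  by rewrite powRr1// ler_wpM2l.
apply: (@le_trans _ _ (y `^ (p / (p - 1)))); last by rewrite lerDr powR_ge0.
have yp : 0 < y by rewrite (le_lt_trans _ xy)// powR_ge0.
rewrite (_ : p / (p - 1) = (p - 1)^-1 + 1); last by field; rewrite gt_eqF.
rewrite powRD; last by rewrite (gt_eqF yp) implybT.
rewrite powRr1// ler_wpM2r//.
have {1}-> : x = (x `^ (p - 1)) `^ (p - 1)^-1.
  by rewrite -powRrM divff ?gt_eqF// powRr1.
by apply: ge0_ler_powR; rewrite ?nnegrE ?powR_ge0 ?invr_ge0 ?(ltW p1) ?(ltW xy) ?(ltW yp).
Qed.

Variables (K1 K1bar lam K2 : R -> R) (alpha c : R).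
Hypothesis alpha_ge1 : 1 <= alpha.
Hypothesis c_gt0 : 0 < c.
Hypothesis emb_c : forall x, `|emb G x| <= c * `|x|.
Hypothesis K1_ge0 : forall t, 0 <= t <= T -> 0 <= K1 t.
Hypothesis K1bar_ge0 : forall t, 0 <= t <= T -> 0 <= K1bar t.
Hypothesis K2_ge0 : forall t, 0 <= t <= T -> 0 <= K2 t.
Hypothesis lam_gt0 : forall t, 0 < t <= T -> 0 < lam t.

(** The constant [c] bounds the norm of the embedding: the lower order term
    [K1 |x|_H^2] of the coercivity condition is absorbed in the growth in [V]. *)
Definition growth_kernel (t : R) : R :=
  c ^+ 2 * K1 t + (K1bar t + (2 * (1 + alpha) * lam t + 2 * K2 t)).

Variables (a : R -> V -> dual V) (b : 'I_r -> R -> V -> H).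

Hypothesis ma : forall v w, measurable_fun (`[0, T] : set R) (fun s => a s v w : R).
Hypothesis mb : forall j v w,
  measurable_fun (`[0, T] : set R) (fun s => inner G (b j s v) (emb G w)).
Hypothesis C1 : forall (t : R) (x y : V), 0 <= t <= T ->
  2 * (a t x - a t y) (x - y) + \sum_(j < r) `|b j t x - b j t y| ^+ 2 <= 0.
Hypothesis C2 : forall (t : R) (x : V), 0 < t <= T ->
  2 * a t x x + \sum_(j < r) `|b j t x| ^+ 2 + lam t * `|x| `^ p
  <= K1 t * `|emb G x| ^+ 2 + K1bar t.
Hypothesis C3 : forall (t : R) (x y z : V), 0 <= t <= T ->
  a t (x + eps *: y) z @[eps --> (0 : R)^'] --> a t x z.
Hypothesis C4 : forall (t : R) (x : V), 0 < t <= T ->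
  `|a t x| `^ (p / (p - 1))
  <= alpha * lam t `^ (p / (p - 1)) * `|x| `^ p + lam t `^ (p / (p - 1) - 1) * K2 t.

Let q := p / (p - 1).

(** The growth condition on [A] divided by [lam ^ (q - 1)], so that only [lam] and [K2],
    both integrable, remain. *)
Lemma growth_scaled t x : 0 < t <= T ->
  lam t * (`|a t x| / lam t) `^ q <= alpha * lam t * `|x| `^ p + K2 t.
Proof.
move=> tT; have l0 := lam_gt0 tT; have := C4 x tT; rewrite -/q => h.
have lq : 0 < lam t `^ (q - 1) by rewrite powR_gt0.
have lqE : lam t `^ q = lam t * lam t `^ (q - 1).
  rewrite -{2}(powRr1 (ltW l0)) -powRD; first by congr (_ `^ _); ring.
  by rewrite (gt_eqF l0) implybT.
rewrite powRM ?invr_ge0 ?(ltW l0)// -[(lam t)^-1]powR_inv1 ?(ltW l0)// -powRrM.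
rewrite mulN1r powRN lqE.
move: h; rewrite lqE; set u := lam t `^ (q - 1) in lq *; set A := `|a t x| `^ q.
move=> h; rewrite -(ler_pM2r lq).
rewrite (_ : lam t * (A / (lam t * u)) * u = A); last first.
  by field; rewrite !gt_eqF.
by apply: le_trans h _; rewrite le_eqVlt; apply/orP; left; apply/eqP; ring.
Qed.

Lemma regular_path_of_conditions :
  regular_path G T p growth_kernel K1 K1bar lam a b.
Proof.
have tT' t : 0 < t <= T -> 0 <= t <= T by move=> /andP[/ltW -> ->].
have growthA t x : 0 < t <= T -> `|a t x| <= lam t + (alpha * lam t * `|x| `^ p + K2 t).
  move=> tT; have l0 := lam_gt0 tT; have := growth_scaled x tT.
  move=> h; rewrite (le_trans _ (lerD (lexx (lam t)) h))//.
  set y := `|a t x| / lam t; have y0 : 0 <= y by rewrite divr_ge0// ltW.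
  rewrite -[leLHS](divfK (lt0r_neq0 l0)) -/y -{2}(mulr1 (lam t)) -mulrDr mulrC ler_pM2l//.
  have [y1|y1] := leP y 1; first by rewrite (le_trans y1)// lerDl powR_ge0.
  rewrite -{1}(powRr1 y0) (@le_trans _ _ (y `^ q)) ?lerDr//.
  apply: ler_powR; first exact: ltW.
  have pge2 := p_ge2; have p1 : 0 < p - 1 by lra.
  by rewrite /q ler_pdivlMr//; lra.
have growthB t x : 0 < t <= T -> \sum_(j < r) `|b j t x| ^+ 2 <=
    K1 t * `|emb G x| ^+ 2 + K1bar t + 2 * (lam t * `|x| `^ p + (alpha * lam t * `|x| `^ p + K2 t)).
  move=> tT; have l0 := lam_gt0 tT; have h := C2 x tT; have h2 := growth_scaled x tT.
  have y0 : 0 <= `|a t x| / lam t by rewrite divr_ge0// ltW.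
  have h3 := mul_le_powR (normr_ge0 x) y0; rewrite -/q in h3.
  have h4 : - (a t x x) <= `|a t x| * `|x|.
    by rewrite (le_trans _ (dual_le_norm _ _))// -normrN ler_norm.
  have h5 : `|a t x| * `|x| = lam t * (`|x| * (`|a t x| / lam t)).
    by field; rewrite gt_eqF.
  have h6 : lam t * (`|x| * (`|a t x| / lam t)) <=
      lam t * `|x| `^ p + lam t * (`|a t x| / lam t) `^ q.
    by rewrite -mulrDr ler_pM2l.
  have h7 : 0 <= lam t * `|x| `^ p by rewrite mulr_ge0 ?powR_ge0// ltW.
  have le (n z S l K A B L : R) : 2 * z + S + l <= K -> - z <= n -> n <= l + B ->
      B <= A -> 0 <= l -> S <= K + 2 * (l + A) by lra.
  exact: (le _ _ _ _ _ _ _ 0 h h4 (eq_ind_r (fun z => z <= _) h6 h5) h2 h7).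
split=> //.
- by move=> t x y /tT'; exact: C1.
- move=> t x w tT; rewrite (le_trans (dual_le_norm _ _))// ler_wpM2r//.
  have l0 := lam_gt0 tT; have X0 : 0 <= `|x| `^ p := powR_ge0 _ _.
  rewrite (le_trans (growthA t x tT))// /growth_kernel.
  have k1 := K1_ge0 (tT' _ tT); have k1b := K1bar_ge0 (tT' _ tT).
  have k2 := K2_ge0 (tT' _ tT).
  have ck : 0 <= c ^+ 2 * K1 t by rewrite mulr_ge0// sqr_ge0.
  move: alpha_ge1 => al1; set X := `|x| `^ p in X0 *.
  have al : lam t <= alpha * lam t by rewrite ler_peMl// ltW.
  have alX : lam t * X <= alpha * lam t * X by rewrite ler_wpM2r.
  have lX : 0 <= lam t * X by rewrite mulr_ge0// ltW.
  have ckX : 0 <= c ^+ 2 * K1 t * X by rewrite mulr_ge0.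
  have k1bX : 0 <= K1bar t * X by rewrite mulr_ge0.
  have k2X : 0 <= K2 t * X by rewrite mulr_ge0.
  by rewrite !mulrDl !mulrDr !mulr1; lra.
- move=> t x tT; rewrite (le_trans (growthB t x tT))// /growth_kernel.
  have l0 := lam_gt0 tT; have X0 : 0 <= `|x| `^ p := powR_ge0 _ _.
  have k1 := K1_ge0 (tT' _ tT); have k1b := K1bar_ge0 (tT' _ tT).
  have k2 := K2_ge0 (tT' _ tT).
  have e2 : K1 t * `|emb G x| ^+ 2 <= c ^+ 2 * K1 t * (1 + `|x| `^ p).
    rewrite [c ^+ 2 * _]mulrC -mulrA ler_wpM2l//.
    rewrite (@le_trans _ _ ((c * `|x|) ^+ 2))//.
      by rewrite ler_pXn2r ?nnegrE// mulr_ge0// ltW.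
    by rewrite exprMn ler_wpM2l ?sqr_ge0// sqr_le_powR.
  set X := `|x| `^ p in X0 e2 *.
  have al0 : 0 <= alpha * lam t by rewrite mulr_ge0 ?(ltW l0)// (le_trans ler01).
  have alX : 0 <= alpha * lam t * X by rewrite mulr_ge0.
  have lX : 0 <= lam t * X by rewrite mulr_ge0// ltW.
  have k1bX : 0 <= K1bar t * X by rewrite mulr_ge0.
  have k2X : 0 <= K2 t * X by rewrite mulr_ge0.
  by rewrite [leRHS]mulrDl; apply: (le_trans (y := c ^+ 2 * K1 t * (1 + X) + (K1bar t + 2 * (lam t * X + (alpha * lam t * X + K2 t))))); [rewrite -addrA lerD2r|rewrite lerD2l; lra].
- move=> t x tT; have := C2 x tT.
  have : 0 <= \sum_(j < r) `|b j t x| ^+ 2 by rewrite sumr_ge0// => j _; rewrite sqr_ge0.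
  have le (z S l K : R) : 0 <= S -> z + S + l <= K -> z + l <= K by lra.
  exact: le.
- move=> t x y z tT.
  have harm : n.+1%:R^-1 @[n --> \oo] --> (0 : R)^'.
    move=> A A0.
    have h : \forall n \near \oo, (n.+1%:R^-1 : R) != 0 -> A n.+1%:R^-1.
      exact: (@cvg_harmonic R _ A0).
    suff : \forall n \near \oo, A (n.+1%:R^-1 : R) by [].
    by apply: filterS h => n; apply; rewrite invr_eq0.
  have h := cvg_comp _ _ harm (@C3 t x y z (tT' _ tT)).
  exact: h.
Qed.

End PathOfConditions.

Section CellOperator.
Context {R : realType} {V H : completeNormedModType R} (G : gelfand_triple V H).
Variables (T p : R) (r : nat).
Hypothesis p_ge2 : 2 <= p.
Hypothesis reflV : reflexive_space V.
Variables (k K1 K1bar lam : R -> R) (a : R -> V -> dual V) (b : 'I_r -> R -> V -> H).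
Hypothesis reg : regular_path G T p k K1 K1bar lam a b.
Variables (s0 s1 : R).
Hypotheses (s0_ge0 : 0 <= s0) (s01 : s0 < s1) (s1T : s1 <= T).
Local Notation mu := (@lebesgue_measure R).
Local Notation J := (`]s0, s1]%classic : set R).
Local Notation Jc := (`[s0, s1]%classic : set R).
Hypothesis Ik : mu.-integrable J (EFin \o k).
Hypothesis IK1 : mu.-integrable J (EFin \o K1).
Hypothesis IK1bar : mu.-integrable J (EFin \o K1bar).
Hypothesis Ilam : mu.-integrable J (EFin \o lam).

Let p_gt0 : 0 < p. Proof. by have := p_ge2; lra. Qed.

Let JT s : J s -> 0 < s <= T.
Proof.
rewrite /= in_itv/= => /andP[s0s ss1].
by rewrite (le_lt_trans s0_ge0 s0s) (le_trans ss1 s1T).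
Qed.

Let JcT : Jc `<=` (`[0, T] : set R).
Proof.
move=> s /=; rewrite !in_itv/= => /andP[s0s ss1].
by rewrite (le_trans s0_ge0 s0s) (le_trans ss1 s1T).
Qed.

Definition cell_integral (x : V) : dual V := vintegral Jc (fun s => a s x).

(** With [h] the part of the step that is already known, the implicit equation for the
    new value [x] is [step_operator h x = 0]. *)
Definition step_operator (h : H) (x : V) : dual V :=
  to_dual G (emb G x) - to_dual G h - cell_integral x.

Definition cell_average (j : 'I_r) (x : V) : H :=
  (s1 - s0)^-1 *: vintegral Jc (fun s => b j s x).

Let ma x w : measurable_fun Jc (fun s => a s x w : R).
Proof. exact: measurable_funS (JcT) (path_measurableA reg x w). Qed.

Let bound_integrable c : mu.-integrable J (EFin \o (fun s => k s * c)).
Proof. exact: integrable_scaler. Qed.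

Let growth_a x s w : J s -> `|a s x w| <= k s * (1 + `|x| `^ p) * `|w|.
Proof. by move=> /JT; exact: (path_growthA reg). Qed.

Lemma cell_integralE x w : cell_integral x w = \int[mu]_(s in J) (a s x w : R).
Proof.
exact: (vintegral_dual reflV (ma x) (growth_a x) (bound_integrable _)).
Qed.

Lemma path_integrable x w : mu.-integrable J (EFin \o (fun s => a s x w : R)).
Proof.
exact: (dual_cell_integrable (ma x) (growth_a x) (bound_integrable _)).
Qed.

Lemma step_operatorE h x w : step_operator h x w =
  inner G (emb G w) (emb G x - h) - \int[mu]_(s in J) (a s x w : R) :> R.
Proof. by rewrite innerBr -cell_integralE. Qed.

Lemma kernel_ge0 t : 0 < t <= T -> 0 <= k t.
Proof.
move=> tT; have := path_growthB reg 0 tT.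
rewrite normr0 powR0 ?gt_eqF// addr0 mulr1; apply: le_trans.
by rewrite sumr_ge0// => j _; rewrite sqr_ge0.
Qed.

Lemma step_operator_strongly_monotone h x y :
  `|emb G (x - y)| ^+ 2 <= step_operator h x (x - y) - step_operator h y (x - y).
Proof.
rewrite !step_operatorE.
have e : inner G (emb G (x - y)) (emb G x - h) - inner G (emb G (x - y)) (emb G y - h) =
    `|emb G (x - y)| ^+ 2.
  by rewrite -innerBr -(inner_norm G) opprB addrA subrK linearB.
have m : \int[mu]_(s in J) (a s x (x - y) : R) <= \int[mu]_(s in J) (a s y (x - y) : R).
  apply: le_Rintegral => //; try exact: path_integrable.
  move=> s /JT sT; have := path_monotone reg x y sT.
  have : 0 <= \sum_(j < r) `|b j s x - b j s y| ^+ 2.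
    by rewrite sumr_ge0// => j _; rewrite sqr_ge0.
  have le (u v S : R) : 0 <= S -> 2 * (u - v) + S <= 0 -> u <= v by lra.
  exact: le.
by move: e m; lra.
Qed.

Lemma step_operator_monotone h : monotone_op (step_operator h).
Proof.
move=> x y; have := step_operator_strongly_monotone h x y.
by apply: le_trans; exact: sqr_ge0.
Qed.

Lemma step_operator_bounded h : locally_bounded_op (step_operator h).
Proof.
move=> rho; have [c c0 cemb] := emb_bounded G.
pose M := c * (c * `|rho| + `|h|) + \int[mu]_(s in J) (k s * (1 + `|rho| `^ p)).
exists M => x w xrho; rewrite step_operatorE.
have xr : `|x| <= `|rho| by rewrite (le_trans xrho)// ler_norm.
rewrite (le_trans (ler_normB _ _))// /M mulrDl lerD//.
  rewrite (le_trans (cauchy_schwarz _ _ _))// mulrAC ler_pM//.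
  rewrite (le_trans (ler_normB _ _))// lerD2r (le_trans (cemb _))//.
  by rewrite ler_wpM2l// ltW.
rewrite mulrC -RintegralZl//; apply: Rintegral_abs_le => //.
- by apply: measurable_closed_open_cell; exact: ma.
- exact: integrable_scale.
move=> s Js; rewrite (le_trans (growth_a x w Js))// mulrC ler_wpM2l//.
rewrite ler_wpM2l ?kernel_ge0 ?JT// lerD2l.
by apply: ge0_ler_powR; rewrite ?nnegrE ?(ltW p_gt0).
Qed.

Lemma step_operator_hemicontinuous h : hemicontinuous_op (step_operator h).
Proof.
move=> x y z; under eq_fun do rewrite step_operatorE.
rewrite step_operatorE; apply: cvgB.
  under eq_fun do rewrite innerBr linearD linearZ /= innerDr innerZr.
  rewrite innerBr; apply: cvgB; last exact: cvg_cst.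
  rewrite -[X in _ --> X]addr0 -[X in _ --> _ + X](mul0r (inner G (emb G z) (emb G y))).
  apply: cvgD; first exact: cvg_cst.
  by apply: cvgM; [exact: cvg_harmonic|exact: cvg_cst].
apply: (@Rintegral_dominated _ _ _ mu J (fun n s => a s (x + n.+1%:R^-1 *: y) z : R)
  (fun s => a s x z : R) (fun s => `|z| * (k s * (1 + (`|x| + `|y|) `^ p)))) => //.
- by move=> n; apply: measurable_closed_open_cell; exact: ma.
- by move=> s /JT sT; exact: (path_hemicontinuous reg).
- exact: integrable_scale.
move=> n s Js; rewrite (le_trans (growth_a _ _ Js))// mulrC ler_wpM2l//.
rewrite ler_wpM2l ?kernel_ge0 ?JT// lerD2l.
apply: ge0_ler_powR; rewrite ?nnegrE ?addr_ge0 ?(ltW p_gt0)//.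
rewrite (le_trans (ler_normD _ _))// lerD2l normrZ gtr0_norm ?invr_gt0//.
by rewrite ler_piMl// invf_le1// ler1n.
Qed.

Lemma lam_cell_gt0 : (forall t, 0 < t <= T -> 0 < lam t) ->
  0 < \int[mu]_(s in J) lam s.
Proof.
move=> l0; rewrite lt_neqAle Rintegral_ge0 ?andbT; last first.
  by move=> s /JT /l0 /ltW.
apply/eqP => I0.
have lE : (\int[mu]_(s in J) `|(lam s)%:E| = 0)%E.
  rewrite -[RHS](congr1 EFin (esym I0)) EFin_Rintegral//.
  by apply: eq_integral => s /set_mem /JT /l0 ls; rewrite gee0_abs// lee_fin ltW.
have mlam : measurable_fun J (EFin \o lam) by case/integrableP: Ilam.
have ae0 : ae_eq mu J (EFin \o lam) (cst 0%E) by apply/ae_eq_integral_abs.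
have : mu J = 0%E.
  apply/negligibleP => //; apply: negligibleS ae0 => s Js /= /(_ Js) [] /eqP.
  by rewrite gt_eqF// l0// JT.
by rewrite cell_measure// => -[] /eqP; rewrite subr_eq0 gt_eqF.
Qed.

(** The term [K1 |x|_H^2] is absorbed by the [|x|_H^2] of the implicit step as soon as the
    integral of [K1] over the cell is at most 1: this is what makes the time step small. *)
Lemma step_operator_coercive h x : \int[mu]_(s in J) K1 s <= 1 ->
  step_operator h x x <= 0 ->
  (\int[mu]_(s in J) lam s) * `|x| `^ p <= \int[mu]_(s in J) K1bar s + `|h| ^+ 2.
Proof.
move=> K1le; rewrite step_operatorE innerBr (inner_norm G) => Dx.
set N := `|emb G x| ^+ 2 in Dx *.
have I1 : mu.-integrable J (EFin \o (fun s => 2 * (a s x x : R))).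
  by apply: integrable_scale => //; exact: path_integrable.
have I2 : mu.-integrable J (EFin \o (fun s => lam s * `|x| `^ p)).
  exact: integrable_scaler.
have I3 : mu.-integrable J (EFin \o (fun s => K1 s * N)).
  exact: integrable_scaler.
have : \int[mu]_(s in J) (2 * (a s x x : R) + lam s * `|x| `^ p) <=
    \int[mu]_(s in J) (K1 s * N + K1bar s).
  apply: le_Rintegral => //; try exact: integrable_addr.
  by move=> s /JT sT; exact: (path_coercive reg).
rewrite !RintegralD// RintegralZl//; last exact: path_integrable.
rewrite !RintegralZr//.
have N0 : 0 <= N by rewrite sqr_ge0.
have : (\int[mu]_(s in J) K1 s) * N <= N by rewrite ler_piMl.
have := inner_le_sqr G (emb G x) h; rewrite -/N.
by lra.
Qed.

Theorem step_solvable (pi : {linear V -> V}) h : continuous pi ->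
  (forall x, pi (pi x) = pi x) -> (forall t, 0 < t <= T -> 0 < lam t) ->
  \int[mu]_(s in J) K1 s <= 1 ->
  exists x, pi x = x /\ forall w, step_operator h x (pi w) = 0.
Proof.
move=> cpi pi_idem l0 K1le; set L := \int[mu]_(s in J) lam s.
have L0 : 0 < L by exact: lam_cell_gt0.
set M := \int[mu]_(s in J) K1bar s + `|h| ^+ 2.
apply: (@browder_minty _ _ _ cpi pi_idem reflV _ (1 + `|M| / L)).
- exact: step_operator_monotone.
- exact: step_operator_hemicontinuous.
move=> x _ /(step_operator_coercive K1le); rewrite -/L -/M => h1.
have ML : 0 <= `|M| / L by rewrite divr_ge0// ltW.
have [x1|x1] := leP `|x| 1; first by rewrite (le_trans x1)// lerDl.
rewrite (@le_trans _ _ (`|x| `^ p))//.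
  rewrite -{1}(powRr1 (normr_ge0 x)); apply: ler_powR; first exact: ltW.
  by have := p_ge2; lra.
rewrite (@le_trans _ _ (`|M| / L)) ?lerDr// ler_pdivlMr// mulrC.
by rewrite (le_trans h1)// ler_norm.
Qed.

Lemma step_unique (pi : {linear V -> V}) h x y : pi x = x -> pi y = y ->
  (forall w, step_operator h x (pi w) = 0) ->
  (forall w, step_operator h y (pi w) = 0) -> x = y.
Proof.
move=> pix piy Dx Dy; apply: (@emb_inj _ _ _ G).
apply/eqP; rewrite -subr_eq0 -linearB -normr_eq0 -(sqrf_eq0 `|_|).
have := step_operator_strongly_monotone h x y.
have -> : x - y = pi (x - y) by rewrite linearB pix piy.
by rewrite Dx Dy subrr => h0; rewrite eq_le h0 sqr_ge0.
Qed.

Let mb j x w : measurable_fun Jc (fun s => inner G (b j s x) (emb G w)).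
Proof. exact: measurable_funS (JcT) (path_measurableB reg j x w). Qed.

Let growth_b x j s : J s -> `|b j s x| ^+ 2 <= k s * (1 + `|x| `^ p).
Proof.
move=> /JT sT; apply: le_trans (path_growthB reg x sT).
by rewrite (bigD1 j)//= lerDl sumr_ge0// => i _; rewrite sqr_ge0.
Qed.

Lemma inner_cell_average j x h : inner G (cell_average j x) h =
  (s1 - s0)^-1 * \int[mu]_(s in J) inner G (b j s x) h.
Proof.
rewrite innerZl; congr (_ * _).
exact: (inner_vintegral s01 (mb j x) (growth_b x j) (bound_integrable _)).
Qed.

Lemma path_inner_integrable j x h :
  mu.-integrable J (EFin \o (fun s => inner G (b j s x) h)).
Proof.
exact: (inner_cell_integrable s01 (mb j x) (growth_b x j) (bound_integrable _)).
Qed.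

Lemma cell_average_bound j x : `|cell_average j x| ^+ 2 <=
  (s1 - s0)^-1 * (\int[mu]_(s in J) k s) * (1 + `|x| `^ p).
Proof.
rewrite -mulrA -RintegralZr//.
apply: (average_sqr_norm s01 (mb j x) (growth_b x j) (bound_integrable _)).
exact: inner_cell_average.
Qed.

(** Monotonicity bounds the increments of the noise coefficients by those of the drift, so
    that the averages depend continuously on [x]. *)
Lemma cell_average_diff j x y : `|cell_average j x - cell_average j y| ^+ 2 <=
  (s1 - s0)^-1 * (\int[mu]_(s in J) k s) *
  (2 * `|x - y| * (2 + `|x| `^ p + `|y| `^ p)).
Proof.
rewrite -mulrA -RintegralZr//.
apply: (@average_sqr_norm _ _ _ s01 _ _ G (fun s => b j s x - b j s y) _ _ _
  (bound_integrable _)).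
- move=> w; apply: eq_measurable_fun (measurable_funB (mb j x w) (mb j y w)).
  by move=> s _; rewrite innerBl.
- move=> s Js; have sT := JT Js.
  have h : `|b j s x - b j s y| ^+ 2 <= 2 * ((a s y (x - y) : R) - a s x (x - y)).
    have := path_monotone reg x y sT; rewrite (bigD1 j)//=.
    set S := \sum_(i < r | _) _.
    have : 0 <= S by rewrite sumr_ge0// => i _; rewrite sqr_ge0.
    have le (u v B S' : R) : 0 <= S' -> 2 * (u - v) + (B + S') <= 0 -> B <= 2 * (v - u) by lra.
    exact: le.
  rewrite (le_trans h)//.
  have := growth_a x (x - y) Js; have := growth_a y (x - y) Js.
  rewrite !ler_norml => /andP[_ h1] /andP[h2 _].
  have -> : k s * (2 * `|x - y| * (2 + `|x| `^ p + `|y| `^ p)) =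
    2 * (k s * (1 + `|y| `^ p) * `|x - y| + k s * (1 + `|x| `^ p) * `|x - y|) by ring.
  by rewrite ler_pM2l//; move: h1 h2; lra.
- move=> h; rewrite innerBl !inner_cell_average -mulrBr -RintegralB//;
    try exact: path_inner_integrable.
  by congr (_ * _); apply: eq_Rintegral => s _; rewrite innerBl.
Qed.

Lemma continuous_cell_average j h :
  continuous (fun x => inner G (cell_average j x) h).
Proof.
move=> x; apply/cvgrPdist_lt => e e0.
set kap := (s1 - s0)^-1 * (\int[mu]_(s in J) k s).
have kap0 : 0 <= kap.
  apply: mulr_ge0; first by rewrite invr_ge0 subr_ge0 ltW.
  by apply: Rintegral_ge0 => s /JT; exact: kernel_ge0.
pose B := kap * (2 * (2 + `|x| `^ p + (`|x| + 1) `^ p)).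
have B0 : 0 <= B.
  by rewrite mulr_ge0// mulr_ge0// addr_ge0 ?powR_ge0// addr_ge0// powR_ge0.
pose C := (`|h| ^+ 2 + 1) * (B + 1).
have C0 : 0 < C by rewrite mulr_gt0// ltr_wpDl// sqr_ge0.
have d0 : 0 < Num.min 1 (e ^+ 2 / C) by rewrite lt_min ltr01 divr_gt0// exprn_gt0.
near=> y.
have : `|x - y| < Num.min 1 (e ^+ 2 / C).
  near: y; move: (Num.min _ _) d0 => dd dd0.
  by apply/nbhs_ballP; exists dd => // y; rewrite -ball_normE.
rewrite lt_min => /andP[xy1]; rewrite ltr_pdivlMr// => xyC.
have yx : `|y| <= `|x| + 1.
  rewrite -(subrK x y) (le_trans (ler_normD _ _))// addrC lerD2l distrC ltW//.
rewrite -innerBl -(ltr_pXn2r (n := 2)) ?nnegrE ?(ltW e0)//.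
apply: le_lt_trans xyC.
apply: (@le_trans _ _ ((`|cell_average j x - cell_average j y| * `|h|) ^+ 2)).
  by rewrite ler_pXn2r ?nnegrE ?mulr_ge0// cauchy_schwarz.
have AB : `|cell_average j x - cell_average j y| ^+ 2 <= `|x - y| * B.
  rewrite (le_trans (cell_average_diff j x y))// -/kap /B.
  rewrite [leRHS](_ : _ =
    kap * (2 * `|x - y| * (2 + `|x| `^ p + (`|x| + 1) `^ p))); last by ring.
  rewrite ler_wpM2l// ler_wpM2l ?mulr_ge0// lerD2l.
  by apply: ge0_ler_powR; rewrite ?nnegrE ?(ltW p_gt0) ?addr_ge0.
rewrite exprMn (le_trans (ler_wpM2r (sqr_ge0 _) AB))// -mulrA ler_wpM2l//.
rewrite /C mulrC ler_pM ?sqr_ge0//; first by rewrite lerDl.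
by rewrite lerDl.
Unshelve. all: by end_near. Qed.

End CellOperator.

(** * Measurability of the solution of a random monotone equation *)

Section RandomEquation.
Context {R : realType} {d : measure_display} {Omega : measurableType d}.
Variables (P : probability Omega R) (S : set (set Omega)).
Hypothesis cS : complete_sub_sigma_algebra P S.
Context {V : completeNormedModType R}.
Hypothesis sepV : separable V.
Hypothesis reflV : reflexive_space V.
Variable pi : {linear V -> V}.
Hypothesis cpi : continuous pi.
Hypothesis pi_idem : forall x, pi (pi x) = pi x.

(** For almost every [w], the solution lies in a closed ball if and only if, for
    every [k], the slightly larger open ball contains a point of a fixed countable
    dense subset of the range of [pi] which violates the first [k] Minty inequalities by less than
    [1 / (k + 1)]; the converse direction is weak compactness. *)
Theorem measurable_monotone_solution (D : Omega -> V -> dual V) (u : Omega -> V) :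
  (forall y v, measurable_wrt S (fun w => D w y v : R)) ->
  {ae P, forall w, [/\ monotone_op (D w), hemicontinuous_op (D w) &
    locally_bounded_op (D w)]} ->
  {ae P, forall w, pi (u w) = u w /\ forall v, D w (u w) (pi v) = 0} ->
  {ae P, forall w x, pi x = x -> (forall v, D w x (pi v) = 0) -> x = u w} ->
  measurable_wrt S (u : Omega -> borel V).
Proof.
move=> mD regD solD uniqD; apply: (measurable_wrt_borel cS sepV) => c rad.
have [y0 dy0] := separable_sequence sepV.
have [C C0 piC] := bounded_projection cpi.
pose y n := pi (y0 n).
have piy n : pi (y n) = y n by exact: pi_idem.
have dy z e : pi z = z -> 0 < e -> exists n, `|y n - z| < e.
  move=> piz e0; have [n hn] := dy0 z (e / C) (divr_gt0 e0 C0).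
  exists n; rewrite -piz -linearB (le_lt_trans (piC _))// mulrC.
  by rewrite -ltr_pdivlMr.
pose B k n i := [set w | - k.+1%:R^-1 < (D w (y i) (y i - y n) : R)].
have SB k n i : S (B k n i).
  have /(measurable_wrtP cS) /(_ `]- k.+1%:R^-1, +oo[%classic) := mD (y i) (y i - y n).
  rewrite (_ : _ @^-1` _ = B k n i).
    by apply; exact: measurable_itv.
  by apply/seteqP; split=> w; rewrite /B /= in_itv/= andbT.
pose A := \bigcap_k \bigcup_n (if `|y n - c| < rad + k.+1%:R^-1
  then \bigcap_i (if (i <= k)%N then B k n i else setT) else set0).
have SA : S A.
  rewrite /A; apply: (sigma_bigcap cS) => k; apply: (sigma_bigcup cS) => n.
  case: ifPn => _; last exact: (sigma_set0 cS).
  apply: (sigma_bigcap cS) => i; case: ifPn => _; first exact: SB.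
  exact: (sigma_setT cS).
apply: (sigma_ae_eq cS SA).
apply: filterS3 regD solD uniqD => w [mDw hDw bDw] [piu Du] uniq; split.
  move=> Aw.
  have /choice[n hn] k : exists n, `|y n - c| < rad + k.+1%:R^-1 /\
      forall i, (i <= k)%N -> - k.+1%:R^-1 < (D w (y i) (y i - y n) : R).
    have [n _] := Aw k I; case: ifPn => // nc h; exists n; split=> // i ik.
    by have := h i I; rewrite ik.
  have [x [pix xc Dx]] := @approximate_minty_solution _ _ pi cpi pi_idem reflV (D w) y
    (fun k => y (n k)) c rad mDw hDw bDw dy (fun k => piy (n k)) (fun k => (hn k).1)
    (fun k i => (hn k).2 i).
  by rewrite /= -(uniq x pix Dx).
move=> /= uc k _.
pose M := \sum_(i < k.+1) `|D w (y i)|.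
have M0 : 0 <= M by rewrite sumr_ge0.
have k0 : 0 < k.+1%:R^-1 :> R by rewrite invr_gt0.
have e0 : 0 < k.+1%:R^-1 / (M + 1) :> R by rewrite divr_gt0// ltr_wpDl.
have [n hn] := dy (u w) _ piu e0.
have hn1 : `|y n - u w| < k.+1%:R^-1.
  by rewrite (lt_le_trans hn)// ler_pdivrMr ?ltr_wpDl// ler_peMr ?lerDr ?(ltW k0).
exists n => //; rewrite ifT; last first.
  rewrite -(subrK (u w) (y n)) -addrA addrC (le_lt_trans (ler_normD _ _))//.
  by rewrite ler_ltD.
move=> i _; case: ifPn => // ik; rewrite /B /=.
have mono : 0 <= (D w (y i) (y i - u w) : R).
  have := mDw (y i) (u w); rewrite dualD dualN.
  have -> : y i - u w = pi (y i - u w) by rewrite linearB piy piu.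
  by rewrite Du subr0.
have -> : y i - y n = (y i - u w) - (y n - u w) by rewrite opprB addrA subrK.
have small : `|D w (y i) (y n - u w)| < k.+1%:R^-1.
  apply: le_lt_trans (dual_le_norm _ _) _.
  have Di : `|D w (y i)| <= M.
    have ik1 : (i < k.+1)%N by [].
    by rewrite /M (bigD1 (Ordinal ik1))//= lerDl sumr_ge0.
  apply: (@le_lt_trans _ _ ((M + 1) * `|y n - u w|)).
    by rewrite ler_wpM2r// (le_trans Di)// lerDl.
  by rewrite mulrC -ltr_pdivlMr// ltr_wpDl.
rewrite dual_sub; move: small; rewrite ltr_norml => /andP[_].
have le (s t m : R) : 0 <= s -> t < m -> - m < s - t by lra.
exact: le.
Qed.

End RandomEquation.

(** * Short cells and Wiener increments *)

Section IntegrableExtra.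
Context {R : realType} {d : measure_display} {T : measurableType d}.
Variables (nu : {measure set T -> \bar R}) (D : set T).
Hypothesis mD : measurable D.

Lemma integrable_sumr n (f : 'I_n -> T -> R) :
  (forall i, nu.-integrable D (EFin \o f i)) ->
  nu.-integrable D (EFin \o (fun x => \sum_i f i x)).
Proof.
elim: n f => [|n IH] f If.
  under [X in integrable _ _ (_ \o X)]eq_fun do rewrite big_ord0.
  exact: integrable0.
under [X in integrable _ _ (_ \o X)]eq_fun do rewrite big_ord_recr/=.
by apply: integrable_addr => //; exact: IH.
Qed.

Lemma subset_Rintegral (E : set T) (f : T -> R) : measurable E -> E `<=` D ->
  nu.-integrable D (EFin \o f) -> (forall x, D x -> 0 <= f x) ->
  \int[nu]_(x in E) f x <= \int[nu]_(x in D) f x.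
Proof.
move=> mE ED If f0; have IfE := integrableS mD mE ED If.
rewrite -lee_fin !EFin_Rintegral//; apply: ge0_subset_integral => //.
by case/integrableP: If.
Qed.

End IntegrableExtra.

Section SmallCells.
Context {R : realType}.
Local Notation mu := (@lebesgue_measure R).
Local Notation cell s t := (`]s, t]%classic : set R).

Lemma sub_cell (T s0 s1 : R) : 0 <= s0 -> s1 <= T -> cell s0 s1 `<=` cell 0 T.
Proof.
move=> s00 s1T s; rewrite /= !in_itv/= => /andP[h1 h2].
by rewrite (le_lt_trans s00 h1) (le_trans h2 s1T).
Qed.

Lemma sub_cell_integrable (T s0 s1 : R) (K : R -> R) : 0 <= s0 -> s1 <= T ->
  mu.-integrable (cell 0 T) (EFin \o K) -> mu.-integrable (cell s0 s1) (EFin \o K).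
Proof. by move=> s00 s1T IK; apply: integrableS IK => //; exact: sub_cell. Qed.

(** The part of [K] above a large level [N] has a small integral, and the part
    below it contributes at most [N] times the length of the cell. *)
Lemma small_cell_integrals (T : R) (K : R -> R) : 0 < T ->
  mu.-integrable (cell 0 T) (EFin \o K) ->
  (forall t, 0 < t <= T -> 0 <= K t) ->
  exists2 de, 0 < de & forall s0 s1, 0 <= s0 -> s0 < s1 -> s1 <= T -> s1 - s0 <= de ->
    \int[mu]_(s in cell s0 s1) K s <= 1.
Proof.
move=> T0 IK K0.
have mK : measurable_fun (cell 0 T) K by exact: integrable_measurable IK.
pose f (n : nat) s := Num.max (K s - n%:R) 0.
have f_le n s : cell 0 T s -> `|f n s| <= K s.
  move=> Ds; have Ks : 0 <= K s by apply: K0; move: Ds; rewrite /= in_itv.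
  by rewrite ger0_norm /f ?le_max ?lexx ?orbT// ge_max Ks gerBl ler0n.
have mf n : measurable_fun (cell 0 T) (f n).
  by apply: measurable_maxr => //; apply: measurable_funB.
have : (\int[mu]_(s in cell 0 T) f n s) @[n --> \oo] --> (\int[mu]_(s in cell 0 T) (0 : R)).
  apply: (@Rintegral_dominated _ _ _ mu (cell 0 T) f (fun=> 0) K _ mf _ IK f_le).
    exact: measurable_itv.
  move=> s Ds; have h : \forall n \near \oo, K s <= n%:R by exact: nbhs_infty_ger.
  apply: cvg_near_cst; apply: filterS h => n Kn.
  by rewrite /f max_r// subr_le0.
move=> /cvgrPdist_lt /(_ 2^-1); rewrite invr_gt0 => /(_ (ltr0n _ _)) [N _ /(_ N (leqnn N)) /=].
rewrite Rintegral_cst; last exact: measurable_itv.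
rewrite mul0r sub0r normrN => hN.
have N1 : 0 < 2 * (N%:R + 1) :> R by rewrite mulr_gt0// ltr_wpDl.
exists (2 * (N%:R + 1))^-1; first by rewrite invr_gt0.
move=> s0 s1 s00 s01 s1T s10.
have If : mu.-integrable (cell 0 T) (EFin \o f N).
  apply: (@le_integrableR _ _ _ mu (cell 0 T) _ (f N) K) => //.
    exact: (mf N).
  exact: (f_le N).
have IJ : mu.-integrable (cell s0 s1) (EFin \o f N).
  exact: sub_cell_integrable If.
have Ic : mu.-integrable (cell s0 s1) (EFin \o (fun=> N%:R : R)).
  by apply: cst_integrable => //; exact: cell_finite.
have h1 : \int[mu]_(s in cell s0 s1) K s <=
    \int[mu]_(s in cell s0 s1) (f N s + N%:R).
  apply: le_Rintegral => //; first exact: sub_cell_integrable IK.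
    exact: integrable_addr.
  by move=> s _; rewrite -lerBlDr /f le_max lexx.
rewrite (le_trans h1)// RintegralD// Rintegral_cst//= cell_measure//=.
have h2 : \int[mu]_(s in cell s0 s1) f N s <= 2^-1.
  rewrite (le_trans _ (ltW hN))// (le_trans _ (ler_norm _))//.
  apply: subset_Rintegral => //; first exact: sub_cell.
  by move=> s _; rewrite /f le_max lexx orbT.
have h3 : N%:R * (s1 - s0) <= 2^-1.
  rewrite (le_trans (ler_wpM2l _ s10))// invfM mulrCA ler_piMr ?invr_ge0//.
  by rewrite ler_pdivrMr ?mul1r ?lerDl// ltr_wpDl.
have half : 2^-1 + 2^-1 = 1 :> R by field.
by rewrite (le_trans (lerD h2 h3))// half.
Qed.

End SmallCells.

Section WienerIncrements.
Context {R : realType} {d : measure_display} {Omega : measurableType d}.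
Variables (P : probability Omega R) (F : R -> set (set Omega)).
Variables (r : nat) (W : 'I_r -> R -> Omega -> R).
Hypothesis W_wiener : wiener_martingale P F W.

Lemma wiener_increment_law j s t D U : 0 <= s -> s < t -> F s D ->
  measurable U -> P (D `&` (fun w => W j t w - W j s w) @^-1` U) =
  (P D * normal_prob 0 (Num.sqrt (t - s)) U)%E.
Proof.
move=> s0 st FD mU; have [_ _ _ /(_ s t s0 st D FD)] := W_wiener.
move=> /(_ (fun i => if i == j then U else setT)) /=.
rewrite (bigD1 j)//= eqxx big1; last first.
  by move=> i /negbTE ->; exact: probability_setT.
rewrite mule1 => <-; last by move=> i; case: ifP.
congr (P (_ `&` _)); apply/seteqP; split=> w /=.
  by move=> Uw i _; case: eqP => [->|].
by move=> /(_ j I); rewrite eqxx.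
Qed.

End WienerIncrements.

(** * Measurability along the filtration *)

Section Filtration.
Context {R : realType} {d : measure_display} {Omega : measurableType d}.
Variables (P : probability Omega R) (F : R -> set (set Omega)).
Hypothesis F_usual : usual_filtration P F.
Local Notation mu := (@lebesgue_measure R).

Lemma complete_filtration t : 0 <= t -> complete_sub_sigma_algebra P (F t).
Proof.
case: F_usual => h1 h2 _ h4 t0; have [sF mF] := h1 t t0.
by split=> // N /h4; exact: h2.
Qed.

Lemma measurable_wrt_later s t d' (E : measurableType d') (X : Omega -> E) :
  0 <= s -> s <= t -> measurable_wrt (F s) X -> measurable_wrt (F t) X.
Proof.
move=> s0 st /(measurable_wrtP (complete_filtration s0)) mX.
apply/(measurable_wrtP (complete_filtration (le_trans s0 st))) => U mU.
by have [_ h _ _] := F_usual; apply: (h s t s0 st); exact: mX.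
Qed.

Variable T : R.

Lemma adapted_path_measurable X w : adapted_process F T X ->
  measurable_fun (`[0, T] : set R) (X ^~ w).
Proof.
move=> [_ mX].
apply: (@measurable_comp _ _ _ _ _ _ (`[0, T] `*` setT) (fun z : R * Omega => X z.1 z.2)
  _ (fun s => (s, w))) => //.
- by apply: measurableX => //; exact: measurable_itv.
- by move=> _ [s /= sT <-].
- by apply: measurable_funTS; exact: pair2_measurable.
Qed.

Lemma adapted_cell_integral X s0 s1 : 0 <= s0 -> s0 < s1 -> s1 <= T ->
  adapted_process F T X ->
  {ae P, forall w, mu.-integrable (`]s0, s1]%classic : set R) (EFin \o X ^~ w)} ->
  measurable_wrt (F s1) (fun w => \int[mu]_(s in (`]s0, s1]%classic : set R)) X s w).
Proof.
move=> s00 s01 s1T [aX mX] iX; have s10 : 0 <= s1 by exact: le_trans (ltW s01).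
have de0 : 0 < s1 - s0 by rewrite subr_gt0.
have sub s : (`]s0, s1]%classic : set R) s -> 0 <= s /\ s <= s1.
  by rewrite /= in_itv/= => /andP[/ltW h ->]; rewrite (le_trans s00 h).
apply: (adapted_integral_measurable (complete_filtration s10) (measurable_itv _) de0
  (cell_measure s01)) iX.
  apply: measurable_funS mX; first by apply: measurableX => //; exact: measurable_itv.
  move=> [s w] [/= /sub[h1 h2] _]; split=> //=.
  by rewrite in_itv/= h1 (le_trans h2).
move=> s /sub[h1 h2]; apply: (measurable_wrt_later h1 h2); apply: aX.
by rewrite h1 (le_trans h2).
Qed.

End Filtration.

Section RegularPaths.
Context {R : realType} {V H : completeNormedModType R} (G : gelfand_triple V H).
Context {d : measure_display} {Omega : measurableType d}.
Variables (P : probability Omega R) (F : R -> set (set Omega)) (T p : R) (r : nat).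
Variables (A : R -> V -> Omega -> dual V) (B : 'I_r -> R -> V -> Omega -> H).
Local Notation mu := (@lebesgue_measure R).

Definition regular_coefficients (k K1 K1bar lam : R -> R) : Prop :=
  {ae P, forall w, regular_path G T p k K1 K1bar lam
    (fun s x => A s x w) (fun j s x => B j s x w)}.

Lemma regular_coefficients_of_conditions (K1 K1bar lam K2 : R -> R) alpha :
  2 <= p -> 1 <= alpha -> adapted_coefficients G T A B F ->
  nonneg_integrable T K1 -> nonneg_integrable T K1bar -> pos_integrable T lam ->
  nonneg_integrable T K2 -> monotonicity P T A B ->
  coercivity G P T A B p K1 K1bar lam -> hemicontinuity P T A ->
  growth P T A p (p / (p - 1)) alpha lam K2 ->
  exists2 k, mu.-integrable (`]0, T]%classic : set R) (EFin \o k) &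
    regular_coefficients k K1 K1bar lam.
Proof.
move=> p2 al AB [K10 IK1] [K1b0 IK1b] [l0 Il] [K20 IK2] C1 C2 C3 C4.
have [c c0 cemb] := emb_bounded G.
have sub K : mu.-integrable (`[0, T]%classic : set R) (EFin \o K) ->
    mu.-integrable (`]0, T]%classic : set R) (EFin \o K).
  apply: integrableS => // s /=; rewrite !in_itv/= => /andP[/ltW -> ->].
  by [].
exists (growth_kernel K1 K1bar lam K2 alpha c).
  apply: integrable_addr => //; first by apply: integrable_scale => //; exact: sub.
  apply: integrable_addr => //; first exact: sub.
  by apply: integrable_addr => //; apply: integrable_scale => //; exact: sub.
apply: filterS2 (filterI C1 C2) (filterI C3 C4) => w [h1 h2] [h3 h4].
apply: (regular_path_of_conditions p2 al c0 cemb K10 K1b0 K20 l0) => //.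
  by move=> v x; have [h _] := AB v x; exact: (adapted_path_measurable w h).
by move=> j v x; have [_ h] := AB v x; exact: (adapted_path_measurable w (h j)).
Qed.

End RegularPaths.

(** * One step with random data *)

Section RandomStep.
Context {R : realType} {V H : completeNormedModType R} (G : gelfand_triple V H).
Context {d : measure_display} {Omega : measurableType d}.
Variables (P : probability Omega R) (F : R -> set (set Omega)).
Hypothesis F_usual : usual_filtration P F.
Variables (T p : R) (r : nat).
Hypothesis p_ge2 : 2 <= p.
Hypothesis sepV : separable V.
Hypothesis reflV : reflexive_space V.
Variables (A : R -> V -> Omega -> dual V) (B : 'I_r -> R -> V -> Omega -> H).
Hypothesis AB : adapted_coefficients G T A B F.
Variables (k K1 K1bar lam : R -> R).
Hypothesis reg : regular_coefficients G P T p A B k K1 K1bar lam.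
Local Notation mu := (@lebesgue_measure R).
Local Notation cell s t := (`]s, t]%classic : set R).
Hypothesis IkT : mu.-integrable (cell 0 T) (EFin \o k).
Hypothesis IK1T : mu.-integrable (cell 0 T) (EFin \o K1).
Hypothesis IK1barT : mu.-integrable (cell 0 T) (EFin \o K1bar).
Hypothesis IlamT : mu.-integrable (cell 0 T) (EFin \o lam).
Hypothesis lam_gt0 : forall t, 0 < t <= T -> 0 < lam t.

Definition weakly_measurable (S : set (set Omega)) (h : Omega -> H) : Prop :=
  forall v, measurable_wrt S (fun w => inner G (h w) (emb G v)).

Definition square_dominated (h : Omega -> H) : Prop :=
  exists2 Z : Omega -> R, P.-integrable setT (EFin \o Z) &
    {ae P, forall w, `|h w| ^+ 2 <= Z w}.

Lemma measurable_power (S : set (set Omega)) (u : Omega -> V) :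
  complete_sub_sigma_algebra P S ->
  measurable_wrt S (u : Omega -> borel V) -> measurable_wrt S (fun w => `|u w| `^ p).
Proof.
move=> cS mu'.
have h : measurable_wrt S ((fun x : V => `|x|) \o u).
  by apply: (measurable_wrt_continuous cS) => // x; exact: norm_continuous.
by apply: (@measurableT_comp _ _ _ _ _ _ (fun x : R => x `^ p)) h; exact: measurable_powR.
Qed.

Lemma integrable_of_expectation (f : Omega -> R) : measurable_fun setT f ->
  (forall w, 0 <= f w) -> ('E_P[f] < +oo)%E -> P.-integrable setT (EFin \o f).
Proof.
move=> mf f0; rewrite unlock => Ef; apply/integrableP; split; first exact/measurable_EFinP.
by under eq_integral => w _ do rewrite /= ger0_norm//.
Qed.

Section Explicit.
Variables (sa sb sc : R) (W : 'I_r -> R -> Omega -> R).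
Hypotheses (sa0 : 0 <= sa) (sab : sa < sb) (sbT : sb <= T) (sbc : sb < sc).
Hypothesis W_wiener : wiener_martingale P F W.

Let sb0 : 0 <= sb. Proof. exact: le_trans (ltW sab). Qed.
Let cS : complete_sub_sigma_algebra P (F sb). Proof. exact: (complete_filtration F_usual). Qed.
Let sc0 : 0 <= sc. Proof. exact: le_trans (ltW sbc). Qed.

Let Ik : mu.-integrable (cell sa sb) (EFin \o k).
Proof. exact: sub_cell_integrable IkT. Qed.

Local Notation avg w := (cell_average (fun j s x => B j s x w) sa sb).

Lemma measurable_cell_average j (u : Omega -> V) v :
  measurable_wrt (F sb) (u : Omega -> borel V) ->
  measurable_wrt (F sb) (fun w => inner G (avg w j (u w)) (emb G v)).
Proof.
apply: (measurable_wrt_caratheodory cS sepV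
  (f := fun x w => inner G (avg w j x) (emb G v))); last first.
  apply: filterS reg => w regw x; exact: (continuous_cell_average p_ge2 regw).
move=> x; apply: (@measurable_wrt_ae _ _ _ _ _ cS _ _
  (fun w => (sb - sa)^-1 * \int[mu]_(s in cell sa sb) inner G (B j s x w) (emb G v))).
  apply: measurable_funM; first exact: measurable_cst.
  apply: (adapted_cell_integral F_usual sa0 sab sbT); first by case: (AB x v).
  by apply: filterS reg => w regw; exact: (path_inner_integrable regw).
by apply: filterS reg => w regw; rewrite (inner_cell_average regw).
Qed.

Let E w (u : V) := emb G u + \sum_(j < r) (W j sc w - W j sb w) *: avg w j u.

Lemma measurable_explicit_part (u : Omega -> V) :
  measurable_wrt (F sb) (u : Omega -> borel V) ->
  weakly_measurable (F sc) (fun w => E w (u w)).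
Proof.
move=> mu' v; have later := measurable_wrt_later F_usual sb0 (ltW sbc).
rewrite /E; under eq_fun do rewrite innerDl inner_suml.
apply: measurable_funD.
  apply: later; have h := @measurable_wrt_continuous _ _ _ _ _ cS _ _
    (to_dual G (emb G v) : V -> R) (@dual_continuous _ _ _) mu'.
  exact: h.
apply: measurable_sum => j.
apply: measurable_funM; last exact: (later _ _ _ (measurable_cell_average j v mu')).
have [mW _ _ _] := W_wiener.
by apply: measurable_funB; [exact: mW|exact: (later _ _ _ (mW j _ sb0))].
Qed.

(** The moments are controlled because the increment is independent of the past. *)
Lemma square_dominated_explicit_part (u : Omega -> V) :
  measurable_wrt (F sb) (u : Omega -> borel V) ->
  ('E_P[(fun w => `|u w| `^ p)%R] < +oo)%E ->
  square_dominated (fun w => E w (u w)).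
Proof.
move=> mu' Eu; have mup := measurable_power cS mu'.
have mup' := measurable_wrt_measurable cS mup.
have [c c0 cemb] := emb_bounded G.
pose Y w := 1 + `|u w| `^ p.
have Y0 w : 0 <= Y w by rewrite addr_ge0// powR_ge0.
have IY : P.-integrable setT (EFin \o Y).
  apply: integrable_addr => //; last exact: integrable_of_expectation.
  apply: cst_integrable => //; exact: le_lt_trans (probability_le1 P measurableT) (ltry _).
have mY := integrable_measurable IY.
pose X j w := W j sc w - W j sb w.
have mX j : measurable_fun setT (X j).
  have [mW _ _ _] := W_wiener.
  have mWt t (t0 : 0 <= t) : measurable_fun setT (W j t) :=
    measurable_wrt_measurable (complete_filtration F_usual t0) (mW j t t0).
  by apply: measurable_funB; exact: mWt.
have IYX j : P.-integrable setT (EFin \o (fun w => Y w * X j w ^+ 2)).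
  have s0 : Num.sqrt (sc - sb) != 0 by rewrite gt_eqF// sqrtr_gt0 subr_gt0.
  have [_ Fm _] := cS.
  have [C C0 hC] := @gaussian_increment_moment _ _ _ _ _ (X j) _ Fm (mX j) s0
    (fun D U FD mU => wiener_increment_law W_wiener j sb0 sbc FD mU).
  apply/integrableP; split.
    by apply/measurable_EFinP/measurable_funM => //; exact: measurable_funX.
  have YX0 w : 0 <= Y w * X j w ^+ 2 by rewrite mulr_ge0// sqr_ge0.
  under eq_integral => w _ do rewrite /= (ger0_norm (YX0 w)).
  apply: (le_lt_trans (hC Y mY _ Y0)).
    move=> x; have /(measurable_wrtP cS) /(_ `[x, +oo[%classic (measurable_itv _)) :
        measurable_wrt (F sb) Y by apply: measurable_funD => //; exact: measurable_cst.
    by congr (F sb _); apply/seteqP; split=> w /=; rewrite in_itv/= andbT.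
  rewrite lte_mul_pinfty ?lee_fin// lte_add_pinfty ?ltry//.
  have /integrableP[_] := IY.
  by under eq_integral => w _ do rewrite /= ger0_norm//.
have [kap hkap] : exists kap,
    {ae P, forall w, forall j, `|avg w j (u w)| ^+ 2 <= kap * Y w}.
  exists ((sb - sa)^-1 * (\int[mu]_(s in cell sa sb) k s)).
  by apply: filterS reg => w regw j; exact: (cell_average_bound regw).
exists (fun w => 2 * c ^+ 2 * Y w + 2 * 2 ^+ r * kap * \sum_(j < r) (Y w * X j w ^+ 2)).
  apply: integrable_addr => //; apply: integrable_scale => //.
  exact: integrable_sumr.
apply: filterS hkap => w hw; rewrite (le_trans (sqr_normD_le G _ _))// lerD//.
  rewrite -mulrA ler_pM2l// (le_trans (y := (c * `|u w|) ^+ 2))//.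
    by rewrite ler_pXn2r ?nnegrE// mulr_ge0// ltW.
  by rewrite exprMn ler_wpM2l ?sqr_ge0// sqr_le_powR.
rewrite -!mulrA ler_pM2l// (le_trans (sqr_norm_sum_le G _))// ler_wpM2l ?exprn_ge0//.
rewrite mulr_sumr ler_sum// => j _; rewrite normrZ exprMn real_normK ?num_real//.
rewrite [leRHS](_ : _ = X j w ^+ 2 * (kap * Y w)); last by ring.
by rewrite ler_wpM2l ?sqr_ge0.
Qed.

End Explicit.

Section Implicit.
Variables (s0 s1 : R).
Hypotheses (s00 : 0 <= s0) (s01 : s0 < s1) (s1T : s1 <= T).
Hypothesis K1_le1 : \int[mu]_(s in cell s0 s1) K1 s <= 1.
Variable pi : {linear V -> V}.
Hypothesis cpi : continuous pi.
Hypothesis pi_idem : forall x, pi (pi x) = pi x.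

Let s10 : 0 <= s1. Proof. exact: le_trans (ltW s01). Qed.
Let cS : complete_sub_sigma_algebra P (F s1). Proof. exact: (complete_filtration F_usual). Qed.
Let Ik : mu.-integrable (cell s0 s1) (EFin \o k). Proof. exact: sub_cell_integrable IkT. Qed.
Let IK1 : mu.-integrable (cell s0 s1) (EFin \o K1). Proof. exact: sub_cell_integrable IK1T. Qed.
Let IK1bar : mu.-integrable (cell s0 s1) (EFin \o K1bar).
Proof. exact: sub_cell_integrable IK1barT. Qed.
Let Ilam : mu.-integrable (cell s0 s1) (EFin \o lam). Proof. exact: sub_cell_integrable IlamT. Qed.

Local Notation D w := (step_operator G (fun s x => A s x w) s0 s1).

(** The solution is measurable because it is unique; coercivity bounds its [p]-th power by
    the square of the known part. *)
Lemma implicit_step (h : Omega -> H) :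
  weakly_measurable (F s1) h -> square_dominated h ->
  exists u : Omega -> V,
  [/\ measurable_wrt (F s1) (u : Omega -> borel V), forall w, pi (u w) = u w,
      {ae P, forall w v, D w (h w) (u w) (pi v) = 0} &
      ('E_P[(fun w => `|u w| `^ p)%R] < +oo)%E].
Proof.
move=> mh [Z IZ hZ].
pose sol w := [set x | pi x = x /\ forall v, D w (h w) x (pi v) = 0].
pose u w := xget 0 (sol w).
have piu w : pi (u w) = u w.
  by rewrite /u; case: xgetP => [x _ []|_]//; rewrite linear0.
have solu : {ae P, forall w, sol w (u w)}.
  apply: filterS reg => w regw.
  have [x solx] := step_solvable p_ge2 reflV regw s00 s01 s1T Ik IK1 IK1bar Ilam (h w)
    cpi pi_idem lam_gt0 K1_le1.
  exact: xgetI solx.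
have mu' : measurable_wrt (F s1) (u : Omega -> borel V).
  apply: (@measurable_monotone_solution _ _ _ _ _ cS _ sepV reflV pi cpi pi_idem
    (fun w => D w (h w))) => //.
  - move=> y v.
    apply: (@measurable_wrt_ae _ _ _ _ _ cS _ _ (fun w =>
      (inner G (emb G v) (emb G y) - inner G (h w) (emb G v)) -
      \int[mu]_(s in cell s0 s1) (A s y w v : R))).
      apply: measurable_funB.
        by apply: measurable_funB => //; exact: mh.
      apply: (adapted_cell_integral F_usual s00 s01 s1T); first by case: (AB y v).
      by apply: filterS reg => w regw; exact: (path_integrable regw).
    apply: filterS reg => w regw.
    by rewrite (step_operatorE reflV regw)// innerBr (innerC G (h w)).
  - apply: filterS reg => w regw; split.
    + exact: (step_operator_monotone reflV regw).
    + exact: (step_operator_hemicontinuous p_ge2 reflV regw).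
    + exact: (step_operator_bounded p_ge2 reflV regw).
  - apply: filterS2 reg solu => w regw [_ Du] x pix Dx.
    exact: (step_unique reflV regw s00 s1T Ik pix (piu w) Dx Du).
exists u; split=> //; first by apply: filterS solu => w [].
have L0 := lam_cell_gt0 s00 s01 s1T Ilam lam_gt0.
set L := \int[mu]_(s in _) _ in L0.
pose C := \int[mu]_(s in cell s0 s1) K1bar s.
have IM : P.-integrable setT (EFin \o (fun w => L^-1 * (C + Z w))).
  apply: integrable_scale => //; apply: integrable_addr => //.
  apply: cst_integrable => //; exact: le_lt_trans (probability_le1 P measurableT) (ltry _).
have /integrableP[mM IMoo] := IM.
have mup := measurable_wrt_measurable cS (measurable_power cS mu').
rewrite unlock; apply: le_lt_trans IMoo; apply: ae_ge0_le_integral => //.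
- exact/measurable_EFinP.
- exact: measurableT_comp.
apply: filterS3 reg solu hZ => w regw [_ Du] hw _.
rewrite lee_fin (le_trans _ (ler_norm _))// ler_pdivlMl//.
apply: le_trans (step_operator_coercive reflV regw s00 s1T Ik IK1 IK1bar Ilam (h := h w) K1_le1 _) _.
  by rewrite -{2}piu Du.
by rewrite lerD2l.
Qed.

End Implicit.

End RandomStep.

(** * The scheme along a projection *)

Section Grid.
Context {R : realType}.
Variables (T : R) (m : nat).
Hypotheses (T_gt0 : 0 < T) (m_gt0 : (0 < m)%N).

Lemma step_gt0 : 0 < step T m. Proof. by rewrite divr_gt0// ltr0n. Qed.

Lemma gridB i : grid T m i.+1 - grid T m i = step T m.
Proof. by rewrite -mulrBl -natrB// subSnn mul1r. Qed.

Lemma grid_lt i : grid T m i < grid T m i.+1.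
Proof. by rewrite -subr_gt0 gridB step_gt0. Qed.

Lemma grid_ge0 i : 0 <= grid T m i.
Proof. by rewrite mulr_ge0// ltW// step_gt0. Qed.

Lemma grid_le i : (i <= m)%N -> grid T m i <= T.
Proof.
move=> im; rewrite /grid /step mulrA ler_pdivrMr ?ltr0n// mulrC ler_pM2l//.
by rewrite ler_nat.
Qed.

End Grid.

Section ProjectedScheme.
Context {R : realType} {V H : completeNormedModType R} (G : gelfand_triple V H).
Context {d : measure_display} {Omega : measurableType d}.
Variables (P : probability Omega R) (F : R -> set (set Omega)).
Hypothesis F_usual : usual_filtration P F.
Variables (T p : R) (r : nat) (W : 'I_r -> R -> Omega -> R).
Hypothesis W_wiener : wiener_martingale P F W.
Hypothesis T_gt0 : 0 < T.
Hypothesis p_ge2 : 2 <= p.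
Hypothesis sepV : separable V.
Hypothesis reflV : reflexive_space V.
Variables (A : R -> V -> Omega -> dual V) (B : 'I_r -> R -> V -> Omega -> H).
Hypothesis AB : adapted_coefficients G T A B F.
Variables (k K1 K1bar lam : R -> R).
Hypothesis reg : regular_coefficients G P T p A B k K1 K1bar lam.
Local Notation mu := (@lebesgue_measure R).
Local Notation cell s t := (`]s, t]%classic : set R).
Hypothesis IkT : mu.-integrable (cell 0 T) (EFin \o k).
Hypothesis IK1T : mu.-integrable (cell 0 T) (EFin \o K1).
Hypothesis IK1barT : mu.-integrable (cell 0 T) (EFin \o K1bar).
Hypothesis IlamT : mu.-integrable (cell 0 T) (EFin \o lam).
Hypothesis lam_gt0 : forall t, 0 < t <= T -> 0 < lam t.
Variable u0 : Omega -> H.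
Hypothesis u0_init : initial_condition P F u0.
Variable m : nat.
Hypothesis m_gt0 : (0 < m)%N.
Hypothesis K1_le1 : forall i, (i < m)%N ->
  \int[mu]_(s in cell (grid T m i) (grid T m i.+1)) K1 s <= 1.
Variable pi : {linear V -> V}.
Hypothesis cpi : continuous pi.
Hypothesis pi_idem : forall x, pi (pi x) = pi x.

Local Notation t_ i := (grid T m i).

Definition explicit_part (w : Omega) (i : nat) (x : V) : H :=
  if i is i'.+1 then
    emb G x + \sum_(j < r) (W j (t_ i.+1) w - W j (t_ i) w) *:
      cell_average (fun j s x => B j s x w) (t_ i') (t_ i) j x
  else u0 w.

Local Notation D w i := (step_operator G (fun s x => A s x w) (t_ i) (t_ i.+1)).

(** Galerkin form of one path of the scheme: the unknowns lie in the range of [pi], and the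
    equation is tested against that range only. *)
Definition projected_scheme (w : Omega) (u : nat -> V) : Prop :=
  u 0%N = 0 /\ forall i, (i < m)%N -> pi (u i.+1) = u i.+1 /\
    forall v, D w i (explicit_part w i (u i)) (u i.+1) (pi v) = 0.

Lemma projected_scheme_unique : {ae P, forall w, forall u v,
  projected_scheme w u -> projected_scheme w v -> forall i, (i <= m)%N -> u i = v i}.
Proof.
apply: filterS reg => w regw u v [u0E uS] [v0E vS]; elim=> [|i IH] im.
  by rewrite u0E v0E.
have [piu Du] := uS i im; have [piv Dv] := vS i im.
rewrite -IH ?(ltnW im)// in Dv.
apply: (step_unique reflV regw _ _ _ piu piv Du Dv); first exact: grid_ge0.
- exact: grid_le.
- by apply: sub_cell_integrable IkT; [exact: grid_ge0|exact: grid_le].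
Qed.

Let good i (u : Omega -> V) :=
  [/\ measurable_wrt (F (t_ i)) (u : Omega -> borel V), forall w, pi (u w) = u w &
      ('E_P[(fun w => `|u w| `^ p)%R] < +oo)%E].

Lemma projected_step i (u : Omega -> V) : (i < m)%N -> good i u ->
  exists2 u', good i.+1 u' &
  {ae P, forall w v, D w i (explicit_part w i (u w)) (u' w) (pi v) = 0}.
Proof.
move=> im [mu' piu Eu].
have [u' [h1 h2 h3 h4]] : exists u' : Omega -> V,
  [/\ measurable_wrt (F (t_ i.+1)) (u' : Omega -> borel V), forall w, pi (u' w) = u' w,
      {ae P, forall w v, D w i (explicit_part w i (u w)) (u' w) (pi v) = 0} &
      ('E_P[(fun w => `|u' w| `^ p)%R] < +oo)%E].
  have sd : weakly_measurable G (F (t_ i.+1)) (fun w => explicit_part w i (u w)) /\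
      square_dominated P (fun w => explicit_part w i (u w)).
    case: i {mu'} im (mu') => [|i] im mi /=.
      have [mu0 Eu0] := u0_init; split=> [v|]; last first.
        exists (fun w => `|u0 w| ^+ 2) => //.
        apply: integrable_of_expectation => //.
          have cF0 := complete_filtration F_usual (lexx 0).
          apply: (measurable_wrt_measurable cF0).
          apply: measurable_funX.
          by apply: (measurable_wrt_continuous cF0) mu0 => x; exact: norm_continuous.
        exact: aeW.
      have cF0 := complete_filtration F_usual (lexx 0).
      apply: (measurable_wrt_later F_usual (lexx 0)); first exact: grid_ge0.
      have cont : continuous (fun x : H => inner G x (emb G v)).
        have [f fE] := inner_dual G (emb G v).
        rewrite (_ : (fun _ => _) = f); first exact: dual_continuous.
        by apply/funext => x; rewrite fE.
      have h := @measurable_wrt_continuous _ _ _ _ _ cF0 _ _ _ cont mu0.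
      exact: h.
    split.
      apply: (measurable_explicit_part F_usual p_ge2 sepV AB reg IkT _ _ _ _ W_wiener mi).
      - exact: grid_ge0.
      - exact: grid_lt.
      - exact/grid_le/ltnW.
      - exact: grid_lt.
    apply: (square_dominated_explicit_part F_usual p_ge2 reg IkT _ _ _ _ W_wiener mi Eu).
    - exact: grid_ge0.
    - exact: grid_lt.
    - exact/grid_le/ltnW.
    - exact: grid_lt.
  case: sd => mh hh.
  apply: (implicit_step F_usual p_ge2 sepV reflV AB reg IkT IK1T IK1barT IlamT lam_gt0
    _ _ _ (K1_le1 im) cpi pi_idem mh hh).
  - exact: grid_ge0.
  - exact: grid_lt.
  - exact: grid_le.
by exists u'.
Qed.

(** The steps are chained by dependent choice, because each step only provides some
    solution outside a null set. *)
Lemma projected_scheme_exists : exists u : nat -> Omega -> V,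
  [/\ grid_adapted F T m u, forall i, (i <= m)%N -> forall w, pi (u i w) = u i w,
      {ae P, forall w, projected_scheme w (u ^~ w)} & finite_moments P p m u].
Proof.
have /choice[next hnext] (x : nat * (Omega -> V)) : exists u', (x.1 < m)%N ->
    good x.1 x.2 -> good x.1.+1 u' /\
    {ae P, forall w v, D w x.1 (explicit_part w x.1 (x.2 w)) (u' w) (pi v) = 0}.
  have [im|_] := boolP (x.1 < m)%N; last by exists (fun=> 0).
  have [gx|ngx] := pselect (good x.1 x.2); last by exists (fun=> 0) => _ h; case: (ngx h).
  by have [u' h1 h2] := projected_step im gx; exists u'.
pose u := nat_rect (fun=> Omega -> V) (fun=> 0) (fun i ui => next (i, ui)).
have gu i : (i <= m)%N -> good i (u i).
  elim: i => [|i IH] im; last by have [] := hnext (i, u i) im (IH (ltnW im)).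
  split=> [|w|].
  - exact: measurable_cst.
  - by rewrite linear0.
  - rewrite unlock; under eq_integral => w _.
      rewrite /= normr0 powR0; last by rewrite gt_eqF//; have := p_ge2; lra.
      over.
    by rewrite integral0 ltry.
exists u; split.
- by move=> i /gu[].
- by move=> i /gu[].
- have /ae_foralln h : forall i, {ae P, forall w, (i < m)%N ->
      forall v, D w i (explicit_part w i (u i w)) (u i.+1 w) (pi v) = 0}.
    move=> i; have [im|im] := boolP (i < m)%N; last exact: aeW.
    have [_ h] := hnext (i, u i) im (gu _ (ltnW im)).
    by apply: filterS h => w h' _.
  apply: filterS h => w hw; split=> // i im; split; last exact: hw.
  by have [_ ->] := gu _ im.
- by move=> i /gu[].
Qed.

Lemma projected_well_posed (S : (nat -> Omega -> V) -> Prop) :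
  (forall u, grid_adapted F T m u ->
    (forall i, (i <= m)%N -> forall w, pi (u i w) = u i w) ->
    {ae P, forall w, projected_scheme w (u ^~ w)} -> S u) ->
  (forall v, S v -> {ae P, forall w, projected_scheme w (v ^~ w)}) ->
  well_posed P p m S.
Proof.
move=> toS ofS; have [u [au piu su mu']] := projected_scheme_exists.
exists u; split=> // [|v /ofS sv]; first exact: toS.
apply: filterS3 projected_scheme_unique su sv => w uniq hu hv.
exact: (uniq (v ^~ w) (u ^~ w) hv hu).
Qed.

End ProjectedScheme.

(** * The two schemes as instances *)

Section Instances.
Context {R : realType} {V H : completeNormedModType R} (G : gelfand_triple V H).
Context {d : measure_display} {Omega : measurableType d}.
Variables (T : R) (r : nat) (W : 'I_r -> R -> Omega -> R).
Variables (A : R -> V -> Omega -> dual V) (B : 'I_r -> R -> V -> Omega -> H).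
Variables (u0 : Omega -> H) (m : nat).
Hypothesis T_gt0 : 0 < T.
Hypothesis m_gt0 : (0 < m)%N.

Local Notation t_ i := (grid T m i).
Local Notation a_ w := (fun s x => A s x w).
Local Notation ex := (explicit_part G T W B u0 m).

Let step_neq0 : step T m != 0. Proof. by rewrite gt_eqF// step_gt0. Qed.

Lemma to_dualD h k : to_dual G (h + k) = to_dual G h + to_dual G k.
Proof. by apply: dual_ext => v; rewrite dualD /= innerDr. Qed.

Lemma to_dualZ a h : to_dual G (a *: h) = a *: to_dual G h.
Proof. by apply: dual_ext => v; rewrite dualZ /= innerZr. Qed.

Definition dual_embedding : {linear H -> dual V} := HB.pack (to_dual G)
  (GRing.isLinear.Build _ _ _ _ (to_dual G) (fun a h k =>
    etrans (to_dualD (a *: h) k) (congr1 (+%R^~ (to_dual G k)) (to_dualZ a h)))).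

Lemma step_avgA i x w :
  step T m *: avgA T A m i x w = cell_integral (a_ w) (t_ i) (t_ i.+1) x.
Proof. by rewrite /avgA scalerA mulfV// scale1r. Qed.

Lemma explicit_partS w i x : ex w i.+1 x =
  emb G x + \sum_(j < r) dW T W m j i.+1 w *: avgB T B m j i.+1 x w.
Proof. by rewrite /= /cell_average gridB. Qed.

Lemma step_operator_eq0 w i h x :
  step_operator G (a_ w) (t_ i) (t_ i.+1) h x = 0 <->
  to_dual G (emb G x) = to_dual G h + step T m *: avgA T A m i x w.
Proof.
rewrite step_avgA /step_operator -addrA -opprD; split=> [/eqP|->].
  by rewrite subr_eq0 => /eqP.
exact: subrr.
Qed.

Lemma dual_eq0 (f : dual V) : (forall v, f v = 0 :> R) <-> f = 0.
Proof. by split=> [h|-> //]; apply: dual_ext => v; rewrite h. Qed.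

Lemma time_schemeE w (u : nat -> V) :
  projected_scheme G T W A B u0 m idfun w u <->
  [/\ u 0%N = 0,
      to_dual G (emb G (u 1%N)) =
        to_dual G (u0 w) + step T m *: avgA T A m 0 (u 1%N) w &
      forall i, (1 <= i < m)%N ->
      to_dual G (emb G (u i.+1)) =
        to_dual G (emb G (u i)) + step T m *: avgA T A m i (u i.+1) w
        + to_dual G (\sum_(j < r) dW T W m j i w *: avgB T B m j i (u i) w)].
Proof.
have stepE i : (forall v, step_operator G (a_ w) (t_ i) (t_ i.+1) (ex w i (u i)) (u i.+1)
    (idfun v) = 0 :> R) <->
    to_dual G (emb G (u i.+1)) = to_dual G (ex w i (u i)) + step T m *: avgA T A m i (u i.+1) w.
  by rewrite -step_operator_eq0 -dual_eq0.
split=> [[u0E h]|[u0E h0 h]].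
  split=> //; first by have [_ /stepE] := h _ m_gt0.
  case=> // i /= im; have [_ /stepE ->] := h _ im.
  by rewrite explicit_partS to_dualD addrAC.
split=> // -[|i] im; split=> //; apply/stepE; first exact: h0.
by rewrite (h i.+1)// explicit_partS to_dualD addrAC.
Qed.

Section Space.
Variable Pin : {linear dual V -> V}.

(** The projection [Pin] read on [V] through the embedding of [V] into its dual. *)
Definition sandwich : {linear V -> V} := Pin \o (dual_embedding \o emb G).

Lemma continuous_sandwich : continuous Pin -> continuous sandwich.
Proof.
move=> cPin; have [c c0 cemb] := emb_bounded G.
pose j : {linear V -> dual V} := dual_embedding \o emb G.
have cj : continuous j.
  apply/linear_bounded_continuous/linear_boundedP.
  near=> M => x; apply: dual_norm_le => v v1.
  rewrite (le_trans (cauchy_schwarz _ _ _))// (@le_trans _ _ (c * (c * `|x|)))//.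
    rewrite ler_pM// (le_trans (cemb _))// ler_piMr// ltW//.
  by rewrite mulrA ler_wpM2r.
by move=> x; apply: (@continuous_comp _ _ _ j Pin); [exact: cj|exact: cPin].
Unshelve. all: by end_near. Qed.

Variable Vn : set V.
Hypothesis Pin_Vn : forall f, Vn (Pin f).
Hypothesis Pin_id : forall x, Vn x -> Pin (to_dual G (emb G x)) = x.
Hypothesis Pin_adj : forall (x : V) (y : dual V),
  y (Pin (to_dual G (emb G x))) = to_dual G (emb G (Pin y)) x.

Lemma sandwich_idem x : sandwich (sandwich x) = sandwich x.
Proof. exact: (Pin_id (Pin_Vn (to_dual G (emb G x)))). Qed.

(** Testing a functional on the range of the projection is applying [Pin] to it. *)
Lemma sandwich_annihilator (f : dual V) :
  (forall v, f (sandwich v) = 0 :> R) <-> Pin f = 0.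
Proof.
split=> [h|h v]; last first.
  by rewrite [LHS](Pin_adj v f) h /= linear0 innerC inner0l.
apply: (@emb_inj _ _ _ G); apply/eqP; rewrite linear0 -normr_eq0 -(sqrf_eq0 `|_|).
by rewrite -(inner_norm G); have := h (Pin f); rewrite [LHS](Pin_adj _ f) /= => ->.
Qed.

Lemma space_time_schemeE w (u : nat -> V) : (forall i, (i <= m)%N -> Vn (u i)) ->
  projected_scheme G T W A B u0 m sandwich w u <->
  [/\ u 0%N = 0,
      u 1%N = Pin (to_dual G (u0 w)) + step T m *: Pin (avgA T A m 0 (u 1%N) w) &
      forall i, (1 <= i < m)%N ->
      u i.+1 = u i + step T m *: Pin (avgA T A m i (u i.+1) w)
        + \sum_(j < r) dW T W m j i w *: Pin (to_dual G (avgB T B m j i (u i) w))].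
Proof.
move=> uV.
have stepE i : (i < m)%N ->
    (forall v, step_operator G (a_ w) (t_ i) (t_ i.+1) (ex w i (u i)) (u i.+1)
      (sandwich v) = 0 :> R) <->
    u i.+1 = Pin (to_dual G (ex w i (u i))) + step T m *: Pin (avgA T A m i (u i.+1) w).
  move=> im; rewrite sandwich_annihilator /step_operator -step_avgA !linearB/=.
  rewrite Pin_id; last exact: uV.
  rewrite -addrA -opprD linearZ /=; split=> [/eqP|<-]; last exact: subrr.
  by rewrite subr_eq0 => /eqP.
have exS i : (i < m)%N -> Pin (to_dual G (ex w i.+1 (u i.+1))) = u i.+1 +
    \sum_(j < r) dW T W m j i.+1 w *: Pin (to_dual G (avgB T B m j i.+1 (u i.+1) w)).
  move=> im; rewrite explicit_partS to_dualD linearD /= Pin_id; last exact: uV.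
  congr (_ + _).
  rewrite -[to_dual G _]/(dual_embedding _) !linear_sum; apply: eq_bigr => j _.
  by rewrite linearZ linearZ.
split=> [[u0E h]|[u0E h0 h]].
  split=> //; first by have [_ /(stepE _ m_gt0)] := h _ m_gt0.
  case=> // i /= im; have [_ /(stepE _ im) e] := h _ im.
  by rewrite {1}e exS ?(ltnW im)// addrAC.
split=> // i im; split; first by apply: Pin_id; exact: uV.
apply/(stepE _ im); case: i im => [|i] im; first exact: h0.
by rewrite {1}(h i.+1)// exS ?(ltnW im)// addrAC.
Qed.

End Space.

End Instances.

Unset Implicit Arguments.

Theorem theorem2p9 (R : realType) (V H : completeNormedModType R)
    (V_separable : separable V) (V_reflexive : reflexive_space V)
    (G : gelfand_triple V H)
    (d : measure_display) (Omega : measurableType d) (P : probability Omega R)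
    (F : R -> set (set Omega)) (F_usual : usual_filtration P F)
    (r : nat) (W : 'I_r -> R -> Omega -> R) (W_wiener : wiener_martingale P F W)
    (T p : R) (T_gt0 : 0 < T) (p_ge2 : 2 <= p)
    (A : R -> V -> Omega -> dual V) (B : 'I_r -> R -> V -> Omega -> H)
    (AB_adapted : adapted_coefficients G T A B F)
    (K1 K1bar lam K2 : R -> R) (alpha : R)
    (K1_int : nonneg_integrable T K1) (K1bar_int : nonneg_integrable T K1bar)
    (lam_int : pos_integrable T lam) (K2_int : nonneg_integrable T K2)
    (alpha_ge1 : 1 <= alpha)
    (C1 : monotonicity P T A B)
    (C2 : coercivity G P T A B p K1 K1bar lam)
    (C3 : hemicontinuity P T A)
    (C4 : growth P T A p (p / (p - 1)) alpha lam K2)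
    (u0 : Omega -> H) (C5 : initial_condition P F u0) :
  (exists m0 : nat, (1 <= m0)%N /\
     forall m : nat, (m0 <= m)%N ->
     well_posed P p m (time_scheme G P F T W A B u0 m)) /\
  (forall (Vn : nat -> set V) (Pi : nat -> {linear dual V -> V}),
     space_discretization Vn Pi ->
     self_adjoint_projections G Vn Pi ->
     contractive_approximation G Pi ->
     exists m0 : nat, (1 <= m0)%N /\
       forall m n : nat, (m0 <= m)%N -> (1 <= n)%N ->
       well_posed P p m (space_time_scheme G P F T W A B u0 m (Vn n) (Pi n))).
Proof.
have sub K : (@lebesgue_measure R).-integrable `[0, T] (EFin \o K) ->
    (@lebesgue_measure R).-integrable `]0, T] (EFin \o K).
  apply: integrableS => // s /=; rewrite !in_itv/= => /andP[/ltW -> ->].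
  by [].
have [k Ik reg] := regular_coefficients_of_conditions p_ge2 alpha_ge1 AB_adapted
  K1_int K1bar_int lam_int K2_int C1 C2 C3 C4.
have [K1_ge0 /sub IK1] := K1_int; have [_ /sub IK1bar] := K1bar_int.
have [lam_gt0 Ilam] := lam_int.
have [m0 m0_gt0 small] : exists2 m0, (1 <= m0)%N & forall m, (m0 <= m)%N ->
    forall i, (i < m)%N -> \int[@lebesgue_measure R]_(s in
      (`]grid T m i, grid T m i.+1]%classic : set R)) K1 s <= 1.
  have [|de de0 hde] := small_cell_integrals T_gt0 IK1.
    by move=> t /andP[/ltW t0 tT]; apply: K1_ge0; rewrite t0.
  exists (Num.bound (T / de)).+1 => // m m0m i im.
  have m_gt0 : (0 < m)%N by exact: leq_trans m0m.
  apply: hde; [exact: grid_ge0|exact: grid_lt|exact: grid_le|].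
  rewrite gridB /step ler_pdivrMr ?ltr0n// mulrC -ler_pdivrMr//.
  have /archi_boundP/ltW h : 0 <= T / de by rewrite divr_ge0// ltW.
  by rewrite (le_trans h)// ler_nat ltnW.
have wp m (m_gt0 : (0 < m)%N) m0m :=
  projected_well_posed F_usual W_wiener T_gt0 p_ge2 V_separable V_reflexive AB_adapted
    reg Ik IK1 IK1bar Ilam lam_gt0 C5 m_gt0 (small m m0m).
split.
  exists m0; split=> // m m0m; have m_gt0 : (0 < m)%N by exact: leq_trans m0m.
  apply: (wp m m_gt0 m0m idfun) => //.
  - by move=> x; exact: cvg_id.
  - by move=> u au _ su; split=> //; apply: filterS su => w /time_schemeE; exact.
  - by move=> v [_ sv]; apply: filterS sv => w hw; apply/time_schemeE.
move=> Vn Pi sd sa _; exists m0; split=> // m n m0m n1.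
have m_gt0 : (0 < m)%N by exact: leq_trans m0m.
have [_ cPi Pi_Vn] := sd n n1; have [Pi_id _ Pi_adj] := sa n n1.
have stE := space_time_schemeE W A B u0 T_gt0 m_gt0 Pi_id Pi_adj.
apply: (wp m m_gt0 m0m (sandwich G (Pi n))).
- exact: continuous_sandwich.
- exact: (sandwich_idem Pi_Vn Pi_id).
- move=> u au piu su; have uV i : (i <= m)%N -> forall w, Vn n (u i w).
    by move=> im w; rewrite -piu//; exact: Pi_Vn.
  split=> //; apply: filterS su => w.
  by rewrite stE// => i im; exact: uV.
- move=> v [_ vV sv]; apply: filterS sv => w.
  by rewrite stE// => i im; exact: vV.
Qed.
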